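(* Let a cavitation solution $(P,Q)$ satisfy the following hypotheses and be a global energy minimizer of $E(\cdot,\cdot)$ in $\mathcal{B}_+$: (i) $(P,Q)\in\mathcal{B}_+\cap H^l(\Lambda;H^l_\omega(I))$ for an integer $l>6$, and $(P,Q)$ is the energy minimizer in $\mathcal{B}_+$; (ii) there exist constants $c_F>1$ and $c_D>1$ such that $c_F^{-1}\le 2r^2F(P,Q)\le c_F$ and $c_D^{-1}\le D(P,Q)\le c_D$ on $\overline{\Omega'}$. Let $(P^{NM},Q^{NM})$ be a global energy minimizer of $E(\cdot,\cdot)$ in $\mathcal{B}^{NM}_+$. Then there exists a constant $C>0$, independent of $M$ and $N$, such that for all sufficiently large $M$, $N$, $$E(P,Q)\le E(P^{NM},Q^{NM})\le E(P,Q)+C\left(M^{2-l}+N^{1-l}\right).$$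
   Context: Fixed numbers $0<\varepsilon\ll\gamma\le1$ (so $\varepsilon<\gamma$, with $\varepsilon$ thought of as much smaller than $\gamma$), $\kappa>0$, $1<p<2$. The function $h\in C^3((0,\infty))$ is strictly convex with $h(t)\to+\infty$ as $t\to0^+$ and $h(t)/t\to+\infty$ as $t\to+\infty$. The stored energy density $W(A)=\kappa|A|^p+h(\det A)$ (Frobenius norm) maps the $2\times2$ matrices with positive determinant into $\mathbb{R}^+=(0,\infty)$. Put $g(t)=\kappa(\sqrt{2t})^p$. Let $\Omega_{(\varepsilon,\gamma)}=\{\mathbf{x}\in\mathbb{R}^2:\varepsilon<|\mathbf{x}|<\gamma\}$, let $\mathbf{u}_0$ be given smooth boundary data on $|\mathbf{x}|=\gamma$, and let $\mathcal{A}_{(\varepsilon,\gamma)}(\mathbf{u}_0)$ be the set of $\mathbf{u}\in W^{1,p}(\Omega_{(\varepsilon,\gamma)};\mathbb{R}^2)$ that are one-to-one a.e., satisfy $\mathbf{u}=\mathbf{u}_0$ on $|\mathbf{x}|=\gamma$, and have $\det\nabla\mathbf{u}>0$ a.e. Coordinates: $I=(-1,1)$, $\Lambda=(0,2\pi)$, $\Omega'=I\times\Lambda$ with coordinates $(\rho,\phi)$, $r=\frac{\gamma+\varepsilon}{2}+\frac{\gamma-\varepsilon}{2}\rho$, $\theta=\phi$, $\rho_r=2/(\gamma-\varepsilon)$. A pair $(P,Q)$ of functions on $\Omega'$ corresponds to the map $\mathbf{u}(r\cos\theta,r\sin\theta)=P(\rho,\phi)\left(\cos(Q(\rho,\phi)+\phi),\sin(Q(\rho,\phi)+\phi)\right)$.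 With subscripts denoting partial derivatives, $$D(P,Q)=\frac{\rho_r}{r}P[P_\rho(Q_\phi+1)-P_\phi Q_\rho],\quad F(P,Q)=\frac{\rho_r^2}{2}(P_\rho^2+P^2Q_\rho^2)+\frac1{2r^2}[P_\phi^2+P^2(Q_\phi+1)^2],$$ which are $\det\nabla\mathbf{u}$ and $\frac12|\nabla\mathbf{u}|^2$, and $$E(P,Q)=\int_{\Omega'}\left[g(F(P,Q))+h(D(P,Q))\right]\frac{r}{\rho_r}\,d\rho\,d\phi=\int_{\Omega_{(\varepsilon,\gamma)}}W(\nabla\mathbf{u})\,d\mathbf{x}.$$ $\mathcal{A}_{\Omega'}(\mathbf{u}_0)$ is the set of pairs $(P,Q)$ corresponding to some $\mathbf{u}\in\mathcal{A}_{(\varepsilon,\gamma)}(\mathbf{u}_0)$. A cavitation solution is a pair $(P,Q)\in\mathcal{A}_{\Omega'}(\mathbf{u}_0)$ minimizing $E$ in $\mathcal{A}_{\Omega'}(\mathbf{u}_0)$. Sets of functions: $P_0(1,\phi),Q_0(1,\phi)$ are defined by $\mathbf{u}_0(\gamma\cos\phi,\gamma\sin\phi)=P_0(1,\phi)(\cos(Q_0(1,\phi)+\phi),\sin(Q_0(1,\phi)+\phi))$. $\mathcal{B}=\{(P,Q)\in C^1(\overline{\Omega'}):P(1,\phi)=P_0(1,\phi),\ Q(1,\phi)=Q_0(1,\phi)\}$ and $\mathcal{B}_+=\{(P,Q)\in\mathcal{B}:D(P,Q)>0 \text{ on }\overline{\Omega'}\}$. For even $N\ge2$ and $M\ge1$,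 $\mathcal{B}^{NM}$ is the set of pairs $(P^{NM},Q^{NM})$ of functions of the form $\sum_{j=0}^M\left(\sum_{k=0}^{N/2}a_{k,j}\cos k\phi+\sum_{k=1}^{N/2-1}b_{k,j}\sin k\phi\right)T_j(\rho)$, $T_j(x)=\cos(j\arccos x)$, real coefficients, with $P^{NM}(1,\phi_n)=P_0(1,\phi_n)$ and $Q^{NM}(1,\phi_n)=Q_0(1,\phi_n)$ for $\phi_n=2\pi n/N$, $0\le n\le N-1$. Further $\mathcal{B}^{NM}_+=\mathcal{B}^{NM}\cap\mathcal{B}_+$. Spaces: with $\omega(\rho)=(1-\rho^2)^{-1/2}$, $H^l(\Lambda;H^l_\omega(I))$ is the space of functions $v$ with $\sum_{k=0}^l\sum_{j=0}^l\int_\Lambda\int_I|\partial_\phi^k\partial_\rho^jv|^2\omega\,d\rho\,d\phi<\infty$, the functions being understood as $2\pi$-periodic in $\phi$ (the weak derivatives are those of the $2\pi$-periodic extension). A pair belongs to it if both components do. *)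

(* Defs.v *)
From HB Require Import structures.
From mathcomp Require Import all_boot all_order all_algebra.
From mathcomp Require Import all_classical all_reals all_analysis.
Set Implicit Arguments.
Unset Strict Implicit.
Unset Printing Implicit Defensive.
Import Order.TTheory GRing.Theory Num.Theory.
Import numFieldNormedType.Exports.
Local Open Scope classical_set_scope.
Local Open Scope ring_scope.

Definition leb2 (R : realType) : {measure set (measurableTypeR R * measurableTypeR R) -> \bar R} :=
  (@lebesgue_measure R \x @lebesgue_measure R)%E.

Definition crd (R : realType) (i : 'I_2) (x : R * R) : R :=
  if i == ord0 then x.1 else x.2.

Definition set_crd (R : realType) (i : 'I_2) (x : R * R) (t : R) : R * R :=
  if i == ord0 then (t, x.2) else (x.1, t).

(** Classical partial derivatives; index 0 is the first variable, 1 the second. *)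
Definition pderivable (R : realType) (i : 'I_2) (f : R * R -> R) (x : R * R) :=
  derivable (fun t : R => f (set_crd i x t)) (crd i x) 1.

Definition pd (R : realType) (i : 'I_2) (f : R * R -> R) (x : R * R) : R :=
  derive1 (fun t : R => f (set_crd i x t)) (crd i x).

Definition pds (R : realType) (s : seq 'I_2) (f : R * R -> R) : R * R -> R :=
  foldr (@pd R) f s.

Definition smooth2 (R : realType) (f : R * R -> R) :=
  forall s : seq 'I_2, continuous (pds s f) /\
    forall i x, pderivable i (pds s f) x.

Definition test_fun (R : realType) (U : set (R * R)) (psi : R * R -> R) :=
  smooth2 psi /\
  exists K : set (R * R),
    [/\ compact K, K `<=` U & forall x, ~ K x -> psi x = 0].

Definition loc_integrable (R : realType) (U : set (R * R)) (f : R * R -> R) :=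
  [/\ measurable_fun (U : set (measurableTypeR R * measurableTypeR R)) f, open U
    & forall K : set (R * R), K `<=` U -> compact K ->
      (\int[leb2 R]_(x in K) (`|f x|%:E) < +oo)%E].

(** [G] is the weak derivative of [f] on [U], the multi-index being the list
    of variables [s]. *)
Definition weak_der (R : realType) (U : set (R * R)) (s : seq 'I_2)
    (f G : R * R -> R) :=
  [/\ loc_integrable U f, loc_integrable U G
    & forall psi, test_fun U psi ->
      (\int[leb2 R]_(x in U) ((f x * pds s psi x)%:E) =
       \int[leb2 R]_(x in U) (((-1) ^+ size s * (G x * psi x))%:E))%E].

Definition in_Lp (R : realType) (U : set (R * R)) (p : R) (f : R * R -> R) :=
  measurable_fun (U : set (measurableTypeR R * measurableTypeR R)) f /\
  (\int[leb2 R]_(x in U) ((`|f x| `^ p)%:E) < +oo)%E.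

Definition is_wgrad (R : realType) (U : set (R * R)) (u : R * R -> R * R)
    (G : R * R -> 'M[R]_2) :=
  forall i j, weak_der U [:: j] (fun x => crd i (u x)) (fun x => G x i j).

(** The weak gradient (unique up to a null set), zero if there is none. *)
Definition wgrad (R : realType) (U : set (R * R)) (u : R * R -> R * R) :
    R * R -> 'M[R]_2 :=
  xget (fun _ => 0) [set G | is_wgrad U u G].

Definition in_W1p (R : realType) (U : set (R * R)) (p : R)
    (u : R * R -> R * R) :=
  [/\ forall i, in_Lp U p (fun x => crd i (u x)),
      is_wgrad U u (wgrad U u)
    & forall i j, in_Lp U p (fun x => wgrad U u x i j)].

Definition frob (R : realType) (A : 'M[R]_2) : R :=
  Num.sqrt (\sum_i \sum_j A i j ^+ 2).

Definition stored_energy (R : realType) (kappa p : R) (h : R -> R)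
    (A : 'M[R]_2) : R :=
  kappa * frob A `^ p + h (\det A).

Definition strictly_convex_pos (R : realType) (h : R -> R) :=
  forall x y t : R, 0 < x -> 0 < y -> x != y -> 0 < t -> t < 1 ->
    h (t * x + (1 - t) * y) < t * h x + (1 - t) * h y.

Definition C3_pos (R : realType) (h : R -> R) :=
  (forall (n : nat) (x : R), (n < 3)%N -> 0 < x -> derivable (derive1n n h) x 1) /\
  (forall x : R, 0 < x -> {for x, continuous (derive1n 3 h)}).

Definition annulus (R : realType) (eps gam : R) : set (R * R) :=
  [set x | eps < Num.sqrt (x.1 ^+ 2 + x.2 ^+ 2) < gam].

Definition circ (R : realType) (r phi : R) : R * R :=
  (r * cos phi, r * sin phi).

(** Smoothness of boundary data, which only matter on the circle of rad_of [gam]. *)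
Definition smooth_on_circle (R : realType) (gam : R) (u0 : R * R -> R * R) :=
  forall (i : 'I_2) (n : nat) (phi : R),
    derivable (derive1n n (fun t : R => crd i (u0 (circ gam t)))) phi 1.

(** [u = u0] on the circle [|x| = gam] in the sense of traces: the trace is the
    [L^p] limit of the boundary values of smooth functions converging to [u]
    in [W^{1,p}]. *)
Definition outer_trace (R : realType) (eps gam p : R)
    (u u0 : R * R -> R * R) :=
  forall i : 'I_2, exists w : nat -> R * R -> R,
    [/\ forall n, smooth2 (w n),
        (\int[leb2 R]_(x in annulus eps gam)
           ((`|w n x - crd i (u x)| `^ p)%:E) @[n --> \oo] --> 0)%E,
        forall j, (\int[leb2 R]_(x in annulus eps gam)
           ((`|pd j (w n) x - wgrad (annulus eps gam) u x i j| `^ p)%:E)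
             @[n --> \oo] --> 0)%E
      & (\int[@lebesgue_measure R]_(t in `[0%R, (2 * pi)%R])
           ((`|w n (circ gam t) - crd i (u0 (circ gam t))| `^ p)%:E)
             @[n --> \oo] --> 0)%E].

Definition injective_ae (R : realType) (U : set (R * R))
    (u : R * R -> R * R) :=
  exists Z : set (R * R), (leb2 R).-negligible Z /\
    forall x y, U x -> U y -> ~ Z x -> ~ Z y -> u x = u y -> x = y.

Definition admissible (R : realType) (eps gam p : R) (u0 u : R * R -> R * R) :=
  [/\ in_W1p (annulus eps gam) p u,
      injective_ae (annulus eps gam) u,
      outer_trace eps gam p u u0
    & {ae leb2 R, forall x, annulus eps gam x ->
         0 < \det (wgrad (annulus eps gam) u x)}].

Definition total_energy (R : realType) (eps gam kappa p : R) (h : R -> R)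
    (u : R * R -> R * R) : \bar R :=
  (\int[leb2 R]_(x in annulus eps gam)
     ((stored_energy kappa p h (wgrad (annulus eps gam) u x))%:E))%E.

(** Points of the computational domain are pairs [(rho, phi)]. *)
Definition Omega' (R : realType) : set (R * R) :=
  [set z | -1 < z.1 < 1 /\ 0 < z.2 < 2 * pi].

Definition clOmega' (R : realType) : set (R * R) :=
  [set z | -1 <= z.1 <= 1 /\ 0 <= z.2 <= 2 * pi].

Arguments Omega' R : clear implicits.
Arguments clOmega' R : clear implicits.

Definition rad_of (R : realType) (eps gam rho : R) : R :=
  (gam + eps) / 2 + (gam - eps) / 2 * rho.

Definition rho_r (R : realType) (eps gam : R) : R := 2 / (gam - eps).

Definition pair_of (R : realType) := ((R * R -> R) * (R * R -> R))%type.

Definition corresponds (R : realType) (eps gam : R) (PQ : pair_of R)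
    (u : R * R -> R * R) :=
  {ae leb2 R, forall z, Omega' R z ->
     u (circ (rad_of eps gam z.1) z.2) = circ (PQ.1 z) (PQ.2 z + z.2)}.

Definition A_Omega' (R : realType) (eps gam p : R) (u0 : R * R -> R * R) :
    set (pair_of R) :=
  [set PQ | exists2 u, admissible eps gam p u0 u & corresponds eps gam PQ u].

(** A pair in [A_Omega'] need not be differentiable (the angle is only defined
    up to multiples of [2 * pi]), so its energy is that of the corresponding
    map, which is determined almost everywhere by the pair; for pairs with
    classical derivatives it is given by [energy] below. *)
Definition cavitation_solution (R : realType) (eps gam kappa p : R)
    (h : R -> R) (u0 : R * R -> R * R) (PQ : pair_of R) :=
  exists u, [/\ admissible eps gam p u0 u, corresponds eps gam PQ u
    & forall PQ' v, A_Omega' eps gam p u0 PQ' -> admissible eps gam p u0 v ->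
        corresponds eps gam PQ' v ->
        (total_energy eps gam kappa p h u <=
         total_energy eps gam kappa p h v)%E].

(** The classical partial derivative on the open rectangle, extended by limits
    to the closed one. *)
Definition bpd (R : realType) (i : 'I_2) (f : R * R -> R) (z : R * R) : R :=
  lim (pd i f x @[x --> within (Omega' R) (nbhs z)]).

(** [C^1] on the closed rectangle. At interior points the convergence expresses
    continuity of the derivative, since the filter contains the point itself. *)
Definition C1_bar (R : realType) (f : R * R -> R) :=
  [/\ {within clOmega' R, continuous f},
      forall i z, Omega' R z -> pderivable i f z
    & forall i z, clOmega' R z ->
        cvg (pd i f x @[x --> within (Omega' R) (nbhs z)])].

Notation d_rho := (@ord0 1).
Notation d_phi := (@ord_max 1).

Definition Dfun (R : realType) (eps gam : R) (PQ : pair_of R) (z : R * R) : R :=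
  let: (P, Q) := PQ in
  rho_r eps gam / rad_of eps gam z.1 * P z *
    (bpd d_rho P z * (bpd d_phi Q z + 1) - bpd d_phi P z * bpd d_rho Q z).

Definition Ffun (R : realType) (eps gam : R) (PQ : pair_of R) (z : R * R) : R :=
  let: (P, Q) := PQ in
  rho_r eps gam ^+ 2 / 2 * (bpd d_rho P z ^+ 2 + P z ^+ 2 * bpd d_rho Q z ^+ 2)
  + (2 * rad_of eps gam z.1 ^+ 2)^-1 *
    (bpd d_phi P z ^+ 2 + P z ^+ 2 * (bpd d_phi Q z + 1) ^+ 2).

Definition gfun (R : realType) (kappa p t : R) : R :=
  kappa * Num.sqrt (2 * t) `^ p.

Definition energy (R : realType) (eps gam kappa p : R) (h : R -> R)
    (PQ : pair_of R) : \bar R :=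
  (\int[leb2 R]_(z in Omega' R)
     (((gfun kappa p (Ffun eps gam PQ z) + h (Dfun eps gam PQ z)) *
       (rad_of eps gam z.1 / rho_r eps gam))%:E))%E.

(** [P0 phi] and [Q0 phi] stand for the boundary values at [(1, phi)]. *)
Definition boundary_polar (R : realType) (gam : R) (u0 : R * R -> R * R)
    (P0 Q0 : R -> R) :=
  forall phi : R, 0 <= phi <= 2 * pi ->
    u0 (circ gam phi) = circ (P0 phi) (Q0 phi + phi).

Definition B (R : realType) (P0 Q0 : R -> R) : set (pair_of R) :=
  [set PQ | [/\ C1_bar PQ.1, C1_bar PQ.2
    & forall phi : R, 0 <= phi <= 2 * pi ->
        PQ.1 (1, phi) = P0 phi /\ PQ.2 (1, phi) = Q0 phi]].

Definition Bplus (R : realType) (eps gam : R) (P0 Q0 : R -> R) :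
    set (pair_of R) :=
  B P0 Q0 `&` [set PQ | forall z, clOmega' R z -> 0 < Dfun eps gam PQ z].

Definition cheb (R : realType) (j : nat) (x : R) : R := cos (j%:R * acos x).

Definition fourier_cheb (R : realType) (N M : nat) (f : R * R -> R) :=
  exists a b : nat -> nat -> R, forall z, clOmega' R z ->
    f z = \sum_(0 <= j < M.+1)
      (\sum_(0 <= k < N./2.+1) a k j * cos (k%:R * z.2) +
       \sum_(1 <= k < N./2) b k j * sin (k%:R * z.2)) * cheb j z.1.

Definition node (R : realType) (N n : nat) : R := 2 * pi * n%:R / N%:R.

Definition B_NM (R : realType) (P0 Q0 : R -> R) (N M : nat) :
    set (pair_of R) :=
  [set PQ | [/\ fourier_cheb N M PQ.1, fourier_cheb N M PQ.2
    & forall n : nat, (n < N)%N ->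
        PQ.1 (1, node R N n) = P0 (node R N n) /\
        PQ.2 (1, node R N n) = Q0 (node R N n)]].

Definition Bplus_NM (R : realType) (eps gam : R) (P0 Q0 : R -> R)
    (N M : nat) : set (pair_of R) :=
  B_NM P0 Q0 N M `&` Bplus eps gam P0 Q0.

Definition minimizer (R : realType) (T : Type) (E : T -> \bar R) (S : set T)
    (x : T) :=
  S x /\ forall y, S y -> (E x <= E y)%E.

Definition periodize (R : realType) (v : R * R -> R) (z : R * R) : R :=
  v (z.1, z.2 - 2 * pi * (Num.floor (z.2 / (2 * pi)))%:~R).

Definition strip (R : realType) : set (R * R) := [set z | -1 < z.1 < 1].

Arguments strip R : clear implicits.

Definition cheb_weight (R : realType) (rho : R) : R :=
  (1 - rho ^+ 2) `^ (- 2^-1).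

(** [Gd k j] is the mixed weak derivative, of order [k] in phi and [j] in rho,
    of the periodic extension. *)
Definition in_Hl (R : realType) (l : nat) (v : R * R -> R) :=
  exists Gd : nat -> nat -> R * R -> R,
    (forall k j, (k <= l)%N -> (j <= l)%N ->
       weak_der (strip R) (nseq k d_phi ++ nseq j d_rho)
         (periodize v) (Gd k j)) /\
    (\sum_(0 <= k < l.+1) \sum_(0 <= j < l.+1)
       \int[leb2 R]_(z in Omega' R)
         ((`|Gd k j z| ^+ 2 * cheb_weight z.1)%:E) < +oo)%E.

(* Main.v *)
Require Import Defs.
From HB Require Import structures.
From mathcomp Require Import all_boot all_order all_algebra.
From mathcomp Require Import all_classical all_reals all_analysis measurable_realfun.
From mathcomp Require Import ring lra zify.
Set Implicit Arguments.
Unset Strict Implicit.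
Unset Printing Implicit Defensive.
Import Order.TTheory GRing.Theory Num.Theory.
Import numFieldNormedType.Exports.
Local Open Scope classical_set_scope.
Local Open Scope ring_scope.

(** Minimality turns first-order smallness into second-order smallness without
    differentiating [E]: if [(P, Q) + e] and [(P, Q) - e] both lie in [B_+], then
    [E ((P, Q) + e) - E (P, Q) <= E ((P, Q) + e) + E ((P, Q) - e) - 2 E (P, Q)],
    and the second difference on the right is bounded by [C |e|^2] in the [C^1]
    norm. It is thus enough to find [(P, Q) + e] in [B^NM_+] with
    [|e| <= C (M^(3-l) + N^(2-l))], whose square is of the required order.

    If some [B^NM_+] is inhabited, the boundary data are trigonometric
    polynomials on [[0, 2 pi]], which Fourier partial sums reproduce. The
    competitor is the Fourier partial sum in [phi] in which every coefficient
    [a (rho)] is replaced by [a 1 - \int_rho^1] of the Chebyshev truncation of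
    [a']: it has the exact trace at [rho = 1]. The decay of the coefficients
    comes from testing the weak derivatives with products of a smoothed
    indicator function in [rho] and a truncated harmonic in [phi]. *)

(** * Continuity and integrals over a segment *)

(** The obstacle is that regularity comes in two forms that do not match: one classical derivative
    on the closed rectangle, and weak derivatives of order up to [l] in each variable for the
    periodic extension on the strip. A Fourier coefficient is therefore never differentiated more
    than once; higher regularity enters only through integrals against derivatives of smoothed
    indicators, bounded uniformly in the width of the smoothing. The exponents count the losses. In
    [M], one order goes to the derivative in [rho], one to turning weak bounds into sup bounds, one
    to summing a tail: [3 - l]. In [N], one goes to the derivative in [phi] and one to the tail:
    [2 - l]. Squaring more than recovers them. The reflected pair need not be a Fourier-Chebyshev
    sum, but it must have the right trace on the whole edge [rho = 1], which is why the trace of the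
    competitor has to be exact. Membership in [B^NM_+] includes the same condition on the whole
    edge, so that one member forces the data to be trigonometric polynomials. The bounds on [D] and
    [F] confine the arguments of [g] and [h] to a compact part of the positive half-line, where
    Taylor bounds hold. *)

Section ContinuityRules.
Context {R : realType} {T : topologicalType}.
Implicit Types f g : T -> R.

Lemma ct_cst (c : R) : continuous (fun _ : T => c).
Proof. exact: cst_continuous. Qed.

Lemma ct_add f g : continuous f -> continuous g -> continuous (fun x => f x + g x).
Proof. by move=> cf cg x; apply: cvgD; [exact: cf|exact: cg]. Qed.

Lemma ct_opp f : continuous f -> continuous (fun x => - f x).
Proof. by move=> cf x; apply: cvgN; exact: cf. Qed.

Lemma ct_mul f g : continuous f -> continuous g -> continuous (fun x => f x * g x).
Proof. by move=> cf cg x; apply: cvgM; [exact: cf|exact: cg]. Qed.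

Lemma ct_exp f n : continuous f -> continuous (fun x => f x ^+ n).
Proof.
move=> cf; elim: n => [|n IH]; first exact: ct_cst.
by rewrite (_ : (fun x => _) = (fun x => f x * f x ^+ n)); [exact: ct_mul|
  apply/funext => x; rewrite exprS].
Qed.

Lemma ct_comp (h : R -> R) f : continuous h -> continuous f ->
  continuous (fun x => h (f x)).
Proof. by move=> ch cf x; apply: (continuous_comp (cf x)); exact: ch. Qed.

Lemma ct_cos f : continuous f -> continuous (fun x => cos (f x)).
Proof. exact/ct_comp/continuous_cos. Qed.

Lemma ct_sin f : continuous f -> continuous (fun x => sin (f x)).
Proof. exact/ct_comp/continuous_sin. Qed.

Lemma ct_norm f : continuous f -> continuous (fun x => `|f x|).
Proof. by move=> cf x; apply: cvg_norm; exact: cf. Qed.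

Lemma ct_sum (I : Type) (s : seq I) (F : I -> T -> R) :
  (forall i, continuous (F i)) -> continuous (fun x => \sum_(i <- s) F i x).
Proof.
move=> cF; elim: s => [|i s IH] x.
  by under eq_fun do rewrite big_nil; exact: cvg_cst.
under eq_fun do rewrite big_cons; apply: cvgD; [exact: cF|exact: IH].
Qed.

End ContinuityRules.

Lemma ct_id (R : realType) : continuous (fun x : R => x).
Proof. by move=> x; exact: cvg_id. Qed.

Lemma ct_fst (R : realType) : continuous (fun z : R * R => z.1).
Proof. by move=> z; exact: cvg_fst. Qed.

Lemma ct_snd (R : realType) : continuous (fun z : R * R => z.2).
Proof. by move=> z; exact: cvg_snd. Qed.

Ltac cts_step :=
  lazymatch goal with |- forall x, @continuous_at _ _ x ?f =>
    lazymatch f with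
    | (fun _ => ?c) => exact: ct_cst
    | (fun x => x) => exact: ct_id
    | id => exact: ct_id
    | fst => exact: ct_fst
    | snd => exact: ct_snd
    | (fun x => x.1) => exact: ct_fst
    | (fun x => x.2) => exact: ct_snd
    | GRing.mul _ => apply: ct_mul
    | GRing.add _ => apply: ct_add
    | GRing.opp => exact: (ct_opp (@ct_id _))
    | cos => exact: continuous_cos
    | sin => exact: continuous_sin
    | (fun x => cos _) => apply: ct_cos
    | (fun x => sin _) => apply: ct_sin
    | (fun x => - _) => apply: ct_opp
    | (fun x => _ + _) => apply: ct_add
    | (fun x => _ * _) => apply: ct_mul
    | (fun x => _ ^+ _) => apply: ct_exp
    | (fun x => `|_|) => apply: ct_norm
    | _ => match goal with H : forall x, @continuous_at _ _ x ?g |- _ =>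
             lazymatch f with (fun x => g _) => apply: (ct_comp H) end
           end
    end
  end.
Ltac cts := repeat first [assumption | cts_step].

Definition ri (R : realType) (a b : R) (f : R -> R) : R :=
  (\int[@lebesgue_measure R]_(x in `[a, b]) f x)%R.

Lemma ri_integrable (R : realType) (a b : R) (f : R -> R) : continuous f ->
  (@lebesgue_measure R).-integrable `[a, b] (EFin \o f).
Proof.
move=> cf; apply: continuous_compact_integrable; first exact: segment_compact.
exact: continuous_subspaceT.
Qed.

Lemma ri_ext (R : realType) (a b : R) (f g : R -> R) :
  (forall x, a <= x <= b -> f x = g x) -> ri a b f = ri a b g.
Proof.
move=> fg; apply: eq_Rintegral => x; rewrite inE/= in_itv/=; exact: fg.
Qed.

Lemma riD (R : realType) (a b : R) (f g : R -> R) : continuous f ->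
  continuous g -> ri a b (fun x => f x + g x) = ri a b f + ri a b g.
Proof. by move=> cf cg; apply: RintegralD => //; exact: ri_integrable. Qed.

Lemma riB (R : realType) (a b : R) (f g : R -> R) : continuous f ->
  continuous g -> ri a b (fun x => f x - g x) = ri a b f - ri a b g.
Proof. by move=> cf cg; apply: RintegralB => //; exact: ri_integrable. Qed.

Lemma riZ (R : realType) (a b c : R) (f : R -> R) : continuous f ->
  ri a b (fun x => c * f x) = c * ri a b f.
Proof. by move=> cf; apply: RintegralZl => //; exact: ri_integrable. Qed.

Lemma ri_cst (R : realType) (a b c : R) : a <= b ->
  ri a b (fun=> c) = c * (b - a).
Proof.
move=> ab; rewrite /ri Rintegral_cst//= lebesgue_measure_itv/= lte_fin.
by case: ltgtP ab => //= -> _; rewrite subrr.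
Qed.

Lemma le_ri (R : realType) (a b : R) (f g : R -> R) : continuous f ->
  continuous g -> (forall x, a <= x <= b -> f x <= g x) -> ri a b f <= ri a b g.
Proof.
move=> cf cg fg; apply: le_Rintegral => //; try exact: ri_integrable.
all: by move=> x /=; rewrite in_itv/=; exact: fg.
Qed.

Lemma ri_sum (R : realType) (a b : R) (I : Type) (s : seq I) (F : I -> R -> R) :
  (forall i, continuous (F i)) ->
  ri a b (fun x => \sum_(i <- s) F i x) = \sum_(i <- s) ri a b (F i).
Proof.
move=> cF; elim: s => [|i s IH].
  rewrite big_nil; under ri_ext do rewrite big_nil.
  by rewrite /ri Rintegral_cst// mul0r.
rewrite big_cons -IH -riD//.
  by apply: ri_ext => x _; rewrite big_cons.
exact: ct_sum.
Qed.

Lemma ri_norm_le (R : realType) (a b M : R) (f : R -> R) : a <= b ->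
  continuous f -> (forall x, a <= x <= b -> `|f x| <= M) ->
  `|ri a b f| <= M * (b - a).
Proof.
move=> ab cf fM; rewrite ler_norml; apply/andP; split.
  rewrite -mulNr -ri_cst//; apply: le_ri => //; first exact: cst_continuous.
  by move=> x /fM; rewrite ler_norml => /andP[].
rewrite -ri_cst//; apply: le_ri => //; first exact: cst_continuous.
by move=> x /fM; rewrite ler_norml => /andP[].
Qed.

Lemma ri_FTC2 (R : realType) (a b : R) (f F : R -> R) : a <= b ->
  continuous f -> (forall x, a <= x <= b -> {for x, continuous F}) ->
  (forall x, a < x < b -> is_derive x 1 F (f x)) ->
  ri a b f = F b - F a.
Proof.
rewrite le_eqVlt => /predU1P[->|ab] cf cF dF.
  by rewrite /ri set_itv1 Rintegral_set1 subrr.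
rewrite /ri /Rintegral (@continuous_FTC2 _ f F)//=.
- exact: continuous_subspaceT.
- split.
  + by move=> x; rewrite in_itv/= => /dF [].
  + by apply: cvg_at_right_filter; apply: cF; rewrite lexx ltW.
  + by apply: cvg_at_left_filter; apply: cF; rewrite lexx ltW.
- by move=> x; rewrite in_itv/= => /dF xF; rewrite derive1E; apply: derive_val.
Qed.

Lemma is_derive_continuous (R : realType) (f : R -> R) (x d : R) :
  is_derive x 1 f d -> {for x, continuous f}.
Proof.
by case=> df _; apply: differentiable_continuous; apply/derivable1_diffP.
Qed.

Lemma ri_FTC2_cc (R : realType) (a b : R) (f F : R -> R) : a <= b ->
  continuous f -> (forall x, a <= x <= b -> is_derive x 1 F (f x)) ->
  ri a b f = F b - F a.
Proof.
move=> ab cf dF; apply: ri_FTC2 => // x xab.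
  exact: is_derive_continuous (dF x xab).
by apply: dF; case/andP: xab => /ltW -> /ltW ->.
Qed.

Lemma ri_primitive (R : realType) (A : R) (f : R -> R) : continuous f ->
  forall x, A < x -> is_derive x 1 (fun t => ri A t f) (f x).
Proof.
move=> cf x Ax.
have [|d e] := @continuous_FTC1_closed R f A x (x + 1) _ (ri_integrable _ _ cf) Ax (cf x).
  by rewrite ltrDl.
by apply: (DeriveDef d); rewrite -derive1E e.
Qed.

Lemma riE (R : realType) (a b : R) (f : R -> R) :
  ri a b f = (\int[@lebesgue_measure R]_(x in `[a, b]) f x)%R.
Proof. by []. Qed.

Lemma riE_oo (R : realType) (a b : R) (f : R -> R) : continuous f ->
  ri a b f = (\int[@lebesgue_measure R]_(x in `]a, b[) f x)%R.
Proof.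
move=> cf; have if_ := ri_integrable a b cf.
rewrite /ri -Rintegral_itv_bndo_bndc; last first.
  by apply: integrableS if_ => //; exact: subset_itv_co_cc.
rewrite -Rintegral_itv_obnd_cbnd//.
by apply: integrableS if_ => //; exact: subset_itv_oo_cc.
Qed.

Global Opaque ri.

Lemma ri_split (R : realType) (a b c : R) (f : R -> R) : continuous f ->
  a <= c -> c <= b -> ri a b f = ri a c f + ri c b f.
Proof.
move=> cf ac cb.
(* The primitive starts at [a - 1] because [ri_primitive] differentiates only strictly to the right
   of its base point, and [u = a] must be covered. *)
have E u v : a <= u -> u <= v -> ri u v f = ri (a - 1) v f - ri (a - 1) u f.
  move=> au uv; apply: (@ri_FTC2_cc _ u v f (fun t => ri (a - 1) t f)) => // x /andP[ux xv].
  by apply: ri_primitive => //; lra.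
have ab := le_trans ac cb.
rewrite (E a b) ?(E a c) ?(E c b) ?lexx//; ring.
Qed.

Lemma is_derive_affine (R : realType) (f : R -> R) (a b x d : R) :
  is_derive (a * x + b) 1 f d ->
  is_derive x 1 (fun t => f (a * t + b)) (a * d).
Proof.
move=> fd; rewrite mulrC.
have D : is_derive x 1 (fun t : R => a * t + b) a.
  apply: is_derive_eq; rewrite ?addr0 /GRing.scale/=; ring.
exact: (@is_derive1_comp _ f (fun t : R => a * t + b)).
Qed.

Lemma continuous_affine (R : realType) (f : R -> R) (a b : R) :
  continuous f -> continuous (fun t => f (a * t + b)).
Proof.
move=> cf x; apply: (@continuous_comp _ _ _ (fun t => a * t + b) f).
  by apply: cvgD; [apply: cvgM; [exact: cvg_cst|exact: cvg_id]|exact: cvg_cst].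
exact: cf.
Qed.

Lemma ri_comp_shift (R : realType) (a b c : R) (f : R -> R) : a <= b ->
  continuous f -> ri (a + c) (b + c) f = ri a b (fun x => f (x + c)).
Proof.
move=> ab cf.
have [F dF] : exists F, forall t, a + c - 1 < t -> is_derive t 1 F (f t).
  by exists ((ri (a + c - 1))^~ f) => t; exact: ri_primitive.
have -> : ri (a + c) (b + c) f = F (b + c) - F (a + c).
  apply: ri_FTC2_cc => //; first by rewrite lerD2r.
  by move=> x /andP[xa xb]; apply: dF; lra.
pose G t := F (1 * t + c).
have -> : ri a b (fun x => f (x + c)) = ri a b (fun x => f (1 * x + c)).
  by apply: ri_ext => x _; rewrite mul1r.
have -> : ri a b (fun x => f (1 * x + c)) = G b - G a.
  apply: ri_FTC2_cc => //; first exact: continuous_affine.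
  move=> x /andP[ax xb].
  rewrite -[X in is_derive _ _ _ X]mul1r; apply: is_derive_affine.
  by apply: dF; lra.
by rewrite /G !mul1r.
Qed.

Lemma ri_comp_opp (R : realType) (a b c : R) (f : R -> R) : a <= b ->
  continuous f -> ri (c - b) (c - a) f = ri a b (fun x => f (c - x)).
Proof.
move=> ab cf.
have [F dF] : exists F, forall t, c - b - 1 < t -> is_derive t 1 F (f t).
  by exists ((ri (c - b - 1))^~ f) => t; exact: ri_primitive.
have -> : ri (c - b) (c - a) f = F (c - a) - F (c - b).
  apply: ri_FTC2_cc => //; first by rewrite lerD2l lerN2.
  by move=> x /andP[xa xb]; apply: dF; lra.
pose G t := F (- 1 * t + c).
have -> : ri a b (fun x => f (c - x)) = - ri a b (fun x => - 1 * f (- 1 * x + c)).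
  rewrite riZ; last exact: continuous_affine.
  by rewrite mulN1r opprK; apply: ri_ext => x _; congr f; ring.
have -> : ri a b (fun x => - 1 * f (- 1 * x + c)) = G b - G a.
  apply: ri_FTC2_cc => //.
    by move=> x; apply: cvgM; [exact: cvg_cst|exact: continuous_affine].
  move=> x /andP[ax xb]; apply: is_derive_affine.
  by apply: dF; lra.
rewrite /G !mulN1r ![- _ + c]addrC; ring.
Qed.

(** * A smooth step function *)

(** A smooth function is carried together with the list of all its derivatives; products and affine
    changes of variable then have explicit lists, and no iterated derivative has to be computed. *)
Definition smooth_seq (R : realType) (F : nat -> R -> R) :=
  forall (n : nat) (x : R), is_derive x 1 (F n) (F n.+1 x).

Lemma smooth_seq_continuous (R : realType) (F : nat -> R -> R) n :
  smooth_seq F -> continuous (F n).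
Proof. move=> sF x; exact: is_derive_continuous (sF n x). Qed.

(** A list of pairs [(i, j)] stands for a sum of products of an [i]-th and a [j]-th derivative. The
    product rule acts on each pair and repetitions are kept, which avoids binomial coefficients. *)
Definition leibniz_step (s : seq (nat * nat)) : seq (nat * nat) :=
  [seq (ij.1.+1, ij.2) | ij <- s] ++ [seq (ij.1, ij.2.+1) | ij <- s].

Definition smooth_mul (R : realType) (F G : nat -> R -> R) (n : nat) (x : R) : R :=
  \sum_(ij <- iter n leibniz_step [:: (0, 0)%N]) F ij.1 x * G ij.2 x.

Lemma smooth_mul0 (R : realType) (F G : nat -> R -> R) (x : R) :
  smooth_mul F G 0 x = F 0%N x * G 0%N x.
Proof. by rewrite /smooth_mul/= big_seq1. Qed.

Lemma smooth_seq_mul (R : realType) (F G : nat -> R -> R) :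
  smooth_seq F -> smooth_seq G -> smooth_seq (smooth_mul F G).
Proof.
move=> sF sG n x; rewrite /smooth_mul iterS.
elim: (iter n _ _) => [|[i j] s IH].
  rewrite big_nil; under eq_fun do rewrite big_nil.
  exact: is_derive_cst.
under eq_fun do rewrite big_cons.
have -> : \sum_(ij <- leibniz_step ((i, j) :: s)) F ij.1 x * G ij.2 x =
   (F i x *: G j.+1 x + G j x *: F i.+1 x) +
   \sum_(ij <- leibniz_step s) F ij.1 x * G ij.2 x.
  rewrite /leibniz_step /= !big_cons !big_cat/= !big_cons/= /GRing.scale/=; ring.
apply: is_deriveD.
exact: is_deriveM.
Qed.

Lemma smooth_mul_zero (R : realType) (F G : nat -> R -> R) (x : R) :
  (forall n, F n x = 0) -> forall n, smooth_mul F G n x = 0.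
Proof.
by move=> F0 n; rewrite /smooth_mul big1// => ij _; rewrite F0 mul0r.
Qed.

Lemma smooth_mul_one (R : realType) (F G : nat -> R -> R) (x : R) :
  F 0%N x = 1 -> (forall n, F n.+1 x = 0) -> forall n, smooth_mul F G n x = G n x.
Proof.
move=> F1 F0 n; rewrite /smooth_mul.
suff H s m : \sum_(ij <- iter m leibniz_step s) F ij.1 x * G ij.2 x =
    \sum_(ij <- s) F ij.1 x * G (ij.2 + m)%N x.
  by rewrite H big_seq1/= F1 mul1r add0n.
elim: m s => [|m IH] s; first by apply: eq_bigr => ij _; rewrite addn0.
rewrite iterSr IH /leibniz_step big_cat/= !big_map/= big1 ?add0r.
  by apply: eq_bigr => ij _; rewrite addSnnS.
by move=> ij _; rewrite F0 mul0r.
Qed.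

Lemma smooth_seq_affine (R : realType) (F : nat -> R -> R) (a b : R) :
  smooth_seq F -> smooth_seq (fun n x => a ^+ n * F n (a * x + b)).
Proof.
move=> sF n x; have := is_derive_affine (sF n (a * x + b)) => /(is_deriveZ (a ^+ n)).
by rewrite /GRing.scale/= mulrA exprSr.
Qed.

Lemma smooth_seqB (R : realType) (F G : nat -> R -> R) :
  smooth_seq F -> smooth_seq G -> smooth_seq (fun n x => F n x - G n x).
Proof. by move=> sF sG n x; apply: is_deriveB. Qed.

Lemma smooth_seqZ (R : realType) (F : nat -> R -> R) (c : R) :
  smooth_seq F -> smooth_seq (fun n x => c * F n x).
Proof. by move=> sF n x; apply: is_deriveZ. Qed.

(** * Functions flat at the origin and a bump function *)

Lemma exprn_le_expR (R : realType) (n : nat) (y : R) : 0 <= y ->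
  y ^+ n <= n%:R ^+ n * expR y.
Proof.
move=> y0; case: n => [|n]; first by rewrite !expr0 mul1r; apply: le_trans (expR_ge1Dx _); lra.
have n0 : (n.+1%:R : R) != 0 by rewrite pnatr_eq0.
(* The claim is the power of order [n.+1] of [y / n.+1 <= expR (y / n.+1)]. *)
have -> : y = n.+1%:R * (y / n.+1%:R) by rewrite mulrCA divff ?mulr1.
rewrite exprMn ler_pM2l ?exprn_gt0 ?ltr0n// expRM_natl.
apply: lerXn2r; rewrite ?nnegrE ?expR_ge0 ?divr_ge0//.
by apply: le_trans (expR_ge1Dx _); rewrite lerDr.
Qed.

Lemma horner_le_expR (R : realType) (q : {poly R}) :
  exists2 C : R, 0 < C & forall y, 0 <= y -> `|q.[y]| <= C * expR y.
Proof.
exists (1 + \sum_(i < size q) `|q`_i| * i%:R ^+ i).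
  by rewrite ltr_wpDr// sumr_ge0// => i _; rewrite mulr_ge0// exprn_ge0.
move=> y y0; rewrite horner_coef (le_trans (ler_norm_sum _ _ _))// mulrDl mul1r.
rewrite (@le_trans _ _ (\sum_(i < size q) `|q`_i| * i%:R ^+ i * expR y))//.
  apply: ler_sum => i _; rewrite normrM normrX (ger0_norm y0) -mulrA.
  by rewrite ler_wpM2l// exprn_le_expR.
by rewrite mulr_suml lerDr expR_ge0.
Qed.

Lemma is_derive_quadratic0 (R : realType) (f : R -> R) (x C : R) : f x = 0 ->
  (forall h, `|h| < 1 -> `|f (x + h)| <= C * h ^+ 2) -> is_derive x 1 f 0.
Proof.
move=> fx0 fC.
have C0 : 0 <= C.
  have := fC (1 / 2); rewrite ger0_norm; last lra.
  move=> /(_ ltac:(lra)); have := normr_ge0 (f (x + 1 / 2)); nra.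
have C1 : 0 < C + 1 by lra.
have H : h^-1 *: (f (h *: 1 + x) - f x) @[h --> 0^'] --> 0.
  apply/cvgrPdist_le => e e0; near=> h.
  have h0 : h != 0 by near: h; exact: nbhs_dnbhs_neq.
  rewrite sub0r normrN fx0 subr0 /GRing.scale/= mulr1 addrC normrM normrV ?unitfE//.
  rewrite ler_pdivrMl ?normr_gt0//.
  apply: (@le_trans _ _ (C * h ^+ 2)).
    apply: fC; near: h; apply: dnbhs0_lt => //.
  rewrite -normr_id -real_normK ?num_real// expr2 normr_id mulrCA ler_wpM2l//.
  apply: (@le_trans _ _ ((C + 1) * `|h|)); first by rewrite ler_wpM2r// lerDl.
  rewrite -ler_pdivlMl//.
  by near: h; apply: dnbhs0_le; rewrite mulr_gt0// invr_gt0.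
apply: DeriveDef; first by apply/cvg_ex; exists 0.
exact/cvg_lim.
Unshelve. all: by end_near. Qed.

(* [exp (-1/x)] times a polynomial in [1/x], cut off to [0] for [x <= 0]:
   a class stable under differentiation. *)
Definition flat_exp (R : realType) (q : {poly R}) (x : R) : R :=
  if 0 < x then q.[x^-1] * expR (- x^-1) else 0.

Lemma flat_exp_quadratic (R : realType) (q : {poly R}) :
  exists C : R, forall h, `|h| < 1 -> `|flat_exp q h| <= C * h ^+ 2.
Proof.
(* The extra factor, evaluated at [h^-1], is [h ^- 2]; moved to the other side it becomes the
   [h ^+ 2] of the claim. *)
have [C C0 qC] := horner_le_expR (q * 'X ^+ 2).
exists C => h h1; rewrite /flat_exp; case: ifPn => h0; last first.
  by rewrite normr0 mulr_ge0 ?sqr_ge0// ltW.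
have hV : 0 <= h^-1 by rewrite invr_ge0 ltW.
have := qC _ hV; rewrite hornerM hornerXn normrM normrX (ger0_norm hV).
rewrite exprVn ler_pdivrMr ?exprn_gt0// => H.
rewrite normrM (ger0_norm (expR_ge0 _)) expRN.
by rewrite ler_pdivrMr ?expR_gt0// mulrAC.
Qed.

(** For positive [x] the derivative of [q(1/x) exp(-1/x)] is [x^-2 (q - q')(1/x) exp(-1/x)], again a
    polynomial in [1/x] times the exponential. At 0 the quadratic bound gives derivative zero. *)
Lemma is_derive_flat_exp (R : realType) (q : {poly R}) (x : R) :
  is_derive x 1 (flat_exp q) (flat_exp ('X^2 * (q - q^`())) x).
Proof.
have [x0|x0|->] := ltgtP x 0.
- rewrite {2}/flat_exp ltNge (ltW x0)/=.
  apply: (@near_eq_is_derive _ _ _ (cst 0) _ _ _ _ _ (is_derive_cst (0 : R) x 1)).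
  near=> y; rewrite /flat_exp ifN// -leNgt; near: y.
  by apply: filterS (lt_nbhsl x0) => y /ltW.
- rewrite {2}/flat_exp x0.
  have xn0 : x != 0 by rewrite gt_eqF.
  have DV : is_derive x 1 (fun y : R => y^-1) (- x ^- 2).
    have := @is_deriveV _ id x 1 1 xn0 _; rewrite /GRing.scale/= mulr1; exact.
  have Dq : is_derive x^-1 1 (fun y : R => q.[y]) q^`().[x^-1].
    by apply: DeriveDef; [exact: derivable_horner|rewrite -derive1E -derivE].
  have D1 := is_derive1_comp Dq DV.
  have De : is_derive x 1 (expR \o (fun y : R => - y^-1)) (expR (- x^-1) * x ^- 2).
    have DN := is_deriveN DV; rewrite opprK in DN.
    exact: (is_derive1_comp (is_derive_expR _) DN).
  have D := is_deriveM D1 De.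
  have D' : is_derive x 1 (fun y : R => q.[y^-1] * expR (- y^-1))
      (('X^2 * (q - q^`())).[x^-1] * expR (- x^-1)).
    apply: (is_derive_eq D).
    rewrite /= hornerM hornerXn hornerD hornerN exprVn /GRing.scale/=; ring.
  apply: (near_eq_is_derive _ D').
  by near=> y; rewrite /flat_exp ifT//; near: y; exact: lt_nbhsr.
- rewrite {2}/flat_exp ltxx.
  have [C HC] := flat_exp_quadratic q.
  apply: (@is_derive_quadratic0 _ _ _ C); first by rewrite /flat_exp ltxx.
  by move=> h h1; rewrite add0r; exact: HC.
Unshelve. all: by end_near. Qed.

Definition flat_seq (R : realType) (n : nat) : R -> R :=
  flat_exp (iter n (fun q => 'X^2 * (q - q^`())) 1).

Lemma smooth_flat_seq (R : realType) : smooth_seq (@flat_seq R).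
Proof. by move=> n x; exact: is_derive_flat_exp. Qed.

Lemma flat_seq0 (R : realType) n (x : R) : x <= 0 -> flat_seq n x = 0.
Proof. by move=> x0; rewrite /flat_seq /flat_exp ltNge x0. Qed.

(** The product of [exp(-1/(1 + x))] and [exp(-1/(1 - x))], each factor being cut off to zero where
    its denominator is not positive. *)
Lemma exists_bump (R : realType) : exists b : nat -> R -> R,
  [/\ smooth_seq b, forall n x, 1 <= `|x| -> b n x = 0, forall x, 0 <= b 0%N x
    & 0 < b 0%N 0].
Proof.
pose F (a : R) n x := a ^+ n * @flat_seq R n (a * x + 1).
have sF a : smooth_seq (F a) by apply: smooth_seq_affine; exact: smooth_flat_seq.
have F0 a n x : a * x + 1 <= 0 -> F a n x = 0 by move=> H; rewrite /F flat_seq0 ?mulr0.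
have Fge a x : 0 <= F a 0%N x.
  rewrite /F expr0 mul1r /flat_seq /flat_exp /=; case: ifP => // _.
  by rewrite hornerC mul1r expR_ge0.
exists (smooth_mul (F 1) (F (- 1))); split.
- exact: smooth_seq_mul.
- move=> n x; rewrite ler_normr => /orP[x1|x1].
    rewrite /smooth_mul big1// => ij _; rewrite (F0 (- 1)) ?mulr0//; lra.
  by apply: smooth_mul_zero => {}n; apply: F0; lra.
- by move=> x; rewrite smooth_mul0 mulr_ge0.
- rewrite smooth_mul0 /F !expr0 !mul1r !mulr0 !add0r /flat_seq /flat_exp /= ltr01.
  by rewrite !hornerC !mul1r mulr_gt0 ?expR_gt0.
Qed.

Lemma ri_gt0 (R : realType) (a b c : R) (f : R -> R) : a < c < b ->
  continuous f -> (forall x, 0 <= f x) -> 0 < f c -> 0 < ri a b f.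
Proof.
move=> /andP[ac cb] cf f0 fc.
have /nbhs_ballP[e /= e0 He] : \forall y \near c, f c / 2 < f y.
  by have /cvgr_gt := cf c; apply; lra.
pose d := Num.min (e / 2) (Num.min (c - a) (b - c)).
have d0 : 0 < d by rewrite !lt_min; apply/and3P; split; lra.
have de : d <= e / 2 by rewrite ge_min lexx.
have dca : d <= c - a by rewrite !ge_min lexx orbT.
have dbc : d <= b - c by rewrite !ge_min lexx !orbT.
have ri0 u v : u <= v -> 0 <= ri u v f.
  move=> uv; have <- : ri u v (fun=> 0) = 0 by rewrite ri_cst// mul0r.
  by apply: le_ri => //; exact: cst_continuous.
rewrite (@ri_split _ a b c)//; [|lra|lra].
rewrite (@ri_split _ c b (c + d))//; [|lra|lra].
rewrite ltr_wpDl//; first by apply: ri0; lra.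
rewrite ltr_pwDl//; last by apply: ri0; lra.
apply: (@lt_le_trans _ _ (ri c (c + d) (fun=> f c / 2))).
  by rewrite ri_cst; [rewrite mulr_gt0//; lra|lra].
apply: le_ri => //; first exact: cst_continuous.
move=> x /andP[cx xd]; apply/ltW/He; rewrite /ball/= ler0_norm; lra.
Qed.

(** [H 0] climbs from 0 to 1 across [[-1, 1]], so [H 1] is a nonnegative kernel of mass one
    supported there. One object thus yields cutoffs, smoothed indicators and mollifiers. *)
Definition smooth_step (R : realType) (H : nat -> R -> R) :=
  [/\ smooth_seq H, forall n (x : R), x <= - 1 -> H n x = 0,
      forall x : R, 1 <= x -> H 0%N x = 1,
      forall n (x : R), 1 <= x -> H n.+1 x = 0 & forall x : R, 0 <= H 1%N x].

Lemma exists_smooth_step (R : realType) : exists H : nat -> R -> R, smooth_step H.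
Proof.
have [b [sb b0 bge bgt]] := exists_bump R.
have cb n : continuous (b n) by exact: smooth_seq_continuous.
pose I := ri (- 2) 1 (b 0%N).
have I0 : 0 < I by apply: (@ri_gt0 _ _ _ 0) => //; lra.
pose m n x := I^-1 * b n x.
have sm : smooth_seq m by exact: smooth_seqZ.
have cm n : continuous (m n) by exact: smooth_seq_continuous.
have m0 n x : 1 <= `|x| -> m n x = 0 by move=> x1; rewrite /m b0 ?mulr0.
have mge x : 0 <= m 0%N x by rewrite mulr_ge0// invr_ge0 ltW.
(* The base point -2 lies to the left of the support, so that [ri_primitive] applies at every
   [x >= -1]; the maximum keeps the segment nonempty for points further left. *)
pose H n := if n is k.+1 then m k else fun x : R => ri (- 2) (Num.max x (- 2)) (m 0%N).
have vanish u v : u <= v -> (forall x, u <= x <= v -> 1 <= `|x|) ->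
    ri u v (m 0%N) = 0.
  move=> uv h; rewrite (_ : ri u v _ = ri u v (fun=> 0)).
    by rewrite ri_cst// mul0r.
  by apply: ri_ext => x /h; exact: m0.
have Hlow (x : R) : x <= - 1 -> H 0%N x = 0.
  move=> x1 /=; apply: vanish; first by rewrite le_max lexx orbT.
  move=> y /andP[_]; rewrite le_max => /orP[] yx; rewrite ler_normr; apply/orP; right; lra.
have Hhigh (x : R) : 1 <= x -> H 0%N x = 1.
  move=> x1 /=; rewrite max_l; last lra.
  rewrite (@ri_split _ _ _ 1)//.
  rewrite (vanish 1 x)//; last first.
    by move=> y /andP[y1 _]; rewrite ler_normr y1.
  rewrite addr0 /m riZ// -/I mulVf// gt_eqF//.
exists H; split => //.
- case=> [|n] x; last exact: sm.
  have [x1|x1] := ltP x (- 1).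
    rewrite [H 1%N x]m0; last by rewrite ler_normr; apply/orP; right; lra.
    apply: (@near_eq_is_derive _ _ _ (cst 0) _ _ _ _ _ (is_derive_cst (0 : R) x 1)).
    near=> y; rewrite Hlow//; near: y.
    by apply: filterS (lt_nbhsl x1) => y /ltW.
  have x2 : - 2 < x by lra.
  apply: (near_eq_is_derive _ (ri_primitive (cm 0%N) x2)).
  near=> y => /=; rewrite max_l//; apply/ltW; near: y; exact: lt_nbhsr.
- case=> [|n] x x1; first exact: Hlow.
  by rewrite [LHS]m0// ler_normr; apply/orP; right; lra.
- by move=> n x x1; rewrite [LHS]m0// ler_normr x1.
Unshelve. all: by end_near. Qed.

Lemma smooth_step_ndecr (R : realType) (H : nat -> R -> R) (x y : R) :
  smooth_step H -> x <= y -> H 0%N x <= H 0%N y.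
Proof.
case=> sH _ _ _ H1 xy; rewrite -subr_ge0.
have c1 : continuous (H 1%N) by exact: smooth_seq_continuous.
have <- : ri x y (H 1%N) = H 0%N y - H 0%N x.
  by apply: ri_FTC2_cc => // t _; exact: sH.
rewrite -[leLHS](mul0r (y - x)) -ri_cst//.
by apply: le_ri => //; exact: cst_continuous.
Qed.

Lemma smooth_step_itv (R : realType) (H : nat -> R -> R) (x : R) :
  smooth_step H -> 0 <= H 0%N x <= 1.
Proof.
move=> sH; have [_ Hl Hr _ _] := sH; apply/andP; split.
  have [x1|x1] := leP x (- 1); first by rewrite Hl.
  by rewrite -(Hl 0%N (- 1) (lexx _)); apply: smooth_step_ndecr => //; rewrite ltW.
have [x1|x1] := leP 1 x; first by rewrite Hr.
by rewrite -(Hr 1 (lexx _)); apply: smooth_step_ndecr => //; rewrite ltW.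
Qed.

(** * Fourier partial sums of continuous functions *)

Lemma is_derive_ext (R : realType) (f g : R -> R) (x d : R) :
  (forall t, f t = g t) -> is_derive x 1 f d -> is_derive x 1 g d.
Proof. by move=> /funext ->. Qed.

Lemma continuous_bounded (R : realType) (a b : R) (f : R -> R) : a <= b ->
  continuous f -> exists2 B : R, 0 <= B & forall x, a <= x <= b -> `|f x| <= B.
Proof.
move=> ab cf.
have [|c _ cM] := @EVT_max R (fun x => `|f x|) a b ab.
  by apply: continuous_subspaceT; cts.
exists `|f c| => // x xab; apply: cM; by rewrite in_itv.
Qed.

Lemma cos_natD2pi (R : realType) (k : nat) (x : R) : cos (x + k%:R * (2 * pi)) = cos x.
Proof.
have -> : k%:R * (2 * pi) = (pi *+ 2) *+ k :> R by rewrite mulr_natl mulr_natl.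
exact: (periodicn (@cosD2pi R)).
Qed.

Lemma sin_natD2pi (R : realType) (k : nat) (x : R) : sin (x + k%:R * (2 * pi)) = sin x.
Proof.
have -> : k%:R * (2 * pi) = (pi *+ 2) *+ k :> R by rewrite mulr_natl mulr_natl.
exact: (periodicn (@sinD2pi R)).
Qed.

(** * Orthogonality of harmonics *)

Lemma mul_cos_cos (R : realType) (a b : R) :
  cos a * cos b = (cos (a + b) + cos (a - b)) / 2.
Proof. by rewrite cosB cosD; lra. Qed.

Lemma mul_sin_sin (R : realType) (a b : R) :
  sin a * sin b = (cos (a - b) - cos (a + b)) / 2.
Proof. by rewrite cosB cosD; lra. Qed.

Lemma twopi_ge0 (R : realType) : 0 <= 2 * pi :> R.
Proof. by rewrite mulr_ge0// pi_ge0. Qed.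

Lemma twopi_gt0 (R : realType) : 0 < 2 * pi :> R.
Proof. by rewrite mulr_gt0// pi_gt0. Qed.

Lemma ri_cos_harmonic (R : realType) (k : nat) (a : R) : (0 < k)%N ->
  ri 0 (2 * pi) (fun y => cos (k%:R * y + a)) = 0.
Proof.
move=> k0; have kn0 : (k%:R : R) != 0 by rewrite pnatr_eq0 -lt0n.
pose F (y : R) := k%:R^-1 * sin (k%:R * y + a).
have -> : ri 0 (2 * pi) (fun y => cos (k%:R * y + a)) = F (2 * pi) - F 0.
  apply: ri_FTC2_cc; [exact: twopi_ge0|by cts|].
  move=> x _.
  have := is_deriveZ k%:R^-1 (is_derive_affine (is_derive_sin (k%:R * x + a))).
  by rewrite /GRing.scale/= mulrA mulVf// mul1r.
by rewrite /F mulr0 add0r (addrC (k%:R * _)) sin_natD2pi subrr.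
Qed.

Lemma ri_cos_cos_neq (R : realType) (k i : nat) (a b : R) : (i < k)%N ->
  ri 0 (2 * pi) (fun y => cos (k%:R * y + a) * cos (i%:R * y + b)) = 0.
Proof.
move=> ik.
rewrite (_ : ri _ _ _ = ri 0 (2 * pi) (fun y =>
    2^-1 * cos ((k + i)%:R * y + (a + b)) + 2^-1 * cos ((k - i)%:R * y + (a - b)))).
  rewrite riD; [|by cts|by cts].
  rewrite !riZ; [|by cts|by cts].
  by rewrite !ri_cos_harmonic ?mulr0 ?addr0// ?subn_gt0// addn_gt0 (leq_ltn_trans _ ik).
apply: ri_ext => y _; rewrite mul_cos_cos natrD natrB 1?ltnW//.
rewrite (_ : k%:R * y + a + _ = (k%:R + i%:R) * y + (a + b)); last by ring.
by rewrite (_ : k%:R * y + a - _ = (k%:R - i%:R) * y + (a - b)); [lra|ring].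
Qed.

Lemma ri_cos_cos_eq (R : realType) (k : nat) (a b : R) : (0 < k)%N ->
  ri 0 (2 * pi) (fun y => cos (k%:R * y + a) * cos (k%:R * y + b)) = pi * cos (a - b).
Proof.
move=> k0.
rewrite (_ : ri _ _ _ = ri 0 (2 * pi) (fun y =>
    2^-1 * cos ((k + k)%:R * y + (a + b)) + 2^-1 * cos (a - b))).
  rewrite riD; [|by cts|by cts].
  rewrite riZ; [|by cts].
  rewrite ri_cos_harmonic ?addn_gt0 ?k0// mulr0 add0r ri_cst ?twopi_ge0//.
  by rewrite subr0 mulrCA mulrA mulrC; field.
apply: ri_ext => y _; rewrite mul_cos_cos natrD.
rewrite (_ : k%:R * y + a + _ = (k%:R + k%:R) * y + (a + b)); last by ring.
by rewrite (_ : k%:R * y + a - _ = a - b); [lra|ring].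
Qed.

(* The phase [a] treats cosine coefficients ([a = 0]) and, up to sign, sine
   coefficients ([a = pi / 2]) alike. *)
Definition fcoef (R : realType) (f : R -> R) (k : nat) (a : R) : R :=
  ri 0 (2 * pi) (fun y => f y * cos (k%:R * y + a)).

Definition fweight (R : realType) (k : nat) : R := (if k == 0%N then 2^-1 else 1) / pi.

(* Both terms of frequency [k] of the Fourier series at [x], see [ftermE]. *)
Definition fterm (R : realType) (f : R -> R) (k : nat) (x : R) : R :=
  fweight R k * fcoef f k (- (k%:R * x)).

Definition fsum (R : realType) (f : R -> R) (n : nat) (x : R) : R :=
  \sum_(0 <= k < n) fterm f k x.

Lemma fcoef_phase (R : realType) (f : R -> R) (k : nat) (a : R) : continuous f ->
  fcoef f k a = cos a * fcoef f k 0 + sin a * fcoef f k (pi / 2).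
Proof.
move=> cf; rewrite /fcoef -!riZ; [|by cts|by cts].
rewrite -riD; [|by cts|by cts].
by apply: ri_ext => y _; rewrite cosDpihalf addr0 cosD; ring.
Qed.

Lemma ftermE (R : realType) (f : R -> R) (k : nat) (x : R) : continuous f ->
  fterm f k x = fweight R k * (fcoef f k 0 * cos (k%:R * x + 0) +
    fcoef f k (pi / 2) * cos (k%:R * x + pi / 2)).
Proof.
move=> cf; rewrite /fterm fcoef_phase// cosN sinN cosDpihalf addr0; congr (_ * _); ring.
Qed.

Lemma continuous_fterm (R : realType) (f : R -> R) (k : nat) : continuous f ->
  continuous (fterm f k).
Proof.
move=> cf; rewrite (_ : fterm f k = fun x => fweight R k * (fcoef f k 0 *
  cos (k%:R * x + 0) + fcoef f k (pi / 2) * cos (k%:R * x + pi / 2))); first by cts.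
by apply/funext => x; exact: ftermE.
Qed.

Lemma continuous_fsum (R : realType) (f : R -> R) (n : nat) : continuous f ->
  continuous (fsum f n).
Proof. by move=> cf; apply: ct_sum => k; exact: continuous_fterm. Qed.

Lemma fcoef_fterm (R : realType) (f : R -> R) (k i : nat) (a : R) : continuous f ->
  fcoef (fterm f i) k a = if k == i then fcoef f k a else 0.
Proof.
move=> cf; rewrite /fcoef.
have pin0 : (pi : R) != 0 by rewrite gt_eqF ?pi_gt0.
rewrite (_ : ri _ _ _ = fweight R i * (
   fcoef f i 0 * ri 0 (2 * pi) (fun y => cos (i%:R * y + 0) * cos (k%:R * y + a)) +
   fcoef f i (pi / 2) *
     ri 0 (2 * pi) (fun y => cos (i%:R * y + pi / 2) * cos (k%:R * y + a)))); last first.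
  rewrite -!riZ; [|by cts..].
  rewrite -riD; [|by cts..].
  rewrite -riZ; [|by cts].
  by apply: ri_ext => y _; rewrite ftermE//; ring.
case: ltngtP => ik.
- by rewrite !ri_cos_cos_neq// !mulr0 addr0 mulr0.
- under ri_ext do rewrite mulrC.
  under [X in _ + _ * X]ri_ext do rewrite mulrC.
  by rewrite !ri_cos_cos_neq// !mulr0 addr0 mulr0.
- rewrite -/(fcoef f k a) [RHS]fcoef_phase// ik /fweight; case: i ik => [|i] ik /=.
    (* At frequency 0 the shifted cosine vanishes, and the other one has square integral [2 * pi]
       instead of [pi], which the factor [2^-1] in [fweight] compensates. *)
    rewrite (_ : fcoef f 0 (pi / 2) = 0); last first.
      rewrite /fcoef (_ : ri _ _ _ = ri 0 (2 * pi) (fun=> 0)).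
        by rewrite ri_cst ?mul0r// twopi_ge0.
      by apply: ri_ext => y _; rewrite mul0r add0r cos_pihalf mulr0.
    rewrite mulr0 mul0r !addr0.
    rewrite (_ : ri _ _ _ = ri 0 (2 * pi) (fun=> cos a)).
      rewrite ri_cst ?twopi_ge0// subr0.
      by move: (pi : R) pin0 => P P0; field.
    by apply: ri_ext => y _; rewrite !mul0r !add0r cos0 mul1r.
  rewrite !ri_cos_cos_eq// sub0r cosN cosB cos_pihalf sin_pihalf.
  by move: (pi : R) pin0 => P P0; field.
Qed.

Lemma fcoefB (R : realType) (f g : R -> R) (k : nat) (a : R) : continuous f ->
  continuous g -> fcoef (fun x => f x - g x) k a = fcoef f k a - fcoef g k a.
Proof.
move=> cf cg; rewrite /fcoef -riB; [|by cts..].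
by apply: ri_ext => y _; ring.
Qed.

Lemma fcoef_fsum (R : realType) (f : R -> R) (n k : nat) (a : R) : continuous f ->
  fcoef (fsum f n) k a = if (k < n)%N then fcoef f k a else 0.
Proof.
move=> cf; rewrite {1}/fcoef.
under ri_ext do rewrite /fsum mulr_suml.
rewrite ri_sum; last first.
  by move=> i; apply: ct_mul; [exact: continuous_fterm|cts].
under eq_bigr do rewrite -/(fcoef _ _ _) fcoef_fterm//.
case: ifPn => [kn|kn].
  rewrite (bigD1_seq k)/= ?iota_uniq ?mem_index_iota//= eqxx big1 ?addr0//.
  by move=> i /negbTE; rewrite eq_sym => ->.
rewrite big_seq big1// => i; rewrite mem_index_iota => /andP[_ ik].
by case: eqP => // ki; rewrite ki ik in kn.
Qed.

(** Multiplication by [(1 + cos (y - x)) / 2] couples a frequency only to itself and its two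
    neighbours, so it costs one order of vanishing. *)
Lemma fcoef_mul_cos (R : realType) (f : R -> R) (m : nat) (x : R) : continuous f ->
  (forall k a, (k < m.+1)%N -> fcoef f k a = 0) ->
  forall k a, (k < m)%N -> fcoef (fun y => f y * ((1 + cos (y - x)) / 2)) k a = 0.
Proof.
move=> cf f0 k a km; rewrite /fcoef.
have cos1 (y : R) : cos (y - x) = cos (1%:R * y + - x) by rewrite mul1r.
have E (k' : nat) (c : R) : (k' < m.+1)%N ->
   ri 0 (2 * pi) (fun y => f y * cos (k'%:R * y + c)) = 0 by exact: f0.
(* The lower neighbour appears below as the frequency [1 - k], which is positive for [k = 0] and
   nonpositive otherwise; hence both signs. *)
have step : forall k' : nat, (k' < m.+1)%N -> forall c, forall s : R, 
   (s = k'%:R) \/ (s = - k'%:R) ->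
   ri 0 (2 * pi) (fun y => f y * cos (s * y + c)) = 0.
  move=> k' k'm c s [->|->]; first exact: E.
  rewrite -[RHS](E k' (- c) k'm); apply: ri_ext => y _.
  by rewrite -(cosN (k'%:R * y - c)) opprB addrC mulNr.
rewrite (_ : ri _ _ _ = 2^-1 * ri 0 (2 * pi) (fun y => f y * cos (k%:R * y + a)) +
   (4^-1 * ri 0 (2 * pi) (fun y => f y * cos ((k.+1)%:R * y + (a - x))) +
   4^-1 * ri 0 (2 * pi) (fun y => f y * cos ((1 - k%:R) * y + (- a - x))))); last first.
  rewrite -!riZ; [|by cts..].
  rewrite -!riD; [|by cts..].
  apply: ri_ext => y _; rewrite -(@natr1 _ k).
  have := mul_cos_cos (k%:R * y + a) (y - x).
  rewrite (_ : k%:R * y + a + (y - x) = (k%:R + 1) * y + (a - x)); last by ring.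
  rewrite -(cosN (k%:R * y + a - _)) (_ : - (k%:R * y + a - (y - x)) = (1 - k%:R) * y + (- a - x)); last by ring.
  move=> H.
  rewrite (_ : f y * ((1 + cos (y - x)) / 2) * cos (k%:R * y + a) =
    f y / 2 * cos (k%:R * y + a) + f y / 2 * (cos (k%:R * y + a) * cos (y - x))); last by field.
  by rewrite H; field.
rewrite (step k)//; [|by rewrite ltnW|by left].
rewrite (step k.+1)//; last by left.
rewrite mulr0 mulr0 !add0r.
case: k km => [|k] km.
  by rewrite (step 1%N) ?mulr0//; left; rewrite subr0.
rewrite (step k) ?mulr0//; last by right; rewrite -(@natr1 _ k); ring.
by rewrite ltnW// ltnW.
Qed.

(** * A trigonometric kernel concentrating at a point *)

Lemma cos_le_cos_away (R : realType) (d t : R) : 0 < d -> d <= pi ->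
  d <= `|t| <= 2 * pi - d -> cos t <= cos d.
Proof.
move=> d0 dpi /andP[dt td]; rewrite -cos_norm.
have [tpi|pit] := leP `|t| pi.
  rewrite leNgt ltr_cos ?in_itv/= ?normr_ge0 ?(ltW d0)// -leNgt//.
rewrite (_ : cos `|t| = cos (2 * pi - `|t|)).
  rewrite leNgt ltr_cos ?in_itv/= ?(ltW d0)// -?leNgt; first lra.
  by apply/andP; split; lra.
by rewrite -[LHS]cosN -[LHS](cos_natD2pi 1%N); congr cos; rewrite mul1r addrC.
Qed.

(** Close to [x] continuity gives [e]; elsewhere [1 - cos (y - x)] is bounded below and a large [C]
    absorbs the oscillation. As [x] is interior, [y - x] stays away from [2 pi] and [- 2 pi], where
    the cosine returns to 1. *)
Lemma continuous_le_cos_modulus (R : realType) (g : R -> R) (x e : R) :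
  continuous g -> 0 < x < 2 * pi -> 0 < e ->
  exists C : R, forall y, 0 <= y <= 2 * pi ->
    `|g y - g x| <= e + C * ((1 - cos (y - x)) / 2).
Proof.
move=> cg /andP[x0 x2] e0.
have [B B0 gB] := continuous_bounded (twopi_ge0 R) cg.
have /nbhs_ballP[d1 /= d10 Hd1] : \forall y \near x, `|g y - g x| < e.
  by have /cvgr_distC_lt := cg x; exact.
have pi0 := pi_gt0 R.
pose d := Num.min d1 (Num.min x (2 * pi - x)).
have d0 : 0 < d by rewrite !lt_min; apply/and3P; split; lra.
have dd1 : d <= d1 by rewrite ge_min lexx.
have dx : d <= x by rewrite !ge_min lexx orbT.
have dx2 : d <= 2 * pi - x by rewrite !ge_min lexx !orbT.
have dpi : d <= pi by lra.
have cd : cos d < 1.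
  by rewrite -cos0 ltr_cos ?in_itv/= ?lexx ?pi_ge0// ?(ltW d0) ?dpi.
have h0 : 0 < (1 - cos d) / 2 by lra.
exists (2 * B / ((1 - cos d) / 2)) => y /andP[y0 y2].
have [yd|yd] := ltP `|y - x| d.
  apply: (@le_trans _ _ e).
    by apply/ltW/Hd1; rewrite /ball/= distrC (lt_le_trans yd).
  rewrite lerDl mulr_ge0 ?divr_ge0 ?mulr_ge0 ?subr_ge0 ?(ltW h0) ?cos_le1// ltW.
have c1 : cos (y - x) <= cos d.
  apply: cos_le_cos_away => //; rewrite yd/= ler_norml; apply/andP; split; lra.
rewrite -mulrA; set Z := _^-1 * _.
have Z1 : 1 <= Z.
  by rewrite /Z ler_pdivlMl// mulr1; lra.
apply: (@le_trans _ _ (2 * B)).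
  apply: (le_trans (ler_normB _ _)).
  have := gB y; rewrite y0 y2 => /(_ isT); have := gB x; rewrite (ltW x0) (ltW x2) => /(_ isT).
  lra.
nra.
Qed.

(** With [q] the base of the powers, the derivative of [q ^+ N.+1 * sin (y - x)] has zero integral
    over a period. The outcome says that [1 - q] has mean [1 / (2 N + 4)] against the kernel
    [q ^+ N.+1], which quantifies its concentration at [x]. *)
Lemma ri_cos_power_rec (R : realType) (x : R) (N : nat) :
  (2 * N%:R + 4) * ri 0 (2 * pi) (fun y => ((1 + cos (y - x)) / 2) ^+ N.+2) =
  (2 * N%:R + 3) * ri 0 (2 * pi) (fun y => ((1 + cos (y - x)) / 2) ^+ N.+1).
Proof.
pose q (y : R) : R := (1 + cos (y - x)) / 2.
have cq : continuous q by rewrite /q; cts.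
pose F (y : R) := q y ^+ N.+1 * sin (y - x).
have D (y : R) : is_derive y 1 F ((2 * N%:R + 4) * q y ^+ N.+2 - (2 * N%:R + 3) * q y ^+ N.+1).
  have Ds : is_derive y 1 (fun t => sin (t - x)) (cos (y - x)).
    have H : is_derive (1 * y + - x) 1 sin (cos (y - x)).
      by rewrite mul1r; exact: is_derive_sin.
    have := is_derive_affine H; rewrite mul1r.
    by under eq_fun do rewrite mul1r.
  have Dc : is_derive y 1 (fun t => cos (t - x)) (- sin (y - x)).
    have H : is_derive (1 * y + - x) 1 cos (- sin (y - x)).
      by rewrite mul1r; exact: is_derive_cos.
    have := is_derive_affine H; rewrite mul1r.
    by under eq_fun do rewrite mul1r.
  have Dq : is_derive y 1 q (- sin (y - x) / 2).
    have := is_deriveZ 2^-1 (is_deriveD (is_derive_cst (1 : R) y 1) Dc).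
    rewrite /GRing.scale/= add0r mulrC.
    by apply: is_derive_ext => t; rewrite /q/= mulrC.
  have Dp : is_derive y 1 (fun t => q t ^+ N.+1) (N.+1%:R * q y ^+ N * (- sin (y - x) / 2)).
    have := is_deriveX N.+1 Dq; rewrite /GRing.scale/=.
    by apply: is_derive_ext => t; rewrite exprfctE.
  apply: (is_derive_eq (is_deriveM Dp Ds)).
  rewrite /GRing.scale/=.
  have s2 : sin (y - x) ^+ 2 = 4 * (q y * (1 - q y)).
    by rewrite sin2cos2 /q; field.
  have cE : cos (y - x) = 2 * q y - 1 by rewrite /q; field.
  rewrite (_ : sin (y - x) * (N.+1%:R * q y ^+ N * (- sin (y - x) / 2)) =
    - (N.+1%:R / 2) * q y ^+ N * sin (y - x) ^+ 2); last by field.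
  by rewrite s2 cE !exprS -(@natr1 _ N); field.
have E : ri 0 (2 * pi) (fun y => (2 * N%:R + 4) * q y ^+ N.+2 - (2 * N%:R + 3) * q y ^+ N.+1)
    = F (2 * pi) - F 0.
  by apply: ri_FTC2_cc; [exact: twopi_ge0|cts].
have FF : F (2 * pi) = F 0.
  have E1 : 2 * pi - x = - x + 1%:R * (2 * pi) by rewrite mul1r addrC.
  by rewrite /F /q E1 sub0r cos_natD2pi sin_natD2pi.
move: E; rewrite FF subrr riB; [|by cts..].
rewrite !riZ; [|by cts..].
by move/eqP; rewrite subr_eq0 => /eqP.
Qed.

Lemma ri_cos_power_gt0 (R : realType) (x : R) (N : nat) : 0 < x < 2 * pi ->
  0 < ri 0 (2 * pi) (fun y => ((1 + cos (y - x)) / 2) ^+ N).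
Proof.
move=> x02; apply: (@ri_gt0 _ _ _ x); [exact: x02|by cts| |].
  move=> y; rewrite exprn_ge0// divr_ge0// -lerBlDl sub0r; exact: cos_geN1.
by rewrite subrr cos0 exprn_gt0// divr_gt0// addr_gt0.
Qed.

Lemma fcoef_mul_cos_power (R : realType) (f : R -> R) (x : R) (N m : nat) :
  continuous f -> (forall k a, (k < m)%N -> fcoef f k a = 0) -> (N < m)%N ->
  ri 0 (2 * pi) (fun y => f y * ((1 + cos (y - x)) / 2) ^+ N) = 0.
Proof.
elim: N f m => [|N IH] f m cf f0 Nm.
  rewrite -[RHS](f0 0%N 0)//; apply: ri_ext => y _.
  by rewrite expr0 mul0r addr0 cos0.
case: m Nm f0 => // m Nm f0.
rewrite -[RHS](IH (fun y => f y * ((1 + cos (y - x)) / 2)) m)//; first last.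
- exact: fcoef_mul_cos.
- by cts.
by apply: ri_ext => y _; rewrite exprS mulrA.
Qed.

(* The kernel [((1 + cos (y - x)) / 2) ^+ N] is a trigonometric polynomial of
   degree [N] concentrating at [x] as [N] grows; integrated against [f - fsum f n]
   it only sees finitely many terms, so that the Fourier series need not be known
   to converge to [f]. *)
Theorem fourier_remainder (R : realType) (f : R -> R) (n : nat) (t x : R) :
  continuous f -> 0 < x < 2 * pi ->
  (forall m y, (n <= m)%N -> `|\sum_(n <= k < m) fterm f k y| <= t) ->
  `|f x - fsum f n x| <= t.
Proof.
move=> cf x02 ft.
pose g y := f y - fsum f n y.
have cS k : continuous (fsum f k) by exact: continuous_fsum.
have cg : continuous g by apply: ct_add => //; exact: ct_opp.
pose q (y : R) : R := (1 + cos (y - x)) / 2.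
have cq : continuous q by rewrite /q; cts.
have q0 y : 0 <= q y.
  by rewrite divr_ge0// -lerBlDl sub0r; exact: cos_geN1.
pose W N := ri 0 (2 * pi) (fun y => q y ^+ N).
have W0 N : 0 < W N by exact: ri_cos_power_gt0.
have step1 N : `|ri 0 (2 * pi) (fun y => g y * q y ^+ N)| <= t * W N.
  (* The remainder after [m] terms is orthogonal to the kernel, of degree [N < m]; the terms from
     [n] to [m] are bounded by assumption. *)
  pose m := (n + N.+1)%N.
  have nm : (n <= m)%N by rewrite leq_addr.
  pose r y := f y - fsum f m y.
  have cr : continuous r by apply: ct_add => //; exact: ct_opp.
  pose s y := \sum_(n <= k < m) fterm f k y.
  have cs : continuous s by apply: ct_sum => k; exact: continuous_fterm.
  have gE y : g y = r y + s y.
    rewrite /g /r /s /fsum (@big_cat_nat _ _ _ n 0 m)//=; ring.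
  have -> : ri 0 (2 * pi) (fun y => g y * q y ^+ N) =
      ri 0 (2 * pi) (fun y => s y * q y ^+ N).
    rewrite (_ : ri _ _ _ = ri 0 (2 * pi) (fun y => r y * q y ^+ N + s y * q y ^+ N)).
      rewrite riD; [|by cts..].
      rewrite (@fcoef_mul_cos_power _ r _ _ m) ?add0r//.
        move=> k a km; rewrite fcoefB// fcoef_fsum// km subrr//.
      by rewrite /m addnS ltnS leq_addl.
    by apply: ri_ext => y _; rewrite gE mulrDl.
  rewrite ler_norml; apply/andP; split.
    rewrite -mulNr -riZ; [|by cts].
    apply: le_ri; [by cts..|] => y _; rewrite ler_wpM2r ?exprn_ge0//.
    by have := ft m y nm; rewrite ler_norml => /andP[].
  rewrite -riZ; [|by cts].
  apply: le_ri; [by cts..|] => y _; rewrite ler_wpM2r ?exprn_ge0//.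
  by have := ft m y nm; rewrite ler_norml => /andP[].
have step2 (e : R) : 0 < e -> `|g x| <= t + e.
  move=> e0; have e20 : 0 < e / 2 by rewrite divr_gt0.
  have [C HC] := continuous_le_cos_modulus cg x02 e20.
  have C0 : 0 <= Num.max C 0 by rewrite le_max lexx orbT.
  (* [N] makes [C / (2 N + 4)] at most [e / 2], so that the cosine part of the modulus contributes
     no more than its constant part. *)
  pose N := (Num.trunc (Num.max C 0 / e)).
  have NC : Num.max C 0 < e * (2 * N%:R + 4) / 2.
    have := Num.Theory.truncnS_gt (Num.max C 0 / e); rewrite -/N ltr_pdivrMr// -natr1.
    lra.
  have wE : W N.+1 - W N.+2 = W N.+1 / (2 * N%:R + 4).
    have := ri_cos_power_rec x N; rewrite -/(W _) -/(W _) => H.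
    have n0 : 2 * N%:R + 4 != 0 :> R by rewrite gt_eqF// ltr_pwDr// mulr_ge0.
    apply: (mulfI n0); rewrite mulrBr mulrCA divff// mulr1.
    rewrite [X in _ - X = _](_ : _ = (2 * N%:R + 3) * W N.+1)//; ring.
  have HH : `|g x * W N.+1 - ri 0 (2 * pi) (fun y => g y * q y ^+ N.+1)| <=
      e / 2 * W N.+1 + Num.max C 0 * (W N.+1 - W N.+2).
    rewrite -riZ; [|by cts].
    rewrite -riB; [|by cts..].
    have bd y : 0 <= y <= 2 * pi -> `|g x * q y ^+ N.+1 - g y * q y ^+ N.+1| <=
       e / 2 * q y ^+ N.+1 + Num.max C 0 * (q y ^+ N.+1 - q y ^+ N.+2).
      move=> y02; rewrite -mulrBl normrM distrC (ger0_norm (exprn_ge0 _ (q0 y))).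
      rewrite (_ : _ + _ = (e / 2 + Num.max C 0 * (1 - q y)) * q y ^+ N.+1); last first.
        by rewrite !exprS; ring.
      rewrite ler_wpM2r ?exprn_ge0//; apply: (le_trans (HC y y02)).
      rewrite lerD2l (_ : 1 - q y = (1 - cos (y - x)) / 2); last by rewrite /q; field.
      rewrite ler_wpM2r// ?le_max ?lexx// divr_ge0// subr_ge0; exact: cos_le1.
    rewrite -riB; [|by cts..].
    rewrite -!riZ; [|by cts..].
    rewrite -riD; [|by cts..].
    rewrite ler_norml; apply/andP; split.
      rewrite -[X in - X]mul1r -mulNr -riZ; [|by cts].
      apply: le_ri; [by cts..|] => y /bd; rewrite ler_norml mulN1r => /andP[H _]; exact: H.
    apply: le_ri; [by cts..|] => y /bd; rewrite ler_norml => /andP[_]; exact.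
  have S1 := step1 N.+1.
  have WN := W0 N.+1.
  have : `|g x| * W N.+1 <= (t + e) * W N.+1.
    rewrite -[W N.+1 in leLHS]gtr0_norm// -normrM.
    have -> : g x * W N.+1 = (g x * W N.+1 - ri 0 (2 * pi) (fun y => g y * q y ^+ N.+1)) +
      ri 0 (2 * pi) (fun y => g y * q y ^+ N.+1) by rewrite subrK.
    apply: (le_trans (ler_normD _ _)).
    apply: (le_trans (lerD HH S1)).
    rewrite wE.
    have n0 : 0 < 2 * N%:R + 4 :> R by rewrite ltr_pwDr// mulr_ge0.
    have : Num.max C 0 * (W N.+1 / (2 * N%:R + 4)) <= e / 2 * W N.+1.
      rewrite mulrA ler_pdivrMr//.
      have := ltW NC; nra.
    lra.
  by rewrite ler_pM2r.
by apply/ler_addgt0Pr => e e0; exact: step2.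
Qed.

(** * Weak bounds, mollification and Chebyshev coefficients *)

Lemma uniform_continuity (R : realType) (f : R -> R) (a b e : R) :
  continuous f -> 0 < e ->
  exists2 d : R, 0 < d & forall x y, a <= x <= b -> `|y - x| <= d -> `|f y - f x| <= e.
Proof.
move=> cf e0.
have := @segment_compact _ a b => /compact_near_coveringP.
move=> /(_ R (0 : R)^'+ (fun d x => forall y, `|y - x| <= d -> `|f y - f x| <= e)).
case=> [x _|d0 /= d00 Hd].
  have e20 : 0 < e / 2 by rewrite divr_gt0.
  have /nbhs_ballP[r /= r0 Hr] : \forall y \near x, `|f y - f x| < e / 2.
    by have /cvgr_distC_lt := cf x; apply.
  have r20 : 0 < r / 2 by rewrite divr_gt0.
  near=> x' d => /= y yd.
  have dr : d < r / 2 by near: d; exact: nbhs_right_lt.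
  have xr : `|x' - x| < r / 2.
    near: x'; apply/nbhs_ballP; exists (r / 2) => //= t; rewrite /ball/= distrC//.
  have Hy : `|f y - f x| < e / 2.
    apply: Hr; rewrite /ball/= distrC.
    have := ler_distD x' y x; lra.
  have Hx : `|f x' - f x| < e / 2.
    by apply: Hr; rewrite /ball/= distrC; lra.
  have := ler_distD (f x) (f y) (f x'); rewrite (distrC (f x)); lra.
exists (d0 / 2); first by rewrite divr_gt0.
move=> x y xab; apply: (Hd (d0 / 2)) => //=.
- by rewrite /ball/= sub0r normrN gtr0_norm; lra.
- by rewrite divr_gt0.
Unshelve. all: by end_near. Qed.

Lemma continuous_bounded2 (R : realType) (a b c d : R) (G : R * R -> R) :
  continuous G ->
  exists2 B : R, 0 <= B & forall x y, a <= x <= b -> c <= y <= d -> `|G (x, y)| <= B.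
Proof.
move=> cG.
have cK : compact (`[a, b]%classic `*` `[c, d]%classic).
  by apply: compact_setX; exact: segment_compact.
have [ab|ba] := leP a b; last by exists 0 => // x y /andP[]; lra.
have [cd|dc] := leP c d; last by exists 0 => // x y _ /andP[]; lra.
have K0 : (`[a, b]%classic `*` `[c, d]%classic : set (R * R)) !=set0.
  by exists (a, c); split => /=; rewrite in_itv/= lexx.
have [|z _ Hz] := @compact_EVT_max _ R (fun z => `|G z|) _ K0 cK.
  by apply: continuous_subspaceT; cts.
exists `|G z| => // x y xab ycd; apply: Hz.
by rewrite inE; split => /=; rewrite in_itv.
Qed.

Lemma continuous_row (R : realType) (G : R * R -> R) (x : R) : continuous G ->
  continuous (fun y => G (x, y)).
Proof.
move=> cG y; apply: (@continuous_comp _ _ _ (fun y => (x, y)) G); last exact: cG.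
apply/cvg_ballP => e e0; near=> t; split => /=; first exact: ballxx.
by near: t; apply/nbhs_ballP; exists e.
Unshelve. all: by end_near.
Qed.

Lemma continuous_col (R : realType) (G : R * R -> R) (y : R) : continuous G ->
  continuous (fun x => G (x, y)).
Proof.
move=> cG x; apply: (@continuous_comp _ _ _ (fun x => (x, y)) G); last exact: cG.
apply/cvg_ballP => e e0; near=> t; split => /=; last exact: ballxx.
by near: t; apply/nbhs_ballP; exists e.
Unshelve. all: by end_near.
Qed.

Lemma continuous_ri (R : realType) (a b : R) (G : R * R -> R) : continuous G ->
  continuous (fun x => ri a b (fun y => G (x, y))).
Proof.
move=> cG x.
have [B B0 GB] := continuous_bounded2 (x - 1) (x + 1) a b cG.
have xI : x \in `]x - 1, x + 1[%classic by rewrite inE/= in_itv/=; lra.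
under eq_fun do rewrite riE.
apply: (@continuity_under_integral _ _ _ (@lebesgue_measure R)
  (fun x y => G (x, y)) `[a, b]%classic _ (x - 1) (x + 1) _ _ (fun=> B) _ _ x xI) => //.
- by move=> t _; apply: ri_integrable; exact: continuous_row.
- by apply: aeW => y _ t _; exact: continuous_col.
- by apply: ri_integrable; exact: ct_cst.
- move=> t /=; rewrite in_itv/= => /andP[t1 t2]; apply: aeW => y /=.
  by rewrite in_itv/= => yab; apply: GB => //; rewrite !ltW.
Qed.

(** Differentiability is asked for [a < y < b] only, because functions in [C1_bar] are
    differentiable just inside the rectangle; the closed segment and its interior give the same
    integral. *)
Lemma is_derive_ri (R : realType) (a b u v x : R) (G G1 : R * R -> R) :
  continuous G -> continuous G1 -> u < x < v ->
  (forall t y, u < t < v -> a < y < b -> is_derive t 1 (fun s => G (s, y)) (G1 (t, y))) ->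
  is_derive x 1 (fun t => ri a b (fun y => G (t, y))) (ri a b (fun y => G1 (x, y))).
Proof.
move=> cG cG1 xuv dG.
have [B B0 GB] := continuous_bounded2 u v a b cG1.
have Ix : `]u, v[%classic x by rewrite /= in_itv.
have intG t : `]u, v[%classic t ->
    (@lebesgue_measure R).-integrable `]a, b[ (EFin \o (fun y => G (t, y))).
  move=> _; have if_ := ri_integrable a b (continuous_row (x := t) cG).
  by apply: integrableS if_ => //; exact: subset_itv_oo_cc.
have dG1 t y : `]u, v[%classic t -> `]a, b[%classic y ->
    derivable (fun s => G (s, y)) t 1.
  by rewrite /= !in_itv/= => tuv yab; case: (dG t y tuv yab).
have p1 t y : `]u, v[%classic t -> `]a, b[%classic y ->
    partial1of2 (fun s y => G (s, y)) t y = G1 (t, y).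
  rewrite /= !in_itv/= => tuv yab; rewrite partial1of2E.
  by case: (dG t y tuv yab) => _ <-.
have GB1 t y : `]u, v[%classic t -> `]a, b[%classic y ->
    `|partial1of2 (fun s y => G (s, y)) t y| <= B.
  move=> tuv yab; rewrite p1//; move: tuv yab; rewrite /= !in_itv/=.
  by move=> /andP[t1 t2] /andP[y1 y2]; apply: GB; rewrite !ltW.
have mab : measurable (`]a, b[%classic : set (measurableTypeR R)) by [].
have intB : (@lebesgue_measure R).-integrable `]a, b[ (EFin \o (fun=> B)).
  have if_ := ri_integrable a b (@ct_cst _ _ B).
  by apply: integrableS if_ => //; exact: subset_itv_oo_cc.
have D := @derivable_under_integral R _ _ (@lebesgue_measure R) (fun s y => G (s, y)) _ mab _ _ _ Ix intG dG1 _ (fun=> B0) intB GB1.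
have E := @differentiation_under_integral R _ _ (@lebesgue_measure R) (fun s y => G (s, y)) _ mab _ _ _ Ix intG dG1 _ (fun=> B0) intB GB1.
have -> : (fun t => ri a b (fun y => G (t, y))) = (fun t => \int[@lebesgue_measure R]_(y in `]a, b[) G (t, y)).
  by apply/funext => t; rewrite riE_oo//; exact: continuous_row.
apply: (DeriveDef D); rewrite -derive1E E riE_oo; last exact: continuous_row.
by apply: eq_Rintegral => y; rewrite inE/= => yab; exact: p1.
Qed.

Definition step_seq (R : realType) (H : nat -> R -> R) (d z x : R) (n : nat) (y : R) : R :=
  (- d^-1) ^+ n * H n (- d^-1 * y + x / d) - (- d^-1) ^+ n * H n (- d^-1 * y + z / d).

Lemma smooth_step_seq (R : realType) (H : nat -> R -> R) (d z x : R) :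
  smooth_seq H -> smooth_seq (step_seq H d z x).
Proof. by move=> sH; apply: smooth_seqB; apply: smooth_seq_affine. Qed.

Lemma step_seq_support (R : realType) (H : nat -> R -> R) (d z x y : R) n :
  smooth_step H -> 0 < d -> z <= x -> y <= z - d \/ x + d <= y ->
  step_seq H d z x n y = 0.
Proof.
move=> [_ Hl Hr Hr1 _] d0 zx [yz|xy].
  have h t : z <= t -> 1 <= - d^-1 * y + t / d.
    by move=> zt; rewrite (_ : _ + _ = (t - y) / d); [rewrite ler_pdivlMr//; lra|ring].
  have hx := h x zx; have hz := h z (lexx _).
  rewrite /step_seq; case: n => [|n]; first by rewrite !Hr// subrr.
  by rewrite !Hr1// !mulr0 subrr.
have h t : t <= x -> - d^-1 * y + t / d <= - 1.
  by move=> zt; rewrite (_ : _ + _ = (t - y) / d); [rewrite ler_pdivrMr//; lra|ring].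
by rewrite /step_seq !Hl ?mulr0 ?subrr//; apply: h.
Qed.

Lemma step_seq0_itv (R : realType) (H : nat -> R -> R) (d z x y : R) :
  smooth_step H -> 0 < d -> z <= x -> 0 <= step_seq H d z x 0 y <= 1.
Proof.
move=> sH d0 zx; rewrite /step_seq !expr0 !mul1r subr_ge0.
rewrite smooth_step_ndecr//=; last by rewrite lerD2l ler_pM2r ?invr_gt0.
have /andP[_ h1] := smooth_step_itv (- d^-1 * y + x / d) sH.
have /andP[h2 _] := smooth_step_itv (- d^-1 * y + z / d) sH.
lra.
Qed.

Lemma step_seq0_eq1 (R : realType) (H : nat -> R -> R) (d z x y : R) :
  smooth_step H -> 0 < d -> z + d <= y <= x - d -> step_seq H d z x 0 y = 1.
Proof.
move=> [_ Hl Hr _ _] d0 /andP[zy yx]; rewrite /step_seq !expr0 !mul1r Hr ?Hl ?subr0//.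
  by rewrite (_ : _ + _ = (z - y) / d); [rewrite ler_pdivrMr//; lra|ring].
by rewrite (_ : _ + _ = (x - y) / d); [rewrite ler_pdivlMr//; lra|ring].
Qed.

(* [step_seq H d z x] lists the derivatives of a smoothed indicator function of
   [[z, x]], so this is a weak form of [`|\int_z^x f^(i)| <= C], that is, of a
   bound on the oscillation of [f^(i-1)]. *)
Definition weak_bound (R : realType) (H : nat -> R -> R) (f : R -> R) (i : nat) (C : R) :=
  forall d z x, 0 < d -> -1 < z - d -> z <= x -> x + d < 1 ->
    `|ri (- 1) 1 (fun y => f y * step_seq H d z x i y)| <= C.

(* [mollify H f d s] is the [s]-th derivative of the convolution of [f] with
   the kernel [H'(./d)/d]. *)
Definition mollify (R : realType) (H : nat -> R -> R) (f : R -> R) (d : R) (s : nat) (x : R) : R :=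
  ri (- 1) 1 (fun y => f y * (d^-1 ^+ s.+1 * H s.+1 (d^-1 * (x - y)))).

Lemma is_derive_mollify (R : realType) (H : nat -> R -> R) (f : R -> R) (d : R) s (x : R) :
  smooth_seq H -> continuous f ->
  is_derive x 1 (mollify H f d s) (mollify H f d s.+1 x).
Proof.
move=> sH cf.
have cH n : continuous (H n) by exact: smooth_seq_continuous.
pose G n (z : R * R) := f z.2 * (d^-1 ^+ n.+1 * H n.+1 (d^-1 * (z.1 - z.2))).
have cG n : continuous (G n).
  have := cH n.+1; rewrite /G => cHn; cts.
apply: (@is_derive_ri _ _ _ (x - 1) (x + 1) _ (G s) (G s.+1)) => //; first by lra.
move=> t y _ _; rewrite /G/=.
have D1 := is_derive_affine (a := d^-1) (b := - d^-1 * y) (x := t) (sH s.+1 _).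
have := is_deriveZ (f y * d^-1 ^+ s.+1) D1.
rewrite /GRing.scale/= => D2.
rewrite (_ : f y * (_ * _) = f y * d^-1 ^+ s.+1 *
    (d^-1 * H s.+2 (d^-1 * t + - d^-1 * y))); last first.
  by rewrite [in LHS]exprSr -!mulrA mulrBr mulNr.
apply: is_derive_ext D2 => r /=.
by rewrite mulrBr mulNr mulrA.
Qed.

(** Both kernels have the same scale, so their difference is, up to sign, a derivative of the
    smoothed indicator of [[z, x]]. A weak bound of order [s + 1] thus controls the oscillation of
    the [s]-th derivative of the mollification. *)
Lemma mollify_sub (R : realType) (H : nat -> R -> R) (f : R -> R) (d z x : R) s :
  smooth_seq H -> continuous f ->
  mollify H f d s x - mollify H f d s z =
  (- 1) ^+ s.+1 * ri (- 1) 1 (fun y => f y * step_seq H d z x s.+1 y).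
Proof.
move=> sH cf; have cH := smooth_seq_continuous (n := s.+1) sH.
have cS := smooth_seq_continuous (n := s.+1) (smooth_step_seq d z x sH).
rewrite /mollify -riB; [|by cts..].
rewrite -riZ; [|by cts].
apply: ri_ext => y _; rewrite /step_seq.
have -> : (- d^-1) ^+ s.+1 = (- 1) ^+ s.+1 * d^-1 ^+ s.+1 by rewrite -exprMn mulN1r.
rewrite (_ : - d^-1 * y + x / d = d^-1 * (x - y)); last by ring.
rewrite (_ : - d^-1 * y + z / d = d^-1 * (z - y)); last by ring.
have s2 : (- 1) ^+ s.+1 * (- 1) ^+ s.+1 = 1 :> R by rewrite -exprMn mulrNN mulr1 expr1n.
set A := (- 1) ^+ s.+1 in s2 *; set B := _^-1 ^+ _.
rewrite (_ : A * (f y * _) = A * A * (f y * (B * H s.+1 (d^-1 * (x - y)) - B * H s.+1 (d^-1 * (z - y))))); last by ring.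
by rewrite s2; ring.
Qed.

Lemma mollify_sub_le (R : realType) (H : nat -> R -> R) (f : R -> R) (d z x C : R) s :
  smooth_step H -> continuous f -> weak_bound H f s.+1 C ->
  0 < d -> - 1 < z - d -> z <= x -> x + d < 1 ->
  `|mollify H f d s x - mollify H f d s z| <= C.
Proof.
move=> [sH _ _ _ _] cf fC d0 z1 zx x1; rewrite mollify_sub// normrM.
by rewrite normrX normrN1 expr1n mul1r; exact: fC.
Qed.

(** The kernel has mass one and lives within [d] of [x]. The value [w] is kept free because, after a
    rescaling, a mollification at [l * x] is compared with [f x]. *)
Lemma mollify_approx (R : realType) (H : nat -> R -> R) (f : R -> R) (d x w e : R) :
  smooth_step H -> continuous f -> 0 < d -> - 1 <= x - d -> x + d <= 1 ->
  (forall y, `|y - x| <= d -> `|f y - w| <= e) ->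
  `|mollify H f d 0 x - w| <= e.
Proof.
move=> [sH Hl Hr Hr1 H1] cf d0 x1 x2 fw.
have cH := smooth_seq_continuous (n := 1%N) sH.
pose K y := d^-1 * H 1%N (d^-1 * (x - y)).
have cK : continuous K by rewrite /K; cts.
have K0 y : 0 <= K y by rewrite mulr_ge0// invr_ge0 ltW.
have K1 : ri (- 1) 1 K = 1.
  pose F (y : R) := - H 0%N (- d^-1 * y + d^-1 * x).
  have dn0 : d != 0 by rewrite gt_eqF.
  have -> : ri (- 1) 1 K = F 1 - F (- 1).
    apply: ri_FTC2_cc; [lra|by []|].
    move=> y _; rewrite /K /F.
    have := is_deriveN (is_derive_affine (a := - d^-1) (b := d^-1 * x) (x := y) (sH 0%N _)).
    rewrite mulNr opprK (_ : - d^-1 * y + d^-1 * x = d^-1 * (x - y)) //; ring.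
  rewrite /F Hl; last first.
    by rewrite mulr1 (_ : - d^-1 + d^-1 * x = (x - 1) / d); [rewrite ler_pdivrMr//; lra|field].
  rewrite Hr ?oppr0 ?opprK ?add0r//.
  by rewrite mulrN1 opprK (_ : d^-1 + d^-1 * x = (x + 1) / d); [rewrite ler_pdivlMr//; lra|field].
have -> : mollify H f d 0 x - w = ri (- 1) 1 (fun y => f y * K y - w * K y).
  rewrite riB; [|by cts..].
  by rewrite riZ// K1 mulr1 /mollify; congr (_ - _); apply: ri_ext => y _; rewrite expr1.
have bd y : - 1 <= y <= 1 -> `|f y * K y - w * K y| <= e * K y.
  move=> _; rewrite -mulrBl normrM (ger0_norm (K0 y)).
  have [yx|yx] := leP `|y - x| d; first by rewrite ler_wpM2r// fw.
  rewrite (_ : K y = 0) ?mulr0//; rewrite /K.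
  move: yx; rewrite ltr_normr => /orP[yx|yx].
    by rewrite Hl ?mulr0// mulrC ler_pdivrMr//; lra.
  by rewrite Hr1 ?mulr0// mulrC ler_pdivlMr//; lra.
rewrite ler_norml; apply/andP; split.
  rewrite [leLHS](_ : - e = - e * ri (- 1) 1 K); last by rewrite K1 mulr1.
  rewrite -riZ//.
  apply: le_ri; [by cts..|] => y /bd; rewrite ler_norml mulNr => /andP[h _]; exact: h.
rewrite [leRHS](_ : e = e * ri (- 1) 1 K); last by rewrite K1 mulr1.
rewrite -riZ//.
by apply: le_ri; [by cts..|] => y /bd; rewrite ler_norml => /andP[].
Qed.

(** The bound on differences of mollifications does not depend on the width [d], which may therefore
    be taken as small as the uniform continuity of [f] demands. *)
Lemma weak_bound_osc (R : realType) (H : nat -> R -> R) (f : R -> R) (C z x : R) :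
  smooth_step H -> continuous f -> weak_bound H f 1 C -> - 1 < z -> z <= x -> x < 1 ->
  `|f x - f z| <= C.
Proof.
move=> sH cf fC z1 zx x1; apply/ler_addgt0Pr => e e0.
have e20 : 0 < e / 2 by rewrite divr_gt0.
have [d1 d10 fd] := uniform_continuity (- 1) 1 cf e20.
pose d := Num.min d1 (Num.min ((1 + z) / 2) ((1 - x) / 2)).
have d0 : 0 < d by rewrite !lt_min; apply/and3P; split; lra.
have dd1 : d <= d1 by rewrite ge_min lexx.
have dz : d <= (1 + z) / 2 by rewrite !ge_min lexx orbT.
have dx : d <= (1 - x) / 2 by rewrite !ge_min lexx !orbT.
have A t : z <= t -> t <= x -> `|mollify H f d 0 t - f t| <= e / 2.
  move=> zt tx; apply: mollify_approx => //; try lra.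
  by move=> y yt; apply: fd; [lra|exact: le_trans dd1].
have Ax := A x zx (lexx _); have Az := A z (lexx _) zx.
have := mollify_sub_le sH cf fC d0; move=> /(_ z x); do 3 (move=> /(_ ltac:(lra))).
move: Ax Az; rewrite !ler_norml => /andP[? ?] /andP[? ?] /andP[? ?].
by apply/andP; split; lra.
Qed.

(** Order 1 keeps [f] within [C] of [f x]; order 0 bounds the integral of [f] against a fixed
    plateau of mass [I >= 1/2]. Hence [|f x| I <= C + C I], and 3 is [1 + 1 / (1/2)]. *)
Lemma weak_bound_sup (R : realType) (H : nat -> R -> R) (f : R -> R) (C x : R) :
  smooth_step H -> continuous f -> weak_bound H f 0 C -> weak_bound H f 1 C ->
  - 1 < x < 1 -> `|f x| <= 3 * C.
Proof.
move=> sH cf fC0 fC1 x11.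
have osc y : - 1 < y < 1 -> `|f x - f y| <= C.
  move=> y11; have [xy|/ltW yx] := leP y x.
    by apply: (weak_bound_osc sH) => //; lra.
  by rewrite distrC; apply: (weak_bound_osc sH) => //; lra.
pose S := step_seq H 4^-1 (- 2^-1) 2^-1 0.
have d40 : 0 < 4^-1 :> R by rewrite invr_gt0.
have cS : continuous S by apply/smooth_seq_continuous/smooth_step_seq; case: sH.
have S01 y : 0 <= S y <= 1 by apply: step_seq0_itv => //; lra.
have Sge : 2^-1 <= ri (- 1) 1 S.
  rewrite (@ri_split _ _ _ (- 4^-1))//; try lra.
  rewrite (@ri_split _ (- 4^-1) _ 4^-1)//; try lra.
  have r0 (u v : R) : u <= v -> 0 <= ri u v S.
    move=> uv; rewrite -[leLHS](mul0r (v - u)) -ri_cst//.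
    by apply: le_ri; [cts|cts|move=> y _; case/andP: (S01 y)].
  have -> : ri (- 4^-1) 4^-1 S = 2^-1.
    rewrite (@ri_ext _ _ _ _ (fun=> 1)); first by rewrite ri_cst; lra.
    by move=> y y4; apply: step_seq0_eq1 => //; lra.
  have := r0 (- 1) (- 4^-1); have := r0 4^-1 1; lra.
have b0 : `|ri (- 1) 1 (fun y => f y * S y)| <= C.
  apply: fC0 => //; lra.
have b1 : `|ri (- 1) 1 (fun y => f x * S y - f y * S y)| <= C * ri (- 1) 1 S.
  have bd y : - 1 <= y <= 1 -> `|f x * S y - f y * S y| <= C * S y.
    move=> y11; have /andP[Sy0 _] := S01 y.
    rewrite -mulrBl normrM (ger0_norm Sy0).
    have [y2|y2] := boolP (- 1 < y < 1); first by rewrite ler_wpM2r// osc.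
    rewrite (_ : S y = 0) ?mulr0//; apply: step_seq_support => //; first lra.
    move: y2; rewrite negb_and -!leNgt => /orP[y2|y2]; [left|right]; lra.
  rewrite ler_norml; apply/andP; split.
    rewrite -mulNr -riZ//.
    apply: le_ri; [by cts..|] => y /bd; rewrite ler_norml mulNr => /andP[h _]; exact: h.
  rewrite -riZ//.
  by apply: le_ri; [by cts..|] => y /bd; rewrite ler_norml => /andP[].
move: b1; rewrite riB; [|by cts..].
rewrite riZ// => b1.
set I := ri (- 1) 1 S in Sge b1.
have I0 : 0 < I by lra.
have C0 : 0 <= C by exact: le_trans b0.
have : `|f x| * I <= C + C * I.
  rewrite -[I in leLHS]gtr0_norm// -normrM.
  rewrite -[f x * I](subrK (ri (- 1) 1 (fun y => f y * S y))).
  by rewrite (le_trans (ler_normD _ _))// addrC lerD.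
nra.
Qed.

(** Integration by parts in [y]: the [sin y] of the inner derivative times [sin (j y + b) / j]
    splits into the frequencies [j - 1] and [j + 1]. Each derivative gains one factor and lowers the
    least index by one, whence [(j - s) ^+ s]. *)
Lemma fcoef_cos_decay (R : realType) (s : nat) (g : nat -> R -> R) (K : R) :
  (forall i (x : R), (i < s)%N -> is_derive x 1 (g i) (g i.+1 x)) ->
  continuous (g s) -> (forall x : R, - 1 <= x <= 1 -> `|g s x| <= K) ->
  forall j b, (s < j)%N ->
    `|fcoef (fun y => g 0%N (cos y)) j b| <= 2 * pi * K / (j - s)%:R ^+ s.
Proof.
elim: s g => [|s IH] g dg cg gK j b sj.
  rewrite expr0 divr1 /fcoef.
  rewrite [leRHS](_ : _ = K * (2 * pi - 0)); last by rewrite subr0 mulrC.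
  apply: ri_norm_le; [exact: twopi_ge0|by cts|] => x _.
  rewrite normrM -[K]mulr1 ler_pM ?normr_ge0 ?cos_max//.
  by apply: gK; rewrite cos_geN1 cos_le1.
case: j sj => // j sj.
have cg1 : continuous (g 1%N).
  case: s dg cg {IH gK sj} => // s dg _ x; exact: is_derive_continuous (dg 1%N x isT).
have cg0 : continuous (g 0%N) by move=> x; exact: is_derive_continuous (dg 0%N x isT).
have IH1 i c : (s < i)%N ->
    `|fcoef (fun y => g 1%N (cos y)) i c| <= 2 * pi * K / (i - s)%:R ^+ s.
  by move=> si; apply: (IH (fun n => g n.+1)) => // n x ns; exact: dg.
have j0 : j.+1%:R != 0 :> R by rewrite pnatr_eq0.
have E : fcoef (fun y => g 0%N (cos y)) j.+1 b =
    (2 * j.+1%:R)^-1 * (fcoef (fun y => g 1%N (cos y)) j b -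
                        fcoef (fun y => g 1%N (cos y)) j.+2 b).
  pose F y := g 0%N (cos y) * (j.+1%:R^-1 * sin (j.+1%:R * y + b)).
  pose f y := g 0%N (cos y) * cos (j.+1%:R * y + b) -
     (2 * j.+1%:R)^-1 * (g 1%N (cos y) * cos (j%:R * y + b) -
        g 1%N (cos y) * cos (j.+2%:R * y + b)).
  have dF (y : R) : is_derive y 1 F (f y).
    have D1 : is_derive y 1 (fun t => g 0%N (cos t)) (g 1%N (cos y) * - sin y).
      exact: (is_derive1_comp (dg 0%N _ _) (is_derive_cos y)).
    have D2 := is_deriveZ j.+1%:R^-1 (is_derive_affine (is_derive_sin (j.+1%:R * y + b))).
    apply: (is_derive_eq (is_deriveM D1 D2)).
    rewrite /GRing.scale/= /f [_^-1 * (_ * cos _)]mulrA mulVf// mul1r.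
    have S := mul_sin_sin (j.+1%:R * y + b) y.
    rewrite (_ : j.+1%:R * y + b - y = j%:R * y + b) in S; last by rewrite -(@natr1 _ j); ring.
    rewrite (_ : j.+1%:R * y + b + y = j.+2%:R * y + b) in S; last by rewrite -(@natr1 _ j.+1); ring.
    rewrite (_ : j.+1%:R^-1 * sin _ * _ = - (j.+1%:R^-1 * g 1%N (cos y) *
       (sin (j.+1%:R * y + b) * sin y))); last by ring.
    by rewrite S; field.
  have cf : continuous f by rewrite /f; cts.
  have : ri 0 (2 * pi) f = F (2 * pi) - F 0 by apply: ri_FTC2_cc => //; exact: twopi_ge0.
  have -> : F (2 * pi) = F 0.
    rewrite /F mulr0 add0r (addrC (_ * (2 * pi))) sin_natD2pi.
    by rewrite -(cos_natD2pi 1%N 0) add0r mul1r.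
  rewrite subrr /f riB; [|by cts..].
  rewrite riZ; [|by cts].
  rewrite riB; [|by cts..].
  by move/eqP; rewrite subr_eq0 => /eqP.
rewrite E normrM ger0_norm ?invr_ge0 ?mulr_ge0//.
have K0 : 0 <= K by apply: le_trans (gK 0 _); rewrite ?normr_ge0//; lra.
have sj' : (s < j)%N by rewrite -ltnS.
have jsn : (0 < j - s)%N by rewrite subn_gt0.
have B1 := IH1 j b sj'.
have B2 : `|fcoef (fun y => g 1%N (cos y)) j.+2 b| <= 2 * pi * K / (j - s)%:R ^+ s.
  apply: (le_trans (IH1 j.+2 b _)); first by rewrite ltnW// ltnW.
  rewrite ler_wpM2l ?mulr_ge0 ?pi_ge0// lef_pV2 ?posrE ?exprn_gt0 ?ltr0n//.
    by apply: lerXn2r; rewrite ?nnegrE// ler_nat leq_sub2r// ltnW.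
  by rewrite subn_gt0 ltnW// ltnW.
rewrite subSS.
have H : `|fcoef (fun y => g 1%N (cos y)) j b - fcoef (fun y => g 1%N (cos y)) j.+2 b|
    <= 2 * (2 * pi * K / (j - s)%:R ^+ s).
  by apply: (le_trans (ler_normB _ _)); rewrite mulr_natl mulr2n lerD.
apply: (le_trans (ler_wpM2l _ H)); first by rewrite invr_ge0 mulr_ge0.
set Z := 2 * pi * K / (j - s)%:R ^+ s.
have Z0 : 0 <= Z by rewrite /Z !mulr_ge0 ?pi_ge0// invr_ge0 exprn_ge0.
have -> : 2 * pi * K / (j - s)%:R ^+ s.+1 = Z / (j - s)%:R.
  by rewrite /Z exprSr invfM mulrA.
rewrite (_ : (2 * j.+1%:R)^-1 * (2 * Z) = Z / j.+1%:R); last by move: Z {Z0} => Z; field.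
rewrite ler_wpM2l// lef_pV2 ?posrE ?ltr0n// ler_nat.
by rewrite (leq_trans (leq_subr _ _)).
Qed.

(** The mean value theorem for the [s]-th derivative finds a point where the next one is at most
    [2 C], and the weak bound of order [s + 2] limits its oscillation to [C]. The result is uniform
    in [d]. *)
Lemma mollify_bound (R : realType) (H : nat -> R -> R) (f : R -> R) (C d : R) (s : nat) (x : R) :
  smooth_step H -> continuous f -> weak_bound H f s.+1 C -> weak_bound H f s.+2 C ->
  0 < d -> d <= 8^-1 -> - 1 + 2 * d <= x <= 1 - 2 * d -> `|mollify H f d s.+1 x| <= 3 * C.
Proof.
move=> sH cf f1 f2 d0 d8 /andP[x1 x2]; have sH' : smooth_seq H by case: sH.
pose a := - 1 + 2 * d; pose b := 1 - 2 * d.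
have ab : a < b by rewrite /a /b; lra.
have [||c] := @MVT R (mollify H f d s) (mollify H f d s.+1) a b ab.
- by move=> y _; exact: is_derive_mollify.
- apply: continuous_subspaceT => y; exact: is_derive_continuous (is_derive_mollify _ _ _ _ _).
rewrite in_itv/= => /andP[ac cb] E.
have B1 : `|mollify H f d s b - mollify H f d s a| <= C.
  by apply: mollify_sub_le => //; rewrite /a /b; lra.
have Bc : `|mollify H f d s.+1 c| <= 2 * C.
  move: B1; rewrite E normrM (gtr0_norm (_ : 0 < b - a)); last by rewrite subr_gt0.
  have : 2^-1 <= b - a by rewrite /a /b; lra.
  have := normr_ge0 (mollify H f d s.+1 c); nra.
have B2 : `|mollify H f d s.+1 x - mollify H f d s.+1 c| <= C.
  have [cx|/ltW xc] := leP c x.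
    by apply: mollify_sub_le => //; move: ac cb; rewrite /a /b; lra.
  by rewrite distrC; apply: mollify_sub_le => //; move: ac cb; rewrite /a /b; lra.
rewrite -[mollify H f d s.+1 x](subrK (mollify H f d s.+1 c)).
apply: (le_trans (ler_normD _ _)); lra.
Qed.

(** [f] is only continuous: the decay is proved for rescaled mollifications, with a constant
    independent of [d], and carries over to [f] because they approximate it uniformly. *)
Lemma weak_bound_cheb_decay (R : realType) (H : nat -> R -> R) (f : R -> R) (C : R) (s j : nat) (b : R) :
  smooth_step H -> continuous f -> weak_bound H f s.+1 C -> weak_bound H f s.+2 C ->
  (s.+1 < j)%N ->
  `|fcoef (fun y => f (cos y)) j b| <= 2 * pi * (3 * C) / (j - s.+1)%:R ^+ s.+1.
Proof.
move=> sH cf f1 f2 sj; apply/ler_addgt0Pr => e e0.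
have sH' : smooth_seq H by case: sH.
have e20 : 0 < e / (2 * pi) by rewrite divr_gt0// twopi_gt0.
have [d1 d10 fd] := uniform_continuity (- 1) 1 cf e20.
pose d := Num.min (d1 / 3) 8^-1.
have d0 : 0 < d by rewrite lt_min divr_gt0//= invr_gt0.
have dd1 : d <= d1 / 3 by rewrite ge_min lexx.
have d8 : d <= 8^-1 by rewrite ge_min lexx orbT.
(* Rescaling by [l] keeps the mollification kernel inside [[-1, 1]]. *)
pose l : R := 1 - 2 * d.
have l01 : 0 <= l <= 1 by rewrite /l; lra.
pose g n (x : R) := l ^+ n * mollify H f d n (l * x).
have dg n (x : R) : is_derive x 1 (g n) (g n.+1 x).
  have D := is_deriveZ (l ^+ n) (is_derive_affine (a := l) (b := 0) (x := x) (is_derive_mollify d n _ sH' cf)).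
  move: D; rewrite /GRing.scale/= addr0 mulrA -exprSr => D.
  by apply: is_derive_ext D => t; rewrite /= /g addr0.
have cg n : continuous (g n) by move=> x; exact: is_derive_continuous (dg n x).
have gK x : - 1 <= x <= 1 -> `|g s.+1 x| <= 3 * C.
  move=> x11; rewrite normrM normrX ger0_norm; last by case/andP: l01.
  have B : `|mollify H f d s.+1 (l * x)| <= 3 * C.
    apply: mollify_bound => //; rewrite /l in l01 *; apply/andP; split; nra.
  have : l ^+ s.+1 <= 1 by apply: exprn_ile1; case/andP: l01.
  have := normr_ge0 (mollify H f d s.+1 (l * x)).
  have : 0 <= l ^+ s.+1 by apply: exprn_ge0; case/andP: l01.
  nra.
have D := fcoef_cos_decay (fun i x _ => dg i x) (cg s.+1) gK b sj.
have g0 x : - 1 <= x <= 1 -> `|g 0%N x - f x| <= e / (2 * pi).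
  move=> x11; rewrite /g expr0 mul1r.
  apply: mollify_approx => //.
  - by rewrite /l; nra.
  - by rewrite /l; nra.
  move=> y yx; apply: fd => //.
  have lx : `|l * x - x| <= 2 * d.
    by rewrite /l ler_norml; apply/andP; split; nra.
  have := ler_distD (l * x) y x; lra.
have A : `|fcoef (fun y => f (cos y)) j b - fcoef (fun y => g 0%N (cos y)) j b| <= e.
  have c0 := cg 0%N.
  rewrite -fcoefB; [|by cts..].
  rewrite /fcoef [leRHS](_ : e = e / (2 * pi) * (2 * pi - 0)); last first.
    by rewrite subr0 divfK// gt_eqF// twopi_gt0.
  apply: ri_norm_le; [exact: twopi_ge0|by cts|] => y _.
  rewrite normrM -[leRHS]mulr1 ler_pM ?normr_ge0 ?cos_max// distrC.
  by apply: g0; rewrite cos_geN1 cos_le1.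
rewrite -[fcoef _ _ _](subrK (fcoef (fun y => g 0%N (cos y)) j b)).
by apply: (le_trans (ler_normD _ _)); rewrite addrC lerD.
Qed.

(** * Functions of class C^1 on the closed rectangle *)

Definition clamp (R : realType) (a b x : R) : R := Num.max a (Num.min x b).

Lemma continuous_clamp (R : realType) (a b : R) : continuous (clamp a b).
Proof.
move=> x; apply: (@continuous_max _ _ (fun=> a) (fun x => Num.min x b)).
  exact: cvg_cst.
by apply: (@continuous_min _ _ id (fun=> b)); [exact: cvg_id|exact: cvg_cst].
Qed.

Lemma clamp_itv (R : realType) (a b x : R) : a <= b -> a <= clamp a b x <= b.
Proof. by move=> ab; rewrite le_max lexx/= ge_max ab/= ge_min lexx orbT. Qed.

Lemma clampK (R : realType) (a b x : R) : a <= x <= b -> clamp a b x = x.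
Proof. by move=> /andP[ax xb]; rewrite /clamp min_l// max_r. Qed.

Definition clamp2 (R : realType) (z : R * R) : R * R :=
  (clamp (- 1) 1 z.1, clamp 0 (2 * pi) z.2).

Lemma continuous_clamp2 (R : realType) : continuous (@clamp2 R).
Proof.
move=> z; apply/cvg_ballP => e e0; near=> t; split => /=; near: t.
  have := @ct_comp R (R * R)%type _ _ (@continuous_clamp R (- 1) 1) (@ct_fst R) z.
  by move/cvg_ballP; apply.
have := @ct_comp R (R * R)%type _ _ (@continuous_clamp R 0 (2 * pi)) (@ct_snd R) z.
by move/cvg_ballP; apply.
Unshelve. all: by end_near. Qed.

Lemma clamp2_clOmega' (R : realType) (z : R * R) : clOmega' R (clamp2 z).
Proof. by split; apply: clamp_itv; [lra|exact: twopi_ge0]. Qed.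

Lemma clamp2K (R : realType) (z : R * R) : clOmega' R z -> clamp2 z = z.
Proof. by case: z => a b [/= za zb]; rewrite /clamp2/= !clampK. Qed.

Lemma Omega'_clOmega' (R : realType) : Omega' R `<=` clOmega' R.
Proof. by move=> z [/andP[a b] /andP[c d]]; split; rewrite !ltW. Qed.

Lemma open_Omega' (R : realType) : open (Omega' R).
Proof.
have -> : Omega' R = (fst @^-1` `]-1, 1[%classic) `&` (snd @^-1` `]0, 2 * pi[%classic).
  by apply/seteqP; split => z /=; rewrite /Omega'/= !in_itv/=.
apply: openI; apply: open_comp => //; try exact: itv_open.
all: by move=> ? _; [exact: cvg_fst || exact: cvg_snd].
Qed.

Lemma near_Omega' (R : realType) (z : R * R) : Omega' R z -> \forall x \near z, Omega' R x.
Proof. by move=> zO; exact: (open_nbhs_nbhs (conj (@open_Omega' R) zO)). Qed.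

Lemma Omega'_closure (R : realType) : clOmega' R `<=` closure (Omega' R).
Proof.
move=> [a b] [/= /andP[a1 a2] /andP[b1 b2]] V /nbhs_ballP[e /= e0 eV].
have pi0 := pi_gt0 R.
pose t := Num.min (e / 8) 2^-1.
have t0 : 0 < t by rewrite lt_min; apply/andP; split; lra.
have te : t <= e / 8 by rewrite ge_min lexx.
have t1 : t <= 2^-1 by rewrite ge_min lexx orbT.
pose s := t / (1 + pi).
have s0 : 0 < s by rewrite divr_gt0//; lra.
have sE : s * (1 + pi) = t by rewrite /s divfK// gt_eqF//; lra.
have s1 : s * pi <= t by lra.
(* The point is moved slightly towards the centre [(0, pi)] of the rectangle. *)
exists (a * (1 - s), b + s * (pi - b)); split.
  split => /=; apply/andP; split; nra.
apply: eV; split; rewrite /ball/= ltr_norml; apply/andP; split; nra.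
Qed.

Lemma within_Omega'_proper (R : realType) (z : R * R) : clOmega' R z ->
  ProperFilter (within (Omega' R) (nbhs z)).
Proof. by move=> /Omega'_closure; exact: within_nbhs_proper. Qed.

Lemma bpd_cvg (R : realType) (i : 'I_2) (f : R * R -> R) (z : R * R) :
  C1_bar f -> clOmega' R z ->
  pd i f x @[x --> within (Omega' R) (nbhs z)] --> bpd i f z.
Proof. by move=> [_ _ cf] zO; exact: cf. Qed.

Lemma bpd_unique (R : realType) (i : 'I_2) (f : R * R -> R) (z : R * R) (d : R) :
  clOmega' R z -> pd i f x @[x --> within (Omega' R) (nbhs z)] --> d ->
  bpd i f z = d.
Proof.
by move=> /within_Omega'_proper P cd; apply: cvg_lim.
Qed.

Lemma bpdE (R : realType) (i : 'I_2) (f : R * R -> R) (z : R * R) :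
  C1_bar f -> Omega' R z -> bpd i f z = pd i f z.
Proof.
move=> cf zO; have /cvgrPdist_lt H := bpd_cvg (i := i) cf (Omega'_clOmega' zO).
apply/eqP; rewrite -subr_eq0 -normr_le0; apply/ler_addgt0Pr => e e0.
rewrite add0r; apply/ltW.
by have := H e e0; rewrite nearE /within/= => /nbhs_singleton/(_ zO).
Qed.

(** A function made of limits is continuous: an estimate that holds near [z] for the interior
    derivative passes to the limit at every nearby point of the closed rectangle. *)
Lemma bpd_continuous (R : realType) (i : 'I_2) (f : R * R -> R) :
  C1_bar f -> {within clOmega' R, continuous (bpd i f)}.
Proof.
move=> cf; apply/subspace_continuousP => z zO; apply/cvgrPdist_le => /= e e0.
have e20 : 0 < e / 2 by rewrite divr_gt0.
have /cvgrPdist_le/(_ _ e20) := bpd_cvg (i := i) cf zO.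
rewrite /within /= nearE => /nbhs_interior; apply: filterS => x Hx xO.
have xP := within_Omega'_proper xO.
apply/ler_addgt0Pr => r r0.
have /cvgrPdist_le/(_ _ r0) Hr := bpd_cvg (i := i) cf xO.
have : \forall y \near within (Omega' R) (nbhs x), `|bpd i f z - pd i f y| <= e / 2.
  exact: Hx.
move=> /(filterI Hr)/(@filter_ex _ _ xP)[y [y1 y2]].
have := ler_distD (pd i f y) (bpd i f z) (bpd i f x).
rewrite (distrC (pd i f y)); lra.
Qed.

(** Projection onto the closed rectangle turns relative continuity into continuity on the plane, the
    setting in which the integral lemmas are stated. *)
Lemma continuous_comp_clamp2 (R : realType) (f : R * R -> R) :
  {within clOmega' R, continuous f} -> continuous (fun z => f (clamp2 z)).
Proof.
move=> /subspace_continuousP cf z; have zO := clamp2_clOmega' z.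
apply/cvgrPdist_lt => e e0; have /cvgrPdist_lt/(_ _ e0) := cf _ zO.
rewrite /within /= nearE => H.
have Hn : nbhs z (@clamp2 R @^-1` [set t | clOmega' R t -> `|f (clamp2 z) - f t| < e]).
  exact: (continuous_clamp2 H).
by apply: filterS Hn => x /=; apply; exact: clamp2_clOmega'.
Qed.

Lemma C1_bar_extension (R : realType) (v : R * R -> R) : C1_bar v ->
  exists V V1 V2 : R * R -> R,
  [/\ continuous V, continuous V1, continuous V2,
      forall z, clOmega' R z -> [/\ V z = v z, V1 z = bpd d_rho v z & V2 z = bpd d_phi v z]
    & forall x y, Omega' R (x, y) ->
       is_derive x 1 (fun t => V (t, y)) (V1 (x, y)) /\
       is_derive y 1 (fun t => V (x, t)) (V2 (x, y))].
Proof.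
move=> cv; have [cv0 dv _] := cv.
exists (fun z => v (clamp2 z)), (fun z => bpd d_rho v (clamp2 z)), (fun z => bpd d_phi v (clamp2 z)).
split.
- exact: continuous_comp_clamp2.
- exact/continuous_comp_clamp2/bpd_continuous.
- exact/continuous_comp_clamp2/bpd_continuous.
- by move=> z zO; rewrite clamp2K.
move=> x y xyO.
have xyO' := Omega'_clOmega' xyO.
rewrite clamp2K// !bpdE//; split.
  have D : is_derive x 1 (fun t => v (t, y)) (pd d_rho v (x, y)).
    by apply: DeriveDef; [exact: dv d_rho _ xyO|rewrite /pd derive1E].
  apply: near_eq_is_derive D.
  have := near_Omega' xyO => /nbhs_ballP[e /= e0 He].
  apply/nbhs_ballP; exists e => //= t xt; rewrite clamp2K//.
  by apply/Omega'_clOmega'/He; split => //=; exact: ballxx.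
have D : is_derive y 1 (fun t => v (x, t)) (pd d_phi v (x, y)).
  by apply: DeriveDef; [exact: dv d_phi _ xyO|rewrite /pd derive1E].
apply: near_eq_is_derive D.
have := near_Omega' xyO => /nbhs_ballP[e /= e0 He].
apply/nbhs_ballP; exists e => //= t xt; rewrite clamp2K//.
by apply/Omega'_clOmega'/He; split => //=; exact: ballxx.
Qed.

Lemma C1_bar_lin (R : realType) (a b : R) (f g : R * R -> R) :
  C1_bar f -> C1_bar g ->
  C1_bar (fun z => a * f z + b * g z) /\
  (forall i z, clOmega' R z ->
     bpd i (fun z => a * f z + b * g z) z = a * bpd i f z + b * bpd i g z).
Proof.
move=> cf cg; have [cf0 df _] := cf; have [cg0 dg _] := cg.
have pdE i x : Omega' R x ->
    is_derive (crd i x) 1 (fun t => a * f (set_crd i x t) + b * g (set_crd i x t))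
      (a * pd i f x + b * pd i g x).
  move=> xO.
  have Df : is_derive (crd i x) 1 (fun t => f (set_crd i x t)) (pd i f x).
    by apply: DeriveDef; [exact: df i x xO|rewrite /pd derive1E].
  have Dg : is_derive (crd i x) 1 (fun t => g (set_crd i x t)) (pd i g x).
    by apply: DeriveDef; [exact: dg i x xO|rewrite /pd derive1E].
  exact: is_deriveD (is_deriveZ a Df) (is_deriveZ b Dg).
have lim i z : clOmega' R z -> pd i (fun z => a * f z + b * g z) x
    @[x --> within (Omega' R) (nbhs z)] --> a * bpd i f z + b * bpd i g z.
  move=> zO; have zP := within_Omega'_proper zO.
  apply: (@cvg_trans _ ((a * pd i f x + b * pd i g x) @[x --> within (Omega' R) (nbhs z)])).
    apply: near_eq_cvg; rewrite /within/= nearE; apply: nearW => x xO.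
    by rewrite {3}/pd derive1E; case: (pdE i x xO) => _ ->.
  apply: cvgD; apply: cvgM; try exact: cvg_cst; exact: bpd_cvg.
split; last by move=> i z zO; apply: bpd_unique => //; exact: lim.
split.
- apply/subspace_continuousP => z zO.
  move/subspace_continuousP : cf0 => /(_ z zO) cf0.
  move/subspace_continuousP : cg0 => /(_ z zO) cg0.
  by apply: cvgD; apply: cvgM => //; exact: cvg_cst.
- by move=> i z zO; case: (pdE i z zO).
- by move=> i z zO; apply/cvg_ex; eexists; exact: lim.
Qed.

Lemma C1_bar_smooth (R : realType) (p p1 p2 : R * R -> R) :
  continuous p -> continuous p1 -> continuous p2 ->
  (forall x y : R, is_derive x 1 (fun t => p (t, y)) (p1 (x, y))) ->
  (forall x y : R, is_derive y 1 (fun t => p (x, t)) (p2 (x, y))) ->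
  C1_bar p /\ forall z, clOmega' R z -> bpd d_rho p z = p1 z /\ bpd d_phi p z = p2 z.
Proof.
move=> cp cp1 cp2 d1 d2.
have pd1 : pd d_rho p = p1.
  by apply/funext => -[x y]; rewrite /pd derive1E; case: (d1 x y) => _ <-.
have pd2 : pd d_phi p = p2.
  by apply/funext => -[x y]; rewrite /pd derive1E; case: (d2 x y) => _ <-.
have lim1 z : pd d_rho p x @[x --> within (Omega' R) (nbhs z)] --> p1 z.
  by rewrite pd1; apply: cvg_within_filter; exact: cp1.
have lim2 z : pd d_phi p x @[x --> within (Omega' R) (nbhs z)] --> p2 z.
  by rewrite pd2; apply: cvg_within_filter; exact: cp2.
have i01 (i : 'I_2) : i = d_rho \/ i = d_phi.
  by case: i => [[|[|//]] h]; [left|right]; apply/val_inj.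
split; last by move=> z zO; split; exact: bpd_unique.
split.
- exact: continuous_subspaceT.
- by move=> i [x y] _; case: (i01 i) => ->; [case: (d1 x y)|case: (d2 x y)].
- by move=> i z _; apply/cvg_ex; case: (i01 i) => ->; eexists; [exact: lim1|exact: lim2].
Qed.

(** * Sobolev regularity and Fourier coefficients *)

Lemma ri_EFin_oo (R : realType) (a b : R) (f : R -> R) : continuous f ->
  (\int[@lebesgue_measure R]_(x in `]a, b[) (f x)%:E = (ri a b f)%:E)%E.
Proof.
move=> cf; rewrite riE_oo// /Rintegral fineK//.
apply: integrable_fin_num => //.
have if_ := ri_integrable a b cf.
by apply: integrableS if_ => //; exact: subset_itv_oo_cc.
Qed.

Lemma integrable_co (R : realType) (a b : R) (f : R -> R) : continuous f ->
  (@lebesgue_measure R).-integrable `[a, b[ (EFin \o f).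
Proof.
move=> cf; have if_ := ri_integrable a b cf.
by apply: integrableS if_ => //; exact: subset_itv_co_cc.
Qed.

Lemma ri_EFin_co (R : realType) (a b : R) (f : R -> R) : continuous f ->
  (\int[@lebesgue_measure R]_(x in `[a, b[) (f x)%:E = (ri a b f)%:E)%E.
Proof.
move=> cf; have if_ := integrable_co a b cf.
rewrite riE -Rintegral_itv_bndo_bndc// /Rintegral fineK//.
exact: integrable_fin_num.
Qed.

Lemma floor_twopi (R : realType) (j : int) (y : R) :
  2 * pi * j%:~R <= y < 2 * pi * (j + 1)%:~R ->
  Num.floor (y / (2 * pi)) = j.
Proof.
have p0 := twopi_gt0 R.
move=> /andP[h1 h2]; apply/floor_def; rewrite ler_pdivlMr// ltr_pdivrMr//.
by rewrite mulrC h1 mulrC h2.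
Qed.

(** [Y] lives on three periods. On each of them the periodic extension is a translate of [w], and
    bringing the three pieces back to [[0, 2 pi]] replaces [Y] by the sum [c] of its translates. *)
Lemma integral_periodized (R : realType) (w Y c : R -> R) :
  continuous w -> continuous Y ->
  (forall y, y <= - (2 * pi) \/ 4 * pi <= y -> Y y = 0) ->
  (forall y, 0 <= y <= 2 * pi -> Y (y - 2 * pi) + Y y + Y (y + 2 * pi) = c y) ->
  (@lebesgue_measure R).-integrable [set: R]
     (fun y => (w (y - 2 * pi * (Num.floor (y / (2 * pi)))%:~R) * Y y)%:E) /\
  (\int[@lebesgue_measure R]_y
     (w (y - 2 * pi * (Num.floor (y / (2 * pi)))%:~R) * Y y)%:E =
   (ri 0 (2 * pi) (fun y => w y * c y))%:E)%E.
Proof.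
move=> cw cY Y0 Yc; have p0 := twopi_gt0 R.
set P := 2 * pi in p0 Y0 Yc *.
pose g1 y := w (y + P) * Y y.
pose g2 y := w y * Y y.
pose g3 y := w (y - P) * Y y.
have c1 : continuous g1 by rewrite /g1; cts.
have c2 : continuous g2 by rewrite /g2; cts.
have c3 : continuous g3 by rewrite /g3; cts.
pose I1 : set R := `[- P, 0[%classic.
pose I2 : set R := `[0, P[%classic.
pose I3 : set R := `[P, P + P[%classic.
have E y : (w (y - P * (Num.floor (y / P))%:~R) * Y y)%:E =
   (((EFin \o g1) \_ I1) y + (((EFin \o g2) \_ I2) y +
   ((EFin \o g3) \_ I3) y))%E.
  (* A patched function takes, outside its set, the default point of the extended reals, which is
     zero. *)
  have e0 : (point : \bar R) = 0%E by [].
  rewrite !patchE !mem_setE /= !in_itv/= !e0.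
  have [y1|y1] := ltP y (- P).
    rewrite Y0 ?mulr0; last by left; exact: ltW.
    have -> : (0 <= y < P) = false by apply/negP => /andP[]; lra.
    have -> : (P <= y < P + P) = false by apply/negP => /andP[]; lra.
    by rewrite /= !adde0.
  have [y2|y2] := ltP y 0.
    rewrite (@floor_twopi _ (- 1)); last by apply/andP; split; rewrite /= -/P; lra.
    have -> : (P <= y < P + P) = false by apply/negP => /andP[]; lra.
    rewrite /= !adde0 /g1; congr (_ * _)%:E; congr w.
    by rewrite mulrN1 opprK.
  have [y3|y3] := ltP y P.
    rewrite (@floor_twopi _ 0); last by apply/andP; split; rewrite /= -/P; lra.
    rewrite /= add0e adde0 /g2; congr (_ * _)%:E; congr w.
    by rewrite mulr0 subr0.
  rewrite /= !add0e; case: ifPn => [y4|y4].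
    rewrite (@floor_twopi _ 1); last by apply/andP; split; rewrite /= -/P; lra.
    by rewrite /g3 mulr1.
  rewrite Y0 ?mulr0//; right; rewrite -leNgt in y4; apply: le_trans y4.
  by rewrite /P; lra.
have mI1 : measurable (I1 : set (measurableTypeR R)) by exact: measurable_itv.
have mI2 : measurable (I2 : set (measurableTypeR R)) by exact: measurable_itv.
have mI3 : measurable (I3 : set (measurableTypeR R)) by exact: measurable_itv.
have i1 : (@lebesgue_measure R).-integrable setT ((EFin \o g1) \_ I1).
  by apply/(integrable_restrict _ mI1 measurableT); rewrite setTI; exact: integrable_co.
have i2 : (@lebesgue_measure R).-integrable setT ((EFin \o g2) \_ I2).
  by apply/(integrable_restrict _ mI2 measurableT); rewrite setTI; exact: integrable_co.
have i3 : (@lebesgue_measure R).-integrable setT ((EFin \o g3) \_ I3).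
  by apply/(integrable_restrict _ mI3 measurableT); rewrite setTI; exact: integrable_co.
rewrite (_ : (fun y => _) = (fun y => ((EFin \o g1) \_ I1) y + (((EFin \o g2) \_ I2) y +
   ((EFin \o g3) \_ I3) y))%E); last by apply/funext => y; rewrite -E.
split; first by apply: integrableD => //; exact: integrableD.
rewrite integralD//; last exact: integrableD.
rewrite integralD// -!integral_mkcond !ri_EFin_co// -!EFinD; congr EFin.
have -> : ri (- P) 0 g1 = ri 0 P (fun y => w y * Y (y - P)).
  rewrite (_ : ri (- P) 0 g1 = ri (0 + - P) (P + - P) g1); last by rewrite add0r subrr.
  rewrite ri_comp_shift//; last exact: ltW.
  by apply: ri_ext => y _; rewrite /g1 subrK.
have -> : ri P (P + P) g3 = ri 0 P (fun y => w y * Y (y + P)).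
  rewrite -[X in ri X _ _](add0r P) ri_comp_shift//; last exact: ltW.
  by apply: ri_ext => y _; rewrite /g3 addrK.
rewrite -riD; [|by cts..].
rewrite -riD; [|by cts..].
by apply: ri_ext => y y0P; rewrite /g2 -Yc//; ring.
Qed.

Notation MR R := (measurableTypeR R).

Lemma continuous_measurable (R : realType) (f : R -> R) : continuous f ->
  measurable_fun [set: MR R] f.
Proof. exact: continuous_measurable_fun. Qed.

Lemma measurable_comp_fst (R : realType) (f : R -> R) : continuous f ->
  measurable_fun [set: MR R * MR R] (fun z => f z.1).
Proof.
move=> cf; apply: (measurableT_comp (continuous_measurable cf)).
exact: measurable_fst.
Qed.

Lemma measurable_comp_snd (R : realType) (f : R -> R) : continuous f ->
  measurable_fun [set: MR R * MR R] (fun z => f z.2).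
Proof.
move=> cf; apply: (measurableT_comp (continuous_measurable cf)).
exact: measurable_snd.
Qed.

Lemma measurable_rect (R : realType) (a b c d : R) :
  measurable (`[a, b]%classic `*` `[c, d]%classic : set (MR R * MR R)).
Proof. by apply: measurableX. Qed.

Lemma leb2_rect_lty (R : realType) (a b c d : R) :
  (leb2 R (`[a, b]%classic `*` `[c, d]%classic) < +oo)%E.
Proof.
rewrite (_ : leb2 R _ = (@lebesgue_measure R `[a, b]%classic * @lebesgue_measure R `[c, d]%classic)%E); last exact: product_measure1E.
rewrite !lebesgue_measure_itv/=.
by case: ifP => _; case: ifP => _; rewrite ?mul0e ?mule0 -?EFinB -?EFinM ltry.
Qed.

Lemma rect_integrable (R : realType) (F : R * R -> R) (a b c d M : R) :
  measurable_fun [set: MR R * MR R] F ->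
  (forall x y, ~ (a <= x <= b /\ c <= y <= d) -> F (x, y) = 0) ->
  (forall z, `|F z| <= M) ->
  (leb2 R).-integrable [set: MR R * MR R] (EFin \o F).
Proof.
move=> mF F0 FM.
pose K : set (MR R * MR R) := `[a, b]%classic `*` `[c, d]%classic.
have mK : measurable K by exact: measurable_rect.
have -> : EFin \o F = (EFin \o F) \_ K.
  apply/funext => -[x y]; rewrite patchE; case: ifPn => //; rewrite notin_setE => nK.
  by rewrite /= F0// => -[h1 h2]; apply: nK; split; rewrite /= in_itv.
apply/integrable_restrict => //; rewrite setTI.
apply: measurable_bounded_integrable => //.
- exact: leb2_rect_lty.
- exact: measurable_funTS.
- by exists M; split; [exact: num_real|move=> r Mr z _; exact: le_trans (FM z) (ltW Mr)].
Qed.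

Lemma measurable_strip (R : realType) : measurable (strip R : set (MR R * MR R)).
Proof.
have -> : strip R = (`]-1, 1[%classic `*` setT : set (MR R * MR R)).
  by apply/seteqP; split => z /=; rewrite /strip/= in_itv/=; [split|case].
exact: measurableX.
Qed.

Lemma measurable_Omega' (R : realType) : measurable (Omega' R : set (MR R * MR R)).
Proof.
have -> : Omega' R = (`]-1, 1[%classic `*` `]0, 2 * pi[%classic : set (MR R * MR R)).
  by apply/seteqP; split => z /=; rewrite /Omega'/= !in_itv.
exact: measurableX.
Qed.

(** Fubini, followed by folding the [phi] line onto one period, where only continuous functions
    remain. *)
Lemma strip_integral (R : realType) (v V : R * R -> R) (X Y c : R -> R) (a b r s : R) :
  continuous V -> (forall z, clOmega' R z -> V z = v z) ->
  measurable_fun (strip R : set (MR R * MR R)) (periodize v) ->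
  continuous X -> (forall x, ~ (a <= x <= b) -> X x = 0) ->
  continuous Y -> continuous c ->
  (forall y, y <= - (2 * pi) \/ 4 * pi <= y -> Y y = 0) ->
  (forall y, 0 <= y <= 2 * pi -> Y (y - 2 * pi) + Y y + Y (y + 2 * pi) = c y) ->
  (\int[leb2 R]_(z in strip R) (periodize v z * (X z.1 * Y z.2))%:E =
   (ri (- 1) 1 (fun x => X x * ri 0 (2 * pi) (fun y => V (x, y) * c y)))%:E)%E.
Proof.
move=> cV Vv mv cX X0 cY cc Y0 Yc.
have p0 := twopi_gt0 R.
have [BV BV0 VB] := continuous_bounded2 (- 1) 1 0 (2 * pi) cV.
have [BX BX0 XB] : exists2 B : R, 0 <= B & forall x, `|X x| <= B.
  have [ab|ba] := leP a b.
    have [B B0 H] := continuous_bounded ab cX; exists B => // x.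
    have [xab|xab] := boolP (a <= x <= b); first exact: H.
    by rewrite X0 ?normr0//; exact/negP.
  by exists 0 => // x; rewrite X0 ?normr0//; lra.
have [BY BY0 YB] : exists2 B : R, 0 <= B & forall x, `|Y x| <= B.
  have ab : - (2 * pi) <= 4 * pi :> R by have := pi_gt0 R; lra.
  have [B B0 H] := continuous_bounded ab cY; exists B => // x.
  have [x1|x1] := leP x (- (2 * pi)); first by rewrite Y0 ?normr0//; left.
  have [x2|x2] := leP (4 * pi) x; first by rewrite Y0 ?normr0//; right.
  by apply: H; rewrite !ltW.
pose F := (fun z => periodize v z * (X z.1 * Y z.2)) \_ (strip R).
have floorP (y : R) : 0 <= y - 2 * pi * (Num.floor (y / (2 * pi)))%:~R < 2 * pi.
  have /andP[h1 h2] := Num.Theory.floor_itv (y / (2 * pi)).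
  rewrite ler_pdivlMr// in h1; rewrite ltr_pdivrMr// intrD in h2.
  by apply/andP; split; lra.
have pV z : strip R z -> periodize v z = V (z.1, z.2 - 2 * pi * (Num.floor (z.2 / (2 * pi)))%:~R).
  move=> /andP[z1 z2]; rewrite /periodize Vv//; split => /=; first by rewrite !ltW.
  by have /andP[-> /ltW ->] := floorP z.2.
have mS := @measurable_strip R.
have mF : measurable_fun [set: MR R * MR R] F.
  apply/(measurable_restrictT _ mS); apply: measurable_funM => //.
  apply: measurable_funTS; apply: measurable_funM.
    exact: measurable_comp_fst.
  exact: measurable_comp_snd.
have FB z : `|F z| <= BV * (BX * BY).
  rewrite /F patchE; case: ifPn => zS; last by rewrite normr0 !mulr_ge0.
  rewrite inE in zS; rewrite pV// !normrM ler_pM ?mulr_ge0//; last by rewrite ler_pM.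
  case/andP: zS => z1 z2; apply: VB; first by rewrite !ltW.
  by have /andP[-> /ltW ->] := floorP z.2.
have iF : (leb2 R).-integrable [set: MR R * MR R] (EFin \o F).
  apply: (@rect_integrable _ _ a b (- (2 * pi)) (4 * pi) (BV * (BX * BY))) => //.
  move=> x y nxy; rewrite /F patchE; case: ifPn => // _ /=.
  have [xab|/negP xab] := boolP (a <= x <= b); last by rewrite X0// mul0r mulr0.
  rewrite (Y0 y) ?mulr0//.
  have [x1|x1] := leP y (- (2 * pi)); first by left.
  have [x2|x2] := leP (4 * pi) y; first by right.
  by exfalso; apply: nxy; split=> //; rewrite !ltW.
transitivity (\int[leb2 R]_z (EFin \o F) z)%E.
  rewrite integral_mkcond; apply: eq_integral => z _.
  by rewrite /F /= !patchE; case: ifP.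
rewrite -[LHS](integral12_prod_meas1 iF) /fubini_F.
rewrite (_ : (fun x => _) = (fun x => ((X x * ri 0 (2 * pi) (fun y => V (x, y) * c y))%:E)) \_ (`]-1, 1[%classic : set R)); last first.
  apply/funext => x; rewrite patchE mem_setE/=; case: ifPn => x1; last first.
    rewrite integral0_eq// => y _; rewrite /F/= patchE ifN// notin_setE => /= xS.
    by move/negP: x1; apply; rewrite in_itv.
  have xS y : strip R (x, y) by move: x1; rewrite in_itv.
  transitivity (\int[@lebesgue_measure R]_y ((X x)%:E *
      (V (x, y - 2 * pi * (Num.floor (y / (2 * pi)))%:~R) * Y y)%:E))%E.
    apply: eq_integral => y _; rewrite /F /= patchE ifT ?inE// pV//= -EFinM.
    by congr EFin; ring.
  have cVx : continuous (fun y => V (x, y)) by exact: continuous_row.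
  have [iE E] := integral_periodized cVx cY Y0 Yc.
  by rewrite integralZl// E.
rewrite -integral_mkcond ri_EFin_oo//.
apply: ct_mul => //.
by apply: (@continuous_ri _ _ _ (fun z => V z * c z.2)); cts.
Qed.

(** * Test functions of product form *)

Definition tensor (R : realType) (X Y : nat -> R -> R) (a b : nat) (z : R * R) : R :=
  X a z.1 * Y b z.2.

Lemma ord2P (i : 'I_2) : i = d_rho \/ i = d_phi.
Proof. by case: i => [[|[|//]] h]; [left|right]; apply/val_inj. Qed.

Lemma is_derive_tensor (R : realType) (X Y : nat -> R -> R) a b (i : 'I_2) (z : R * R) :
  smooth_seq X -> smooth_seq Y ->
  is_derive (crd i z) 1 (fun t => tensor X Y a b (set_crd i z t))
    (tensor X Y (a + (i == d_rho)) (b + (i == d_phi)) z).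
Proof.
move=> sX sY; case: (ord2P i) => ->; rewrite /tensor /crd /set_crd/= ?addn0 ?addn1.
  have := is_deriveZ (Y b z.2) (sX a z.1); rewrite /GRing.scale/= mulrC.
  by apply: is_derive_ext => t; rewrite /= mulrC.
by have := is_deriveZ (X a z.1) (sY b z.2); apply: is_derive_ext.
Qed.

Lemma pds_tensor (R : realType) (X Y : nat -> R -> R) (s : seq 'I_2) :
  smooth_seq X -> smooth_seq Y ->
  pds s (tensor X Y 0 0) = tensor X Y (count_mem d_rho s) (count_mem d_phi s).
Proof.
move=> sX sY; elim: s => [//|i s IH] /=; rewrite IH; apply/funext => z.
rewrite {1}/pd derive1E; case: (is_derive_tensor (count_mem d_rho s) (count_mem d_phi s) i z sX sY) => _ ->.
by rewrite addnC [in RHS]addnC; congr tensor; rewrite addnC.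
Qed.

Lemma continuous_tensor (R : realType) (X Y : nat -> R -> R) a b :
  smooth_seq X -> smooth_seq Y -> continuous (tensor X Y a b).
Proof.
move=> sX sY; have cX := smooth_seq_continuous (n := a) sX.
by have cY := smooth_seq_continuous (n := b) sY; rewrite /tensor; cts.
Qed.

Lemma tensor_test_fun (R : realType) (X Y : nat -> R -> R) (a b c d : R) :
  smooth_seq X -> smooth_seq Y -> - 1 < a -> b < 1 ->
  (forall x, ~ (a <= x <= b) -> X 0%N x = 0) ->
  (forall y, ~ (c <= y <= d) -> Y 0%N y = 0) ->
  test_fun (strip R) (tensor X Y 0 0).
Proof.
move=> sX sY a1 b1 X0 Y0; split.
  move=> s; rewrite pds_tensor//; split; first exact: continuous_tensor.
  move=> i z; have := is_derive_tensor (count_mem d_rho s) (count_mem d_phi s) i z sX sY.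
  by case.
exists (`[a, b]%classic `*` `[c, d]%classic); split.
- by apply: compact_setX; exact: segment_compact.
- by move=> z [/=]; rewrite in_itv/= => /andP[h1 h2] _; rewrite /strip/=; lra.
- move=> [x y] nxy; rewrite /tensor/=.
  have [xab|/negP xab] := boolP (a <= x <= b); last by rewrite X0// mul0r.
  by rewrite Y0 ?mulr0// => yab; apply: nxy; split; rewrite /= in_itv.
Qed.

Definition cos_seq (R : realType) (k : nat) (b : R) (n : nat) (y : R) : R :=
  k%:R ^+ n * cos (k%:R * y + (b + n%:R * (pi / 2))).

Lemma smooth_cos_seq (R : realType) (k : nat) (b : R) : smooth_seq (cos_seq k b).
Proof.
move=> n y; rewrite /cos_seq.
have D := is_deriveZ (k%:R ^+ n) (is_derive_affine (is_derive_cos (k%:R * y + (b + n%:R * (pi / 2))))).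
apply: (is_derive_eq D); rewrite /GRing.scale/= [LHS]mulrA -exprSr; congr (_ * _).
by rewrite -cosDpihalf -(@natr1 _ n); congr cos; lra.
Qed.

Lemma cos_seqB2pi (R : realType) (k : nat) (b : R) (n : nat) (y : R) :
  cos_seq k b n (y - 2 * pi) = cos_seq k b n y.
Proof.
rewrite /cos_seq; congr (_ * _); rewrite -[LHS](cos_natD2pi k); congr cos; ring.
Qed.

(** A harmonic is not compactly supported. [Y] is a compactly supported replacement with the right
    sum over periods; it is bounded by 1 and exceeds one period by [e] only on either side, so that
    nothing is lost as [e] tends to 0. *)
Lemma exists_periodic_cutoff (R : realType) (H : nat -> R -> R) (k : nat) (b e : R) :
  smooth_step H -> 0 < e -> e <= 1 ->
  exists Y : nat -> R -> R,
  [/\ smooth_seq Y,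
      forall n y, y <= - e \/ 2 * pi + e <= y -> Y n y = 0,
      forall y, `|Y 0%N y| <= 1
    & forall n y, 0 <= y <= 2 * pi ->
        Y n (y - 2 * pi) + Y n y + Y n (y + 2 * pi) = cos_seq k b n y].
Proof.
move=> sH e0 e1; have [sH' Hl Hr Hr1 H1] := sH.
have pi1 : 1 <= pi :> R by have := pi_ge2 R; lra.
(* [U] steps from 1 down to 0 around 0, so that the differences of translates of
   [U c] by periods of [c] telescope to [c]. *)
pose U n y := (- e^-1) ^+ n * H n (- e^-1 * y + 0).
have sU : smooth_seq U by exact: smooth_seq_affine.
have cU : smooth_seq (cos_seq k b) by exact: smooth_cos_seq.
pose Z := smooth_mul U (cos_seq k b).
have sZ : smooth_seq Z by exact: smooth_seq_mul.
have Zr n y : e <= y -> Z n y = 0.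
  move=> ey; apply: smooth_mul_zero => {}n; rewrite /U Hl ?mulr0// addr0 mulNr lerN2.
  by rewrite ler_pdivlMl// mulr1.
have Zl n y : y <= - e -> Z n y = cos_seq k b n y.
  move=> ye; have h : 1 <= - e^-1 * y + 0.
    by rewrite addr0 mulNr -mulrN ler_pdivlMl//; lra.
  apply: smooth_mul_one; first by rewrite /U expr0 mul1r Hr.
  by move=> {}n; rewrite /U Hr1 ?mulr0.
pose Y n y := Z n (y - 2 * pi) - Z n y.
have sY : smooth_seq Y.
  move=> n y; have := is_derive_affine (a := 1) (b := - (2 * pi)) (x := y) (sZ n _).
  rewrite mul1r => D; have := is_deriveB D (sZ n y); rewrite mul1r.
  apply: is_derive_ext => t.
  by have -> : Y n t = Z n (1 * t - 2 * pi) - Z n t by rewrite mul1r.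
exists Y; split => //.
- move=> n y [ye|ye]; rewrite /Y; last by rewrite !Zr ?subrr//; lra.
  by rewrite !Zl ?cos_seqB2pi ?subrr//; lra.
- move=> y; rewrite /Y /Z !smooth_mul0 cos_seqB2pi -mulrBl normrM -[leRHS]mulr1.
  rewrite ler_pM ?normr_ge0//.
    rewrite /U !expr0 !mul1r.
    have /andP[h1 h2] := smooth_step_itv (- e^-1 * (y - 2 * pi) + 0) sH.
    have /andP[h3 h4] := smooth_step_itv (- e^-1 * y + 0) sH.
    by rewrite ler_norml; apply/andP; split; lra.
  by rewrite /cos_seq expr0 mul1r cos_max.
- move=> n y /andP[y0 y2]; rewrite /Y addrK.
  rewrite (Zl n (y - 2 * pi - 2 * pi)); last by lra.
  rewrite (Zr n (y + 2 * pi)); last by lra.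
  rewrite !cos_seqB2pi; ring.
Qed.

Lemma leb2_vertical (R : realType) (a b y : R) :
  (leb2 R (`[a, b]%classic `*` [set y]) = 0)%E.
Proof.
rewrite (_ : leb2 R _ = (@lebesgue_measure R `[a, b]%classic * @lebesgue_measure R [set y])%E); last exact: product_measure1E.
by rewrite lebesgue_measure_set1 mule0.
Qed.

(** The weak derivative is tested with a smoothed indicator in [rho] times a cut-off harmonic in
    [phi]. The [m] derivatives in [phi] produce [k ^+ m]; the test function is at most 1 in absolute
    value, so the other side is at most the integral of [|G|] over its support, and [e] is sent to
    0. *)
Lemma weak_der_bound (R : realType) (H : nat -> R -> R) (v V G : R * R -> R) (m i k : nat)
    (al d z x : R) :
  smooth_step H -> continuous V -> (forall w, clOmega' R w -> V w = v w) ->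
  weak_der (strip R) (nseq m d_phi ++ nseq i d_rho) (periodize v) G ->
  0 < d -> - 1 < z - d -> z <= x -> x + d < 1 ->
  (`| k%:R ^+ m * ri (- 1) 1 (fun t => fcoef (fun y => V (t, y)) k al * step_seq H d z x i t)|%:E
     <= \int[leb2 R]_(w in Omega' R) (`|G w|%:E))%E.
Proof.
move=> sH cV Vv [[mv _ _] [mG _ lG] wG] d0 z1 zx x1.
have sH' : smooth_seq H by case: sH.
set A := _ * ri _ _ _.
pose X := step_seq H d z x.
have sX : smooth_seq X by exact: smooth_step_seq.
have cX n : continuous (X n) by exact: smooth_seq_continuous.
have X0 n t : ~ (z - d <= t <= x + d) -> X n t = 0.
  move=> nt; apply: step_seq_support => //.
  have [t1|t1] := leP t (z - d); first by left.
  have [t2|t2] := leP (x + d) t; first by right.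
  by exfalso; apply: nt; rewrite !ltW.
have X1 t : `|X 0%N t| <= 1.
  by have /andP[h1 h2] := step_seq0_itv t sH d0 zx; rewrite ger0_norm.
have pi2 := pi_ge2 R.
(* With this phase the [m]-th derivative of the harmonic has phase [al]. *)
pose be := al - m%:R * (pi / 2).
have mS := @measurable_strip R.
pose K (e : R) : set (MR R * MR R) := `[z - d, x + d]%classic `*` `[- e, 2 * pi + e]%classic.
have mK e : measurable (K e) by exact: measurable_rect.
have KS e : K e `<=` strip R.
  by move=> w [/=]; rewrite in_itv/= => /andP[h1 h2] _; rewrite /strip/=; lra.
have cK e : compact (K e) by apply: compact_setX; exact: segment_compact.
have mnG : measurable_fun (strip R : set (MR R * MR R)) (fun w => `|G w|%:E).
  by apply/measurable_EFinP; exact: measurableT_comp.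
have step (e : R) : 0 < e -> e <= 1 -> (`|A|%:E <= \int[leb2 R]_(w in K e) `|G w|%:E)%E.
  move=> e0 e1.
  have [Y [sY Y0 Y1 Yc]] := exists_periodic_cutoff k be sH e0 e1.
  have cY n : continuous (Y n) by exact: smooth_seq_continuous.
  have Y0' y : ~ (- e <= y <= 2 * pi + e) -> Y 0%N y = 0.
    move=> ny; apply: Y0.
    have [t1|t1] := leP y (- e); first by left.
    have [t2|t2] := leP (2 * pi + e) y; first by right.
    by exfalso; apply: ny; rewrite !ltW.
  have tf := tensor_test_fun sX sY z1 x1 (X0 0%N) Y0'.
  have := wG _ tf.
  rewrite pds_tensor// !count_cat !count_nseq/= !mul0n !mul1n addn0 add0n.
  rewrite (@strip_integral _ v V (X i) (Y m) (cos_seq k be m) (z - d) (x + d))//; first last.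
  - by move=> y; exact: Yc.
  - by move=> y [yl|yr]; apply: Y0; [left|right]; lra.
  - exact: smooth_seq_continuous (@smooth_cos_seq _ _ _).
  - exact: X0.
  have -> : ri (- 1) 1 (fun t => X i t * ri 0 (2 * pi) (fun y => V (t, y) * cos_seq k be m y)) = A.
    rewrite /A -riZ; last first.
      apply: ct_mul => //; rewrite /fcoef.
      by apply: (@continuous_ri _ _ _ (fun w => V w * cos (k%:R * w.2 + al))); cts.
    apply: ri_ext => t _.
    have cVt : continuous (fun y => V (t, y)) by exact: continuous_row.
    have -> : ri 0 (2 * pi) (fun y => V (t, y) * cos_seq k be m y) =
        k%:R ^+ m * fcoef (fun y => V (t, y)) k al.
      rewrite /fcoef -riZ; [|by cts].
      apply: ri_ext => y _; rewrite /cos_seq.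
      by rewrite (_ : be + _ = al) /be ?subrK//; ring.
    by rewrite mulrC mulrA.
  move=> AE; rewrite -abse_EFin AE.
  have mGt : measurable_fun (strip R : set (MR R * MR R)) (fun w =>
      ((-1) ^+ size (nseq m (ord_max : 'I_2) ++ nseq i ord0) * (G w * tensor X Y 0 0 w))%:E).
    apply/measurable_EFinP; apply: measurable_funM; first exact: measurable_cst.
    apply: measurable_funM => //; apply: measurable_funTS; apply: measurable_funM.
      exact: measurable_comp_fst.
    exact: measurable_comp_snd.
  apply: (le_trans (le_abse_integral _ mS mGt)).
  rewrite -(setIidr (@KS e)) integral_mkcondr.
  apply: ge0_le_integral => //.
  - exact: measurableT_comp.
  - apply/(measurable_restrict _ (mK e) mS).
    by apply: measurable_funS mnG => //; exact: subIsetl.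
  - move=> [s t] wS; rewrite patchE abse_EFin !normrM normrX normrN1 expr1n mul1r.
    case: ifPn => [_|].
      by rewrite lee_fin -[leRHS]mulr1 ler_pM// -[leRHS]mulr1 ler_pM.
    rewrite notin_setE (_ : (point : \bar R) = 0%:E)// lee_fin => nK.
    have [sab|/negP sab] := boolP (z - d <= s <= x + d); last by rewrite X0// normr0 mul0r mulr0.
    rewrite (Y0' t) ?normr0 ?mulr0// => tab; apply: nK; split; rewrite /= in_itv//.
(* The supports for [e = 1 / (n + 1)] decrease to [K 0], which lies in the closed rectangle;
   dominated convergence is applied on the largest of them. *)
pose D := K 1.
have mD : measurable D by exact: mK.
have iG : (leb2 R).-integrable D (fun w => `|G w|%:E).
  apply/integrableP; split.
    by apply: measurable_funS mnG => //; exact: KS.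
  by under eq_integral do rewrite abse_EFin normr_id; apply: lG; [exact: KS|exact: cK].
pose h w : \bar R := `|G w|%:E.
have ih0 e : 0 <= e -> e <= 1 -> (\int[leb2 R]_(w in D) (h \_ (K e)) w = \int[leb2 R]_(w in K e) h w)%E.
  move=> e0 e1; rewrite -integral_mkcondr; congr (integral _ _ _); apply/setIidr.
  move=> w [h1 h2]; split => //; move: h2; rewrite /= !in_itv/= => /andP[h3 h4].
  by apply/andP; split; lra.
pose Kn (n : nat) := K (n.+1%:R^-1).
pose K0 := K 0.
have ptw (s t : R) : D (s, t) -> (h \_ (Kn n)) (s, t) @[n --> \oo] --> (h \_ K0) (s, t).
  move=> [sD tD].
  have [t02|t02] := boolP (0 <= t <= 2 * pi).
    apply: cvg_near_cst; apply: nearW => n; rewrite !patchE !ifT// inE; split => //=.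
      by move: t02; rewrite in_itv/= oppr0 addr0.
    move: t02; rewrite in_itv/= => /andP[t0 t2].
    have : 0 <= n.+1%:R^-1 :> R by rewrite invr_ge0.
    move: (n.+1%:R^-1) => u u0.
    by apply/andP; split; lra.
  have nK0 : ~ K0 (s, t).
    by move=> [_]; rewrite /= in_itv/= oppr0 addr0; exact/negP.
  rewrite {2}/patch ifN; last by rewrite notin_setE.
  apply: cvg_near_cst.
  have [r r0 Hr] : exists2 r : R, 0 < r & t < - r \/ 2 * pi + r < t.
    move: t02; rewrite negb_and -!ltNge => /orP[t0|t2].
      by exists (- t / 2); [lra|left; lra].
    by exists ((t - 2 * pi) / 2); [lra|right; lra].
  have : \forall n \near \oo, n.+1%:R^-1 < r :> R.
    exact: near_infty_natSinv_lt (PosNum r0).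
  apply: filterS => n nr; rewrite patchE ifN// notin_setE => -[_]; rewrite /= in_itv/=.
  by move: (n.+1%:R^-1) nr => u nr; case: Hr => Hr /andP[h1 h2]; lra.
have lim : (\int[leb2 R]_(w in D) (h \_ (Kn n)) w @[n --> \oo] -->
    \int[leb2 R]_(w in D) (h \_ K0) w)%E.
  apply: (@dominated_cvg _ _ _ (leb2 R) D mD (fun n => h \_ (Kn n)) (h \_ K0) h) => //.
  - move=> n; apply/(measurable_restrict _ (mK _) mD).
    by apply: measurable_funS mnG => //; apply: subset_trans (@KS 1); exact: subIsetl.
  - by move=> [s t]; exact: ptw.
  - move=> n w wD; rewrite patchE; case: ifPn => _.
      by rewrite /h abse_EFin normr_id.
    change (`|0%:E| <= h w)%E.
    by rewrite abse_EFin normr0 lee_fin.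
have le1 : (`|A|%:E <= \int[leb2 R]_(w in D) (h \_ K0) w)%E.
  rewrite -(cvg_lim _ lim)//; apply: lime_ge; first by apply/cvg_ex; eexists; exact: lim.
  apply: nearW => n; rewrite /Kn ih0//; first by apply: step; rewrite ?invr_gt0// invf_le1// ler1n.
  by rewrite invf_le1// ler1n.
apply: (le_trans le1); rewrite /K0 ih0//.
(* Only the edges [phi = 0] and [phi = 2 pi] keep [K 0] from lying in the open rectangle, and they
   are null sets. *)
pose N : set (MR R * MR R) := (`[z - d, x + d]%classic `*` [set 0%R]) `|` (`[z - d, x + d]%classic `*` [set (2 * pi)%R]).
have mN1 y : measurable (`[z - d, x + d]%classic `*` [set y] : set (MR R * MR R)).
  exact: measurableX.
have mN : measurable N by exact: measurableU.
have N0 : leb2 R N = 0%E.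
  apply/eqP; rewrite -measure_le0; apply: (le_trans (measureU2 _ (mN1 _) (mN1 _))).
  by rewrite -[leRHS]adde0; apply: leeD; rewrite -[leLHS]/(leb2 R _) leb2_vertical.
have iK0 : (leb2 R).-integrable (K 0) h.
  apply: integrableS iG => //.
  move=> w [h1 h2]; split => //; move: h2; rewrite /= !in_itv/= => /andP[h3 h4].
  by apply/andP; split; lra.
rewrite (negligible_integral mN _ iK0 N0)//.
apply: ge0_subset_integral => //.
- exact: measurableD.
- exact: measurable_Omega'.
- apply: measurable_funS mnG => // w [/andP[h1 h2] _]; rewrite /strip/=; lra.
- by move=> w _; rewrite /h lee_fin.
- suff sub (s t : R) : (K 0 `\` N) (s, t) -> Omega' R (s, t) by move=> [s t]; exact: sub.
  move=> [[/= h1 h2] nN]; move: h1 h2; rewrite !in_itv/= oppr0 addr0.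
  move=> /andP[s1 s2] /andP[t1 t2]; split => /=; first lra.
  have t0 : t != 0 by apply/eqP => t0; apply: nN; left; split => //=; rewrite in_itv/= s1.
  have t3 : t != 2 * pi by apply/eqP => t3; apply: nN; right; split => //=; rewrite in_itv/= s1.
  by rewrite !lt_neqAle t1 t2 eq_sym t0 t3.
Qed.

Lemma cheb_weight_ge1 (R : realType) (r : R) : -1 < r < 1 -> 1 <= cheb_weight r.
Proof.
move=> r1; rewrite /cheb_weight powRN -[leLHS]invr1 lef_pV2 ?posrE//; last first.
  by apply: powR_gt0; nra.
apply: (@le_trans _ _ (1 `^ 2^-1)); last by rewrite powR1.
by apply: ge0_ler_powR; rewrite ?nnegrE ?invr_ge0//; nra.
Qed.

(** Since the weight [w] is at least 1, [g <= 1 + g ^+ 2 * w] bounds every unweighted integral by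
    the measure of the rectangle plus the finite Sobolev sum. *)
Lemma in_Hl_integral_bound (R : realType) (l : nat) (Gd : nat -> nat -> R * R -> R) :
  (forall k j, (k <= l)%N -> (j <= l)%N ->
     measurable_fun (strip R : set (MR R * MR R)) (Gd k j)) ->
  (\sum_(0 <= k < l.+1) \sum_(0 <= j < l.+1)
       \int[leb2 R]_(z in Omega' R)
         ((`|Gd k j z| ^+ 2 * cheb_weight z.1)%:E) < +oo)%E ->
  exists2 C : R, 0 <= C & forall k j, (k <= l)%N -> (j <= l)%N ->
    (\int[leb2 R]_(z in Omega' R) (`|Gd k j z|%:E) <= C%:E)%E.
Proof.
move=> mG Goo.
set S := (\sum_(0 <= k < l.+1) _)%E in Goo.
have t0 k j : (0 <= \int[leb2 R]_(z in Omega' R) ((`|Gd k j z| ^+ 2 * cheb_weight z.1)%:E))%E.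
  by apply: integral_ge0 => z _; rewrite lee_fin mulr_ge0 ?powR_ge0 ?exprn_ge0.
have S0 : (0 <= S)%E by apply: sume_ge0 => k _; apply: sume_ge0 => j _; exact: t0.
have tS k j : (k <= l)%N -> (j <= l)%N ->
    (\int[leb2 R]_(z in Omega' R) ((`|Gd k j z| ^+ 2 * cheb_weight z.1)%:E) <= S)%E.
  move=> kl jl; rewrite /S (bigD1_seq k) ?iota_uniq ?mem_index_iota//=.
  rewrite -[leLHS]adde0; apply: leeD; last first.
    by apply: sume_ge0 => i _; apply: sume_ge0 => i' _; exact: t0.
  rewrite (bigD1_seq j) ?iota_uniq ?mem_index_iota//=.
  rewrite -[leLHS]adde0; apply: leeD => //.
  by apply: sume_ge0 => i _; exact: t0.
have mO := @measurable_Omega' R.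
have OS : Omega' R `<=` strip R by move=> z [].
have Ofin : (leb2 R (Omega' R) < +oo)%E.
  apply: le_lt_trans (@leb2_rect_lty R (- 1) 1 0 (2 * pi)); apply: le_measure; rewrite ?inE//.
    exact: measurable_rect.
  by move=> z [/andP[a b] /andP[c d]]; split; rewrite /= in_itv/=; rewrite !ltW.
have mw : measurable_fun (Omega' R : set (MR R * MR R)) (fun z => cheb_weight z.1).
  have m1 : measurable_fun [set: MR R] (fun r : R => 1 - r ^+ 2).
    by apply: continuous_measurable; cts.
  have mp : measurable_fun [set: MR R * MR R] (fun z => cheb_weight z.1).
    apply: (measurableT_comp _ (@measurable_fst _ _ (MR R) (MR R))).
    exact: (measurableT_comp (measurable_powR _) m1).
  exact: measurable_funTS.
exists (fine (leb2 R (Omega' R)) + fine S).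
  by rewrite addr_ge0// fine_ge0.
move=> k j kl jl.
have mGO : measurable_fun (Omega' R : set (MR R * MR R)) (Gd k j).
  by apply: measurable_funS (mG k j kl jl) => //; exact: measurable_strip.
have mnG : measurable_fun (Omega' R : set (MR R * MR R)) (fun z => `|Gd k j z|).
  exact: measurableT_comp.
have mq : measurable_fun (Omega' R : set (MR R * MR R))
    (fun z => ((`|Gd k j z| ^+ 2 * cheb_weight z.1)%:E)).
  by apply/measurable_EFinP; apply: measurable_funM => //; exact: measurable_funX.
apply: (@le_trans _ _ (\int[leb2 R]_(z in Omega' R) (1 + (`|Gd k j z| ^+ 2 * cheb_weight z.1)%:E))%E).
  apply: ge0_le_integral => //.
  - by apply/measurable_EFinP.
  - by apply: emeasurable_funD => //; exact: measurable_cst.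
  - move=> z [z1 _]; rewrite -EFinD lee_fin.
    have w1 := cheb_weight_ge1 z1; have := normr_ge0 (Gd k j z).
    move: (cheb_weight z.1) (`|Gd k j z|) w1 => w g w1 g0.
    have : g ^+ 2 <= g ^+ 2 * w by rewrite ler_peMr// exprn_ge0.
    by have := sqr_ge0 (g - 1); nra.
rewrite ge0_integralD//; last first.
  by move=> z _; rewrite lee_fin mulr_ge0 ?powR_ge0 ?exprn_ge0.
rewrite integral_cst// mul1e EFinD; apply: leeD.
  by rewrite fineK// ge0_fin_numE.
by rewrite fineK ?ge0_fin_numE//; exact: tS.
Qed.

(** The regularity is mixed: all [l] derivatives in [phi] are spent on decay in [k], while the [i]
    derivatives in [rho] stay on the step. Frequency 0 is bounded with no derivative in [phi],
    whence [maxn k 1]. *)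
Lemma in_Hl_weak_bound (R : realType) (H : nat -> R -> R) (l : nat) (v V : R * R -> R) :
  smooth_step H -> in_Hl l v -> continuous V -> (forall w, clOmega' R w -> V w = v w) ->
  exists2 C : R, 0 <= C & forall k al i, (i <= l)%N ->
    weak_bound H (fun t => fcoef (fun y => V (t, y)) k al) i (C / (maxn k 1)%:R ^+ l).
Proof.
move=> sH [Gd [wG Goo]] cV Vv.
have [C C0 CG] : exists2 C : R, 0 <= C & forall k j, (k <= l)%N -> (j <= l)%N ->
    (\int[leb2 R]_(z in Omega' R) (`|Gd k j z|%:E) <= C%:E)%E.
  apply: in_Hl_integral_bound Goo => k j kl jl.
  by have [_ [mG _ _] _] := wG k j kl jl.
exists C => // k al i il d z x d0 z1 zx x1.
have B m : (m <= l)%N -> `|k%:R ^+ m * ri (- 1) 1 (fun t => fcoef (fun y => V (t, y)) k al * step_seq H d z x i t)| <= C.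
  move=> ml; rewrite -lee_fin; apply: le_trans (CG m i ml il).
  exact: (weak_der_bound _ _ sH cV Vv (wG m i ml il)).
case: k B => [|k] B.
  by rewrite expr1n divr1; have := B 0%N isT; rewrite expr0 mul1r.
rewrite ler_pdivlMr ?exprn_gt0// mulrC.
by have := B l (leqnn _); rewrite normrM ger0_norm.
Qed.

(** * Chebyshev truncation *)

(** Telescoping: [1 / k^2 <= 2 / k - 2 / (k + 1)] because [k + 1 <= 2 k]. *)
Lemma sum_inv_sqr (R : realType) (n m : nat) : (0 < n)%N ->
  \sum_(n <= k < m) (k%:R ^+ 2)^-1 <= 2 / n%:R :> R.
Proof.
move=> n0; have [nm|mn] := leqP n m; last first.
  by rewrite big_geq ?divr_ge0// ltnW.
suff : \sum_(n <= k < m) (k%:R ^+ 2)^-1 <= 2 / n%:R - 2 / m%:R :> R.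
  by move/le_trans; apply; rewrite gerBl divr_ge0.
have E : \sum_(n <= k < m) (2 / k%:R - 2 / k.+1%:R) = 2 / n%:R - 2 / m%:R :> R.
  have -> : 2 / n%:R - 2 / m%:R = (- (2 / m%:R)) - (- (2 / n%:R)) :> R by ring.
  rewrite -(telescope_sumr (fun k => - (2 / k%:R)))//.
  by apply: eq_bigr => k _; rewrite opprK addrC.
rewrite -E big_seq_cond [leRHS]big_seq_cond; apply: ler_sum => k.
rewrite mem_index_iota andbT => /andP[nk _].
have k1 : 1 <= k%:R :> R by rewrite ler1n (leq_trans n0).
rewrite -(@natr1 _ k); move: (k%:R : R) k1 => x x1.
have -> : 2 / x - 2 / (x + 1) = 2 / (x * (x + 1)) by field; rewrite !gt_eqF//; lra.
rewrite -[leLHS]div1r ler_pdivrMr ?exprn_gt0 1?(lt_le_trans ltr01)//.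
by rewrite mulrAC ler_pdivlMr; nra.
Qed.

Lemma sum_inv_exp (R : realType) (n m s : nat) : (0 < n)%N ->
  \sum_(n <= k < m) (k%:R ^+ s.+2)^-1 <= 2 / n%:R ^+ s.+1 :> R.
Proof.
move=> n0; have n1 : 0 < n%:R :> R by rewrite ltr0n.
apply: (@le_trans _ _ ((n%:R ^+ s)^-1 * \sum_(n <= k < m) (k%:R ^+ 2)^-1)).
  rewrite big_distrr/= big_seq_cond [leRHS]big_seq_cond; apply: ler_sum => k.
  rewrite mem_index_iota andbT => /andP[nk _].
  have k0 : 0 < k%:R :> R by rewrite ltr0n (leq_trans n0).
  rewrite -addn2 exprD invfM ler_pM2r ?invr_gt0 ?exprn_gt0//.
  by rewrite lef_pV2 ?posrE ?exprn_gt0// lerXn2r ?nnegrE ?ler_nat// ltW.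
apply: le_trans (ler_wpM2l _ (sum_inv_sqr R m n0)) _.
  by rewrite invr_ge0 exprn_ge0.
by rewrite exprS invfM mulrCA mulrA [_^-1 * _]mulrC !mulrA.
Qed.

(** * Chebyshev polynomials *)

Fixpoint chebpoly_pair (R : realType) (n : nat) : {poly R} * {poly R} :=
  if n is n'.+1 then ((chebpoly_pair R n').2, 'X *+ 2 * (chebpoly_pair R n').2 - (chebpoly_pair R n').1) else (1, 'X).

Definition chebpoly (R : realType) (n : nat) : {poly R} := (chebpoly_pair R n).1.

Lemma chebpoly0 (R : realType) : chebpoly R 0 = 1. Proof. by []. Qed.

Lemma chebpoly1 (R : realType) : chebpoly R 1 = 'X. Proof. by []. Qed.

Lemma chebpolySS (R : realType) (n : nat) :
  chebpoly R n.+2 = 'X *+ 2 * chebpoly R n.+1 - chebpoly R n.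
Proof. by []. Qed.

Lemma horner_chebpoly_cos (R : realType) (n : nat) (x : R) :
  (chebpoly R n).[cos x] = cos (n%:R * x).
Proof.
suff : (chebpoly R n).[cos x] = cos (n%:R * x) /\
       (chebpoly R n.+1).[cos x] = cos (n.+1%:R * x) by case.
elim: n => [|n [IH1 IH2]]; first by rewrite mul0r cos0 mul1r /chebpoly/= !hornerE.
split=> //; rewrite chebpolySS !hornerE IH1 IH2.
have -> : n.+2%:R * x = n.+1%:R * x + x by rewrite -(@natr1 _ n.+1); ring.
have -> : n%:R * x = n.+1%:R * x - x by rewrite -(@natr1 _ n); ring.
by rewrite cosB cosD; ring.
Qed.

Lemma horner_chebpoly (R : realType) (n : nat) (x : R) : - 1 <= x <= 1 ->
  (chebpoly R n).[x] = cheb n x.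
Proof.
move=> x1; rewrite /cheb -horner_chebpoly_cos acosK//.
Qed.

(** The span absorbs multiplication by ['X] at the cost of one degree, since
    [2 X T_(j+1) = T_(j+2) + T_j]. This brings a primitive of a Chebyshev sum back into the form
    required by [fourier_cheb]. *)
Lemma chebpoly_span (R : realType) (M : nat) (p : {poly R}) : (size p <= M.+1)%N ->
  exists c : nat -> R, p = \sum_(0 <= j < M.+1) c j *: chebpoly R j.
Proof.
pose S m (q : {poly R}) := exists c : nat -> R, q = \sum_(0 <= j < m.+1) c j *: chebpoly R j.
have SD m q r : S m q -> S m r -> S m (q + r).
  move=> [c ->] [d ->]; exists (fun j => c j + d j).
  by rewrite -big_split; apply: eq_bigr => j _; rewrite scalerDl.
have SZ m a q : S m q -> S m (a *: q).
  move=> [c ->]; exists (fun j => a * c j).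
  by rewrite scaler_sumr; apply: eq_bigr => j _; rewrite scalerA.
have ST m j : (j <= m)%N -> S m (chebpoly R j).
  move=> jm; exists (fun i => (i == j)%:R).
  rewrite (bigD1_seq j) ?iota_uniq ?mem_index_iota//= eqxx scale1r big1 ?addr0// => i.
  by move/negbTE => ->; rewrite scale0r.
have SX m j : (j <= m)%N -> S m.+1 (chebpoly R j * 'X).
  case: j => [|j] jm; first by rewrite chebpoly0 mul1r -chebpoly1; exact: ST.
  have -> : chebpoly R j.+1 * 'X = 2^-1 *: (chebpoly R j.+2 + chebpoly R j).
    have E2 (q : {poly R}) : q *+ 2 = (2 : R) *: q by rewrite scaler_nat.
    by rewrite chebpolySS subrK mulrnAl E2 scalerA mulVf ?pnatr_eq0// scale1r mulrC.
  by apply: SZ; apply: SD; apply: ST; rewrite // (leq_trans (leqnSn j))// ltnW.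
rewrite -/(S M p); elim: M p => [|M IH] p.
  by move=> /size1_polyC ->; rewrite -alg_polyC -chebpoly0; apply: SZ; exact: ST.
elim/poly_ind: p => [|q c _] sq.
  by rewrite -(scale0r 1) -chebpoly0; apply: SZ; exact: ST.
apply: (SD M.+1); last by rewrite -alg_polyC -chebpoly0; apply: SZ; exact: ST.
have /IH [d ->] : (size q <= M.+1)%N.
  by move: sq; rewrite size_MXaddC; case: eqP => [->|_]; rewrite ?size_poly0.
rewrite big_distrl big_mkord/=; apply: (big_ind (S M.+1)).
- by rewrite -(scale0r 1) -chebpoly0; apply: SZ; exact: ST.
- by move=> *; exact: SD.
- by move=> j _; rewrite -scalerAl; apply: SZ; apply: SX; rewrite -ltnS.
Qed.

Lemma size_chebpoly (R : realType) (n : nat) : (size (chebpoly R n) <= n.+1)%N.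
Proof.
suff : (size (chebpoly R n) <= n.+1)%N && (size (chebpoly R n.+1) <= n.+2)%N by case/andP.
elim: n => [|n /andP[IH1 IH2]]; first by rewrite /chebpoly/= size_poly1 size_polyX.
rewrite IH2/= chebpolySS (leq_trans (size_polyD _ _))// geq_max size_polyN.
rewrite (leq_trans IH1) ?andbT; last by rewrite ltnW// ltnW.
rewrite mulrnAl -[_ *+ 2](scaler_nat 2) (leq_trans (size_scale_leq _ _))// mulrC.
have [->|q0] := eqVneq (chebpoly R n.+1) 0; first by rewrite mul0r size_poly0.
by rewrite size_mulX.
Qed.

Definition poly_primitive (R : realType) (p : {poly R}) : {poly R} :=
  \poly_(i < (size p).+1) (p`_i.-1 / i%:R).

Lemma deriv_poly_primitive (R : realType) (p : {poly R}) : (poly_primitive p)^`() = p.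
Proof.
apply/polyP => i; rewrite coef_deriv coef_poly ltnS/=.
case: ltnP => [_|ip]; last by rewrite mul0rn nth_default.
by rewrite -[LHS]mulr_natr mulfVK// pnatr_eq0.
Qed.

Lemma size_poly_primitive (R : realType) (p : {poly R}) : (size (poly_primitive p) <= (size p).+1)%N.
Proof. exact: size_poly. Qed.

Lemma fweight_le1 (R : realType) (k : nat) : 0 <= fweight R k <= 1.
Proof.
rewrite /fweight; apply/andP; split; first by rewrite divr_ge0 ?pi_ge0//; case: ifP.
rewrite ler_pdivrMr ?pi_gt0// mul1r; have := pi_ge2 R; case: ifP => _; lra.
Qed.

Lemma normr_fterm_le (R : realType) (f : R -> R) (k : nat) (x C : R) :
  (forall b, `|fcoef f k b| <= C) -> `|fterm f k x| <= C.
Proof.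
move=> fC; rewrite /fterm normrM; have /andP[w0 w1] := fweight_le1 R k.
rewrite (ger0_norm w0); apply: le_trans (fC (- (k%:R * x))).
by rewrite ler_piMl.
Qed.

(** The Chebyshev series of [f] is the cosine series of [f] composed with [cos]. With [m] terms the
    degree stays below [m], which leaves room for a primitive of degree [m]. *)
Definition cheb_trunc (R : realType) (f : R -> R) (m : nat) : {poly R} :=
  \sum_(0 <= j < m) (fweight R j * fcoef (fun y => f (cos y)) j 0) *: chebpoly R j.

Lemma size_cheb_trunc (R : realType) (f : R -> R) (m : nat) :
  (size (cheb_trunc f m) <= m)%N.
Proof.
rewrite /cheb_trunc big_mkord; apply: (leq_trans (size_sum _ _ _)).
apply/bigmax_leqP => j _; apply: (leq_trans (size_scale_leq _ _)).
exact: leq_trans (size_chebpoly _ _) (ltn_ord j).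
Qed.

(** The composition with [cos] is symmetric under [y -> 2 pi - y], so it has no sine
    coefficients. *)
Lemma fcoef_even (R : realType) (f : R -> R) (k : nat) : continuous f ->
  fcoef (fun y => f (cos y)) k (pi / 2) = 0.
Proof.
move=> cf; rewrite /fcoef.
set F := fun y => _; have cF : continuous F by rewrite /F; cts.
have := @ri_comp_opp R 0 (2 * pi) (2 * pi) F (twopi_ge0 R) cF.
rewrite subrr subr0.
have -> : ri 0 (2 * pi) (fun x => F (2 * pi - x)) = ri 0 (2 * pi) (fun x => - 1 * F x).
  apply: ri_ext => x _; rewrite /F.
  have -> : cos (2 * pi - x) = cos x.
    rewrite -(cosN (2 * pi - x)) opprB; have := cos_natD2pi 1 (x - 2 * pi).
    by rewrite mul1r subrK.
  have -> : cos (k%:R * (2 * pi - x) + pi / 2) = - cos (k%:R * x + pi / 2).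
    have -> : k%:R * (2 * pi - x) + pi / 2 = (pi / 2 - k%:R * x) + k%:R * (2 * pi) by ring.
    rewrite cos_natD2pi [in RHS]addrC !cosD cosN sinN cos_pihalf; ring.
  by rewrite mulrN mulN1r.
by rewrite riZ// mulN1r; lra.
Qed.

Lemma fsum_comp_cos (R : realType) (f : R -> R) (m : nat) (x : R) : continuous f ->
  fsum (fun y => f (cos y)) m x = (cheb_trunc f m).[cos x].
Proof.
move=> cf; rewrite /fsum /cheb_trunc horner_sum; apply: eq_bigr => j _.
rewrite hornerZ horner_chebpoly_cos ftermE; last by cts.
by rewrite fcoef_even// mul0r !addr0 mulrA.
Qed.

Lemma cheb_trunc_error (R : realType) (f : R -> R) (K x : R) (s m : nat) : continuous f ->
  (forall j b, (s.+2 < j)%N ->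
    `|fcoef (fun y => f (cos y)) j b| <= K / (j - s.+2)%:R ^+ s.+2) ->
  (s.+3.*2 <= m)%N -> -1 < x < 1 ->
  `|f x - (cheb_trunc f m).[x]| <= K * (2 ^+ s.+3 / m%:R ^+ s.+1).
Proof.
move=> cf fK sm /andP[x1 x2].
have K0 : 0 <= K.
  by have := fK s.+3 0 (leqnn _); rewrite subSnn expr1n divr1; apply: le_trans.
have xc : cos (acos x) = x by rewrite acosK// in_itv/= !ltW.
rewrite -{1 2}xc -fsum_comp_cos//.
apply: (@fourier_remainder _ (fun y => f (cos y))).
- by cts.
- rewrite acos_gt0 ?x2 ?ltW//=; apply: lt_trans (acos_ltpi _) _.
    by rewrite x1 ltW.
  by have := pi_gt0 R; lra.
move=> n y mn; apply: le_trans (ler_norm_sum _ _ _) _.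
have m0 : (0 < m)%N by apply: leq_trans sm; rewrite doubleS.
apply: (@le_trans _ _ (K * 2 ^+ s.+2 * \sum_(m <= k < n) (k%:R ^+ s.+2)^-1)).
  rewrite big_distrr/= big_seq_cond [leRHS]big_seq_cond; apply: ler_sum => k.
  rewrite mem_index_iota andbT => /andP[mk _].
  apply: normr_fterm_le => b.
  have sk : (s.+3.*2 <= k)%N by exact: leq_trans mk.
  have sk' : (s.+2 < k)%N by apply: leq_trans sk; rewrite -addnn leq_addr.
  apply: le_trans (fK k b sk') _; rewrite -mulrA ler_wpM2l//.
  (* The lower bound on [m] makes [k] at most [2 (k - s - 2)], which absorbs the shift of the index
     at the price of [2 ^+ s.+2]; the tail sum adds one more factor 2. *)
  have k2 : k%:R <= 2 * (k - s.+2)%:R :> R.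
    by rewrite -natrM ler_nat; lia.
  have j0 : 0 < (k - s.+2)%:R :> R by rewrite ltr0n subn_gt0.
  have k0 : 0 < k%:R :> R by rewrite ltr0n (leq_trans _ sk').
  rewrite ler_pdivlMr ?exprn_gt0// mulrC ler_pdivrMr ?exprn_gt0// -exprMn.
  by rewrite lerXn2r ?nnegrE// ltW// mulr_gt0.
rewrite -mulrA ler_wpM2l//.
apply: le_trans (ler_wpM2l _ (sum_inv_exp R n s m0)) _; first by rewrite exprn_ge0.
by rewrite mulrA -exprSr.
Qed.

(** * Fourier tails *)

Lemma normr_le_closure (R : realType) (F : R * R -> R) (c : R) : continuous F ->
  (forall z, Omega' R z -> `|F z| <= c) -> forall z, clOmega' R z -> `|F z| <= c.
Proof.
move=> cF Fc z /Omega'_closure.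
suff cl : closed [set w | `|F w| <= c] by move/(closureS Fc); rewrite -((closure_id _).1 cl).
have -> : [set w | `|F w| <= c] = (fun w => `|F w|) @^-1` [set x | x <= c] by [].
by apply: closed_comp => [w _|]; [exact: ct_norm|exact: closed_le].
Qed.

Lemma normr_le_closed_period (R : realType) (F : R -> R) (c x : R) : continuous F ->
  (forall x, 0 < x < 2 * pi -> `|F x| <= c) -> 0 <= x <= 2 * pi -> `|F x| <= c.
Proof.
move=> cF Fc x02.
apply: (@normr_le_closure _ (fun z => F z.2) c _ _ (0, x)) => [|z [_ /Fc]//|].
  by cts.
by split=> //=; rewrite lerN10 ler01.
Qed.

Lemma is_derive_fcoef (R : realType) (V V1 : R * R -> R) (k : nat) (al x : R) :
  continuous V -> continuous V1 ->
  (forall x y, Omega' R (x, y) -> is_derive x 1 (fun t => V (t, y)) (V1 (x, y))) ->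
  -1 < x < 1 ->
  is_derive x 1 (fun t => fcoef (fun y => V (t, y)) k al) (fcoef (fun y => V1 (x, y)) k al).
Proof.
move=> cV cV1 dV x1.
apply: (@is_derive_ri _ 0 (2 * pi) (-1) 1 x (fun z => V z * cos (k%:R * z.2 + al))
  (fun z => V1 z * cos (k%:R * z.2 + al))) => //.
- by cts.
- by cts.
move=> t y t1 y1 /=; have D := dV t y (conj t1 y1).
apply: is_derive_eq; rewrite scaler0 add0r /GRing.scale/=; ring.
Qed.

(** Integration by parts has no boundary terms, as the step vanishes at -1 and 1; a classical
    derivative uses up one weak order. *)
Lemma weak_bound_derive (R : realType) (H : nat -> R -> R) (a f : R -> R) (i : nat) (C : R) :
  smooth_step H -> continuous a -> continuous f ->
  (forall x : R, -1 < x < 1 -> is_derive x 1 a (f x)) ->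
  weak_bound H a i.+1 C -> weak_bound H f i C.
Proof.
move=> sH ca cf da aC d z x d0 z1 zx x1.
have sX := @smooth_step_seq _ H d z x (let: And5 s _ _ _ _ := sH in s).
have cX n : continuous (step_seq H d z x n) by exact: smooth_seq_continuous.
have cXi := cX i; have cXi1 := cX i.+1.
have : ri (-1) 1 (fun y => f y * step_seq H d z x i y + a y * step_seq H d z x i.+1 y) =
  a 1 * step_seq H d z x i 1 - a (- 1) * step_seq H d z x i (- 1).
  apply: (@ri_FTC2 R (-1) 1 _ (fun y => a y * step_seq H d z x i y)) => //.
  - by cts.
  - have cF : continuous (fun y => a y * step_seq H d z x i y) by cts.
    by move=> y _; exact: cF.
  move=> y /da D; have D' := sX i y.
  by apply: is_derive_eq; rewrite addrC /GRing.scale/= mulrC.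
rewrite (step_seq_support _ _ d0)//; last by right; exact: ltW.
rewrite (step_seq_support _ _ d0)//; last by left; exact: ltW.
rewrite !mulr0 subrr riD; [|by cts..] => /eqP; rewrite addr_eq0 => /eqP ->.
by rewrite normrN; exact: aC.
Qed.

Lemma fourier_tail (R : realType) (g : R -> R) (C x : R) (n s : nat) : continuous g ->
  (0 < n)%N -> (forall k b, (n <= k)%N -> `|fcoef g k b| <= C / k%:R ^+ s.+2) ->
  0 <= x <= 2 * pi -> `|g x - fsum g n x| <= C * (2 / n%:R ^+ s.+1).
Proof.
move=> cg n0 gC x02.
have C0 : 0 <= C.
  have := le_trans (normr_ge0 _) (gC n 0 (leqnn _)).
  by rewrite pmulr_lge0// invr_gt0 exprn_gt0// ltr0n.
apply: (@normr_le_closed_period _ (fun x => g x - fsum g n x)) => // [|y y02].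
  by have := @continuous_fsum _ g n cg => cS; cts.
apply: fourier_remainder => // m t nm.
apply: le_trans (ler_norm_sum _ _ _) _.
apply: le_trans (ler_wpM2l C0 (sum_inv_exp R m s n0)).
rewrite big_distrr/= big_seq_cond [leRHS]big_seq_cond; apply: ler_sum => k.
rewrite mem_index_iota andbT => /andP[nk _].
by apply: normr_fterm_le => b; exact: gC.
Qed.

Lemma fterm_periodic (R : realType) (g : R -> R) (k : nat) : continuous g ->
  fterm g k (2 * pi) = fterm g k 0.
Proof.
by move=> cg; rewrite !ftermE// mulr0 !addr0 add0r [_ + pi / 2]addrC -[k%:R * _]add0r addrA !cos_natD2pi addr0.
Qed.

(** Fourier partial sums agree at the two ends of the period and approximate [g] uniformly up to
    these ends. Periodicity of a solution in [phi] is obtained in this way, from the decay of its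
    coefficients. *)
Lemma fourier_periodic (R : realType) (g : R -> R) (C : R) : continuous g ->
  (forall k b, (0 < k)%N -> `|fcoef g k b| <= C / k%:R ^+ 2) -> g 0 = g (2 * pi).
Proof.
move=> cg gC; apply/eqP; rewrite -subr_eq0 -normr_le0; apply/ler_addgt0Pr => e e0.
rewrite add0r.
have C0 : 0 <= C by have := gC 1%N 0 isT; rewrite expr1n divr1; apply: le_trans.
pose n := (Num.truncn (4 * C / e)).+1.
have n0 : (0 < n)%N by [].
have b x : 0 <= x <= 2 * pi -> `|g x - fsum g n x| <= C * (2 / n%:R ^+ 1).
  by move=> x02; apply: fourier_tail => // k b nk; apply: gC; exact: leq_trans nk.
have b0 := b 0; have b1 := b (2 * pi).
have E : fsum g n (2 * pi) = fsum g n 0.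
  by apply: eq_bigr => k _; exact: fterm_periodic.
rewrite E in b1; rewrite !lexx twopi_ge0 in b0 b1.
have -> : g 0 - g (2 * pi) = (g 0 - fsum g n 0) - (g (2 * pi) - fsum g n 0) by ring.
apply: le_trans (ler_normB _ _) _; apply: le_trans (lerD (b0 isT) (b1 isT)) _.
have nn : 4 * C / e < n%:R by apply: truncnS_gt.
move: nn; rewrite ltr_pdivrMr// => /ltW nn.
have -> : C * (2 / n%:R ^+ 1) + C * (2 / n%:R ^+ 1) = 4 * C / n%:R by rewrite expr1; ring.
by rewrite ler_pdivrMr ?ltr0n// [e * _]mulrC.
Qed.

Lemma fcoef_derive (R : realType) (g g1 : R -> R) (k : nat) (al : R) :
  continuous g -> continuous g1 ->
  (forall y : R, 0 < y < 2 * pi -> is_derive y 1 g (g1 y)) -> g 0 = g (2 * pi) ->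
  fcoef g1 k al = k%:R * fcoef g k (al - pi / 2).
Proof.
move=> cg cg1 dg g0; rewrite /fcoef -riZ; last by cts.
apply/eqP; rewrite -subr_eq0 -riB; [|by cts..].
have -> : ri 0 (2 * pi)
    (fun y => g1 y * cos (k%:R * y + al) - k%:R * (g y * cos (k%:R * y + (al - pi / 2)))) =
    g (2 * pi) * cos (k%:R * (2 * pi) + al) - g 0 * cos (k%:R * 0 + al); last first.
  by rewrite mulr0 (addrC _ al) cos_natD2pi g0 add0r subrr.
apply: (@ri_FTC2 R 0 (2 * pi) _ (fun y => g y * cos (k%:R * y + al))); rewrite ?twopi_ge0//.
- by cts.
- have cF : continuous (fun y => g y * cos (k%:R * y + al)) by cts.
  by move=> x _; exact: cF.
move=> y /dg D; apply: is_derive_eq.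
rewrite addrA cosB cos_pihalf sin_pihalf mulr0 add0r mulr1 /GRing.scale/=; ring.
Qed.

(** All terms of frequency at least [n0] vanish by orthogonality, so the remainder estimate applies
    with bound 0. *)
Lemma fsum_trig (R : realType) (g : R -> R) (al be : nat -> R) (n0 n : nat) (x : R) :
  continuous g ->
  (forall y, 0 <= y <= 2 * pi ->
    g y = \sum_(0 <= k < n0) (al k * cos (k%:R * y) + be k * sin (k%:R * y))) ->
  (n0 <= n)%N -> 0 <= x <= 2 * pi -> fsum g n x = g x.
Proof.
move=> cg gE n0n x02; apply/esym/eqP; rewrite -subr_eq0 -normr_le0.
apply: (@normr_le_closed_period _ (fun x => g x - fsum g n x)) => // [|y y02].
  by have := @continuous_fsum _ g n cg => cS; cts.
apply: fourier_remainder => // m t nm.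
rewrite big_seq_cond big1 ?normr0// => k; rewrite mem_index_iota andbT => /andP[nk _].
rewrite /fterm /fcoef; set c := - _.
have -> : ri 0 (2 * pi) (fun y => g y * cos (k%:R * y + c)) =
  ri 0 (2 * pi) (fun y => \sum_(i <- index_iota 0 n0)
    (al i * (cos (k%:R * y + c) * cos (i%:R * y + 0)) +
     - be i * (cos (k%:R * y + c) * cos (i%:R * y + pi / 2)))).
  apply: ri_ext => u u02; rewrite gE// big_distrl/=; apply: eq_bigr => i _.
  rewrite addr0 [cos (i%:R * u + _)]cosD cos_pihalf sin_pihalf; ring.
rewrite ri_sum; last by move=> i; cts.
rewrite big_seq_cond big1 ?mulr0// => i; rewrite mem_index_iota andbT => /andP[_ ii].
have ik : (i < k)%N by apply: leq_trans ii (leq_trans n0n nk).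
rewrite riD; [|by cts..]; rewrite !riZ; [|by cts..].
by rewrite !ri_cos_cos_neq// !mulr0 addr0.
Qed.

(** * Approximation by Fourier-Chebyshev sums *)

Lemma fsum_sub_le (R : realType) (g : R -> R) (u0 u1 d : nat -> R) (n : nat) (x : R) :
  continuous g ->
  (forall k, `|fcoef g k 0 - u0 k| <= d k) -> (forall k, `|fcoef g k (pi / 2) - u1 k| <= d k) ->
  `|fsum g n x - \sum_(0 <= k < n)
      fweight R k * (u0 k * cos (k%:R * x + 0) + u1 k * cos (k%:R * x + pi / 2))|
    <= 2 * \sum_(0 <= k < n) d k.
Proof.
move=> cg d0 d1; rewrite /fsum -sumrB; apply: le_trans (ler_norm_sum _ _ _) _.
rewrite big_distrr/=; apply: ler_sum => k _; rewrite ftermE// -mulrBr.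
set c0 := cos _; set c1 := cos (_ + pi / 2).
have -> : fcoef g k 0 * c0 + fcoef g k (pi / 2) * c1 - (u0 k * c0 + u1 k * c1) =
  (fcoef g k 0 - u0 k) * c0 + (fcoef g k (pi / 2) - u1 k) * c1 by ring.
have /andP[w0 w1] := fweight_le1 R k.
rewrite normrM (ger0_norm w0); apply: le_trans (ler_piMl (normr_ge0 _) w1) _.
have cl (u y : R) : `|u| <= d k -> `|u * cos y| <= d k.
  move=> ud; rewrite normrM; apply: le_trans ud; rewrite ler_piMr//.
  by rewrite ler_norml cos_geN1 cos_le1.
apply: le_trans (ler_normD _ _) _; rewrite mulr_natl mulr2n.
by apply: lerD; apply: cl.
Qed.

Lemma sum_inv_exp0 (R : realType) (n s : nat) :
  \sum_(0 <= k < n) ((maxn k 1)%:R ^+ s.+2)^-1 <= 3 :> R.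
Proof.
case: n => [|n]; first by rewrite big_geq.
rewrite big_ltn// expr1n invr1 (_ : 3 = 1 + 2 :> R) 1?lerD2l; last by ring.
apply: (@le_trans _ _ (\sum_(1 <= k < n.+1) (k%:R ^+ s.+2)^-1)).
  rewrite big_seq_cond [leRHS]big_seq_cond; apply: ler_sum => k.
  by rewrite mem_index_iota andbT => /andP[/maxn_idPl -> _].
by apply: le_trans (sum_inv_exp R n.+1 s (ltn0Sn 0)) _; rewrite expr1n divr1.
Qed.

(** With [s + 4] weak orders for [V], its [rho] derivative has [s + 3]. The sup bound behind
    [weak_bound_cheb_decay] consumes the last of them, so the Chebyshev coefficients decay with
    power [s + 2], and summing the tail leaves [m ^- s.+1]. *)
Lemma Hl_coef_bounds (R : realType) (s : nat) (v V V1 : R * R -> R) :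
  in_Hl s.+4 v -> continuous V -> continuous V1 ->
  (forall z, clOmega' R z -> V z = v z) ->
  (forall x y, Omega' R (x, y) -> is_derive x 1 (fun t => V (t, y)) (V1 (x, y))) ->
  exists2 C : R, 0 <= C & forall k al (x : R), -1 < x < 1 ->
  [/\ `|fcoef (fun y => V (x, y)) k al| <= C / (maxn k 1)%:R ^+ s.+4,
      `|fcoef (fun y => V1 (x, y)) k al| <= C / (maxn k 1)%:R ^+ s.+4
    & forall m, (s.+3.*2 <= m)%N ->
      `|fcoef (fun y => V1 (x, y)) k al -
        (cheb_trunc (fun t => fcoef (fun y => V1 (t, y)) k al) m).[x]|
      <= C / (maxn k 1)%:R ^+ s.+4 / m%:R ^+ s.+1].
Proof.
move=> vl cV cV1 Vv dV; have [H sH] := exists_smooth_step R.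
have [C C0 CW] := in_Hl_weak_bound sH vl cV Vv.
exists (2 * pi * (3 * C) * 2 ^+ s.+3) => [|k al x x1].
  apply: mulr_ge0; last exact: exprn_ge0.
  by apply: mulr_ge0; [exact: twopi_ge0|exact: mulr_ge0].
set w := (maxn k 1)%:R ^+ s.+4.
have w0 : 0 < w by rewrite exprn_gt0// ltr0n leq_max orbT.
set a := fun t => fcoef (fun y => V (t, y)) k al.
set f := fun t => fcoef (fun y => V1 (t, y)) k al.
have ca : continuous a.
  by apply: (@continuous_ri _ 0 (2 * pi) (fun z => V z * cos (k%:R * z.2 + al))); cts.
have cf : continuous f.
  by apply: (@continuous_ri _ 0 (2 * pi) (fun z => V1 z * cos (k%:R * z.2 + al))); cts.
have da (t : R) : -1 < t < 1 -> is_derive t 1 a (f t) by exact: is_derive_fcoef.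
have wa i : (i <= s.+4)%N -> weak_bound H a i (C / w) by exact: CW.
have wf i : (i < s.+4)%N -> weak_bound H f i (C / w).
  by move=> il; apply: (weak_bound_derive sH ca cf da); exact: wa.
have big : 3 * (C / w) <= 2 * pi * (3 * C) * 2 ^+ s.+3 / w.
  rewrite mulrA ler_pM2r ?invr_gt0//.
  have e1 : 1 <= 2 ^+ s.+3 :> R by rewrite exprn_ege1// ler1n.
  have p1 := pi_ge2 R.
  have q1 : 1 <= 2 * pi :> R by lra.
  have c3 : 0 <= 3 * C by rewrite mulr_ge0.
  rewrite -[leLHS]mul1r mulrAC; apply: ler_wpM2r => //.
  by rewrite -[leLHS]mul1r ler_pM.
split.
- by apply: le_trans big; apply: (weak_bound_sup sH ca) => //; exact: wa.
- by apply: le_trans big; apply: (weak_bound_sup sH cf) => //; exact: wf.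
move=> m sm.
have := @cheb_trunc_error _ f (2 * pi * (3 * (C / w))) x s m cf _ sm x1.
have -> : 2 * pi * (3 * C) * 2 ^+ s.+3 / w / m%:R ^+ s.+1 =
  2 * pi * (3 * (C / w)) * (2 ^+ s.+3 / m%:R ^+ s.+1).
  by move: (w^-1) (_^-1) => u u'; ring.
apply=> j b sj; apply: (weak_bound_cheb_decay b sH cf) => //; exact: wf.
Qed.

Lemma fourier_cheb_of_poly (R : realType) (n M : nat) (A B : nat -> {poly R}) :
  (forall k, (size (A k) <= M.+1)%N) -> (forall k, (size (B k) <= M.+1)%N) ->
  fourier_cheb n.*2 M (fun z => \sum_(0 <= k < n)
    ((A k).[z.1] * cos (k%:R * z.2 + 0) + (B k).[z.1] * cos (k%:R * z.2 + pi / 2))).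
Proof.
move=> /(_ _)/chebpoly_span sA /(_ _)/chebpoly_span sB.
have [a aA] := choice sA; have [b bB] := choice sB.
(* [fourier_cheb] admits cosines up to [k = n] but sines only below [n]; the top cosine gets
   coefficient 0. The sign comes from [cos (t + pi / 2) = - sin t]. *)
exists (fun k j => if (k < n)%N then a k j else 0), (fun k j => - b k j) => z [z1 z2].
rewrite doubleK; under [RHS]eq_bigr => j _.
  rewrite big_nat_recr//= ltnn mul0r addr0.
  rewrite (_ : \sum_(0 <= i < n) _ = \sum_(0 <= i < n) a i j * cos (i%:R * z.2)); last first.
    by apply: eq_big_nat => i /andP[_ ->].
  rewrite (_ : \sum_(1 <= i < n) _ = \sum_(0 <= i < n) - b i j * sin (i%:R * z.2)); last first.
    case: (n) => [|n']; first by rewrite !big_geq.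
    by rewrite [RHS]big_ltn// mul0r sin0 mulr0 add0r.
  rewrite -big_split/= big_distrl/=; over.
rewrite exchange_big/=; apply: eq_bigr => k _.
rewrite aA bB !horner_sum !big_distrl -big_split/=; apply: eq_bigr => j _.
rewrite !hornerZ !horner_chebpoly// addr0 cosD cos_pihalf sin_pihalf; ring.
Qed.

(** The difference is minus the integral of [f - T] over [[x, 1]], whose length is at most 2; the
    added constant makes it vanish at 1. *)
Lemma trunc_primitive_error (R : realType) (a f : R -> R) (T : {poly R}) (e x : R) :
  continuous a -> continuous f ->
  (forall t : R, -1 < t < 1 -> is_derive t 1 a (f t)) ->
  (forall t, -1 < t < 1 -> `|f t - T.[t]| <= e) -> -1 < x < 1 ->
  `|a x - ((a 1 - (poly_primitive T).[1])%:P + poly_primitive T).[x]| <= 2 * e.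
Proof.
move=> ca cf da fT /andP[x1 x2].
have cT : continuous (horner T) by exact: continuous_horner.
have cP : continuous (horner (poly_primitive T)) by exact: continuous_horner.
have cfT : continuous (fun t => f t - T.[t]) by move=> t; apply: continuousB; [exact: cf|exact: cT].
have caP : continuous (fun t => a t - (poly_primitive T).[t]).
  by move=> t; apply: continuousB; [exact: ca|exact: cP].
have fT' t : x <= t <= 1 -> `|f t - T.[t]| <= e.
  move=> /andP[xt t1]; apply: (@normr_le_closure _ (fun z => f z.1 - T.[z.1]) e _ _ (t, 0)).
  - apply: (@ct_comp _ _ (fun t => f t - T.[t]) fst) => //; exact: ct_fst.
  - by move=> z [/fT].
  by split=> /=; rewrite ?t1 ?lexx ?twopi_ge0// andbT (le_trans _ xt)// ltW.
have E : ri x 1 (fun t => f t - T.[t]) = (a 1 - (poly_primitive T).[1]) - (a x - (poly_primitive T).[x]).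
  apply: (@ri_FTC2 _ x 1 _ (fun t => a t - (poly_primitive T).[t])); rewrite ?ltW//.
  - by move=> t _; exact: caP.
  move=> t /andP[xt t1]; have D := da t; rewrite t1 (lt_trans x1 xt) in D.
  have {}D := D isT; have D2 := is_derive_poly (poly_primitive T) t.
  rewrite deriv_poly_primitive in D2; exact: is_deriveB.
rewrite hornerD hornerC; have -> : a x - (a 1 - (poly_primitive T).[1] + (poly_primitive T).[x]) =
    - ri x 1 (fun t => f t - T.[t]) by rewrite E; ring.
rewrite normrN; apply: le_trans (ri_norm_le _ cfT fT') _; first exact: ltW.
have e0 : 0 <= e by apply: le_trans (fT' 1 _) => //; rewrite lexx ltW.
by rewrite mulrC ler_wpM2r//; lra.
Qed.

Lemma is_derive_bigsum (R : realType) (I : Type) (r : seq I) (F : I -> R -> R) (dF : I -> R) (x : R) :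
  (forall i, is_derive x 1 (F i) (dF i)) ->
  is_derive x 1 (fun t => \sum_(i <- r) F i t) (\sum_(i <- r) dF i).
Proof.
move=> dFi; elim: r => [|i r IH].
  by rewrite big_nil; under eq_fun do rewrite big_nil; exact: is_derive_cst.
by rewrite big_cons; under eq_fun do rewrite big_cons; exact: is_deriveD.
Qed.

Lemma is_derive_comb (R : realType) (F G : R -> R) (dF dG u b c x : R) :
  is_derive x 1 F dF -> is_derive x 1 G dG ->
  is_derive x 1 (fun t => u * (F t * b + G t * c)) (u * (dF * b + dG * c)).
Proof.
move=> DF DG; apply: is_derive_eq; rewrite !scaler0 !add0r /GRing.scale/=; ring.
Qed.

Lemma is_derive_harmonic (R : realType) (u q0 q1 k y : R) :
  is_derive y 1 (fun t => u * (q0 * cos (k * t + 0) + q1 * cos (k * t + pi / 2)))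
    (u * (- (k * q1) * cos (k * y + 0) + k * q0 * cos (k * y + pi / 2))).
Proof.
apply: is_derive_eq; rewrite !addr0 sinD cosD cos_pihalf sin_pihalf /GRing.scale/=; ring.
Qed.

Definition weighted_harmonic (R : realType) (k : nat) (u0 u1 y : R) : R :=
  fweight R k * (u0 * cos (k%:R * y + 0) + u1 * cos (k%:R * y + pi / 2)).

Lemma poly_harmonic_sum (R : realType) (n M : nat) (A B : nat -> {poly R}) :
  (forall k, (size (A k) <= M.+1)%N) -> (forall k, (size (B k) <= M.+1)%N) ->
  let p z := \sum_(0 <= k < n) weighted_harmonic k (A k).[z.1] (B k).[z.1] z.2 in
  let p1 z := \sum_(0 <= k < n) weighted_harmonic k (A k)^`().[z.1] (B k)^`().[z.1] z.2 in
  let p2 z := \sum_(0 <= k < n)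
    weighted_harmonic k (- (k%:R * (B k).[z.1])) (k%:R * (A k).[z.1]) z.2 in
  [/\ fourier_cheb n.*2 M p, C1_bar p, continuous p, continuous p1 & continuous p2] /\
  forall z, clOmega' R z -> bpd d_rho p z = p1 z /\ bpd d_phi p z = p2 z.
Proof.
move=> sA sB p p1 p2.
have chP (q : {poly R}) : continuous (fun z : R * R => q.[z.1]).
  by apply: (@ct_comp _ _ (horner q) fst); [exact: continuous_horner|exact: ct_fst].
have cg k (u0 u1 : R * R -> R) : continuous u0 -> continuous u1 ->
    continuous (fun z => weighted_harmonic k (u0 z) (u1 z) z.2).
  by move=> c0 c1; rewrite /weighted_harmonic; cts.
have cp : continuous p.
  by apply: ct_sum => k; apply: (cg k (fun z => _.[z.1]) (fun z => _.[z.1])); exact: chP.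
have cp1 : continuous p1.
  by apply: ct_sum => k; apply: (cg k (fun z => _.[z.1]) (fun z => _.[z.1])); exact: chP.
have cp2 : continuous p2.
  apply: ct_sum => k; apply: (cg k (fun z => - (_ * _.[z.1])) (fun z => _ * _.[z.1])).
    by apply: ct_opp; apply: ct_mul; [exact: ct_cst|exact: chP].
  by apply: ct_mul; [exact: ct_cst|exact: chP].
have dp1 (x y : R) : is_derive x 1 (fun t => p (t, y)) (p1 (x, y)).
  apply: is_derive_bigsum => k; rewrite /weighted_harmonic /=.
  have D0 := is_derive_poly (A k) x; have D1 := is_derive_poly (B k) x.
  exact: is_derive_comb.
have dp2 (x y : R) : is_derive y 1 (fun t => p (x, t)) (p2 (x, y)).
  by apply: is_derive_bigsum => k; exact: (is_derive_harmonic (fweight R k) (A k).[x] (B k).[x] k%:R y).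
have [C1p pE] := C1_bar_smooth cp cp1 cp2 dp1 dp2.
split=> //; split=> //.
have sZ (q : {poly R}) k : (size q <= M.+1)%N -> (size (fweight R k *: q) <= M.+1)%N.
  exact: leq_trans (size_scale_leq _ _).
have [a' [b' E]] := fourier_cheb_of_poly n (fun k => sZ _ k (sA k)) (fun k => sZ _ k (sB k)).
exists a', b' => z zO; rewrite -E//; apply: eq_bigr => k _.
rewrite !hornerZ /weighted_harmonic; move: (A k).[_] (B k).[_] (cos _) (cos _) => q1 q2 c1 c2.
by ring.
Qed.

(** Differentiating in [phi] costs one of the [s + 4] powers of [k] and summing the tail another,
    hence [n ^- s.+2]; the power of [M] is that of the Chebyshev truncation of the [rho] derivative,
    which integration from the edge hands on to the function itself. *)
Lemma fourier_cheb_approximation (R : realType) (s n0 : nat) (v : R * R -> R) (al be : nat -> R) :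
  C1_bar v -> in_Hl s.+4 v ->
  (forall y, 0 <= y <= 2 * pi ->
    v (1, y) = \sum_(0 <= k < n0) (al k * cos (k%:R * y) + be k * sin (k%:R * y))) ->
  exists2 C : R, 0 <= C & forall M n, (s.+3.*2 <= M)%N -> (0 < n)%N -> (n0 <= n)%N ->
    exists p : R * R -> R,
    [/\ C1_bar p, fourier_cheb n.*2 M p, forall y, 0 <= y <= 2 * pi -> p (1, y) = v (1, y)
      & forall z, clOmega' R z ->
        [/\ `|v z - p z| <= C * (M%:R ^- s.+1 + n%:R ^- s.+2),
            `|bpd d_rho v z - bpd d_rho p z| <= C * (M%:R ^- s.+1 + n%:R ^- s.+2)
          & `|bpd d_phi v z - bpd d_phi p z| <= C * (M%:R ^- s.+1 + n%:R ^- s.+2)]].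
Proof.
move=> C1v vl vtrace.
have [V [V1 [V2 [cV cV1 cV2 VE dV]]]] := C1_bar_extension C1v.
have Vv z : clOmega' R z -> V z = v z by move=> /VE[].
have dV1 x y : Omega' R (x, y) -> is_derive x 1 (fun t => V (t, y)) (V1 (x, y)).
  by move=> /dV[].
have [C C0 CB] := Hl_coef_bounds vl cV cV1 Vv dV1.
exists (12 * C) => [|M n sM n1 n0n]; first by rewrite mulr_ge0.
pose f k b t := fcoef (fun y => V1 (t, y)) k b.
pose a k b t := fcoef (fun y => V (t, y)) k b.
set w := fun k => (maxn k 1)%:R ^+ s.+4 : R.
set em := (M%:R ^+ s.+1)^-1 : R.
have [A [sA A1 fe ae]] : exists A : nat -> R -> {poly R},
  [/\ forall k b, (size (A k b) <= M.+1)%N, forall k b, (A k b).[1] = a k b 1,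
      forall k b (x : R), -1 < x < 1 -> `|f k b x - (A k b)^`().[x]| <= C / w k * em
    & forall k b (x : R), -1 < x < 1 -> `|a k b x - (A k b).[x]| <= 2 * (C / w k * em)].
  pose T k b := cheb_trunc (f k b) M.
  exists (fun k b => (a k b 1 - (poly_primitive (T k b)).[1])%:P + poly_primitive (T k b)).
  have fT k b x : -1 < x < 1 -> `|f k b x - (T k b).[x]| <= C / w k * em.
    by move=> x1; have [_ _ /(_ M sM)] := CB k b x x1.
  split=> k b.
  - apply: (leq_trans (size_polyD _ _)).
    rewrite geq_max (leq_trans (size_polyC_leq1 _))//.
    by apply: (leq_trans (size_poly_primitive _)); rewrite ltnS size_cheb_trunc.
  - by rewrite hornerD hornerC subrK.
  - by rewrite derivD derivC add0r deriv_poly_primitive; exact: fT.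
  move=> x x1; apply: (@trunc_primitive_error _ (a k b) (f k b)) => //.
  - by apply: (@continuous_ri _ 0 (2 * pi) (fun z => V z * cos (k%:R * z.2 + b))); cts.
  - by apply: (@continuous_ri _ 0 (2 * pi) (fun z => V1 z * cos (k%:R * z.2 + b))); cts.
  - by move=> t t1; apply: is_derive_fcoef.
  - exact: fT.
have := poly_harmonic_sum n (fun k => sA k 0) (fun k => sA k (pi / 2)).
set p := fun z => _; set p1 := fun z => _; set p2 := fun z => _.
move=> /= [[fcp C1p cp cp1 cp2] pE].
exists p; split => //.
  (* At [rho = 1] the coefficients are exact, so [p] is a Fourier partial sum of the boundary
     values, and [fsum_trig] identifies it with them. *)
  move=> y y02; have y1 : clOmega' R (1, y) by split; rewrite //= lexx andbT; lra.
  rewrite -Vv// -(@fsum_trig _ (fun y => V (1, y)) al be n0 n)//; last 2 first.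
  + by apply: continuous_row.
  + move=> t t02; rewrite Vv; first exact: vtrace.
    by split; rewrite //= lexx andbT; lra.
  apply: eq_bigr => k _; rewrite ftermE; last exact: continuous_row.
  by rewrite !A1.
set d := _ + _.
suff main z : Omega' R z ->
    [/\ `|V z - p z| <= 12 * C * d, `|V1 z - p1 z| <= 12 * C * d & `|V2 z - p2 z| <= 12 * C * d].
  move=> z zO; have [<- <- <-] := VE z zO; have [-> ->] := pE z zO.
  split.
  - apply: (@normr_le_closure _ (fun z => V z - p z)) zO; first by cts.
    by move=> z' /main[].
  - apply: (@normr_le_closure _ (fun z => V1 z - p1 z)) zO; first by cts.
    by move=> z' /main[].
  - apply: (@normr_le_closure _ (fun z => V2 z - p2 z)) zO; first by cts.
    by move=> z' /main[].
case: z => x y xyO; have [/= x1 y1] := xyO.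
have cVx := continuous_row (x := x) cV; have cV1x := continuous_row (x := x) cV1.
have cV2x := continuous_row (x := x) cV2.
have y02 : 0 <= y <= 2 * pi by lra.
have w0 k : 0 < w k by rewrite exprn_gt0// ltr0n leq_max orbT.
have em0 : 0 <= em by rewrite invr_ge0 exprn_ge0.
(* The powers of [k] produced by derivatives in [phi] still leave a summable weight. *)
have kw k i : (i <= 2)%N -> k%:R ^+ i / w k <= (maxn k 1)%:R ^- s.+2.
  move=> i2; have m1 : 1 <= (maxn k 1)%:R :> R by rewrite ler1n leq_max orbT.
  have m0 : 0 < (maxn k 1)%:R :> R by apply: lt_le_trans m1.
  rewrite ler_pdivrMr// /w -(addn2 s.+2) exprD mulrA mulVf ?mul1r; last first.
    by rewrite expf_neq0// gt_eqF.
  apply: (@le_trans _ _ ((maxn k 1)%:R ^+ i)).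
    by rewrite lerXn2r ?nnegrE// ler_nat leq_maxl.
  by rewrite ler_weXn2l.
(* The 12 is [2 * 2 * 3]: two phases per frequency, the factor 2 in the coefficient error from
   integration over [[x, 1]], and the bound 3 of [sum_inv_exp0]. *)
have claim (u : R -> R) (u0 u1 : nat -> R) : continuous u ->
    (forall k b, (0 < k)%N -> `|fcoef u k b| <= C / k%:R ^+ s.+3) ->
    (forall k, `|fcoef u k 0 - u0 k| <= 2 * C * em * (maxn k 1)%:R ^- s.+2) ->
    (forall k, `|fcoef u k (pi / 2) - u1 k| <= 2 * C * em * (maxn k 1)%:R ^- s.+2) ->
    `|u y - \sum_(0 <= k < n) weighted_harmonic k (u0 k) (u1 k) y| <= 12 * C * d.
  move=> cu uC h0 h1; have := fsum_sub_le n y cu h0 h1.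
  have : `|u y - fsum u n y| <= C * (2 / n%:R ^+ s.+2).
    by apply: fourier_tail => // k b nk; apply: uC; exact: leq_trans nk.
  rewrite -big_distrr/=; have := sum_inv_exp0 R n s.
  set S := \sum_(0 <= k < n) _ => S3 t1 t2.
  have := ler_normD (u y - fsum u n y)
    (fsum u n y - \sum_(0 <= k < n) weighted_harmonic k (u0 k) (u1 k) y).
  rewrite addrA subrK => /le_trans; apply.
  apply: le_trans (lerD t1 t2) _; rewrite /d -/em.
  have n0' : 0 <= (n%:R ^+ s.+2)^-1 :> R by rewrite invr_ge0 exprn_ge0.
  have h2 : 2 * (2 * C * em * S) <= 12 * C * em.
    have : C * em * S <= C * em * 3 by rewrite ler_wpM2l// mulr_ge0.
    by lra.
  have : 0 <= C * (n%:R ^+ s.+2)^-1 by rewrite mulr_ge0.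
  by lra.
have wk k : (0 < k)%N -> w k = k%:R ^+ s.+4 by rewrite /w => /maxn_idPl ->.
have tail1 k : (0 < k)%N -> C / w k <= C / k%:R ^+ s.+3.
  move=> k0; have k1 : 1 <= k%:R :> R by rewrite ler1n.
  rewrite wk// ler_wpM2l// lef_pV2 ?posrE ?exprn_gt0 ?ltr0n//.
  by rewrite ler_weXn2l.
split.
- apply: (claim (fun y => V (x, y))) => // [k b k0|k|k].
  + by apply: le_trans (tail1 k k0); have [] := CB k b x x1.
  + apply: le_trans (ae k 0 x x1) _; have := kw k 0%N isT; rewrite expr0 mul1r => h.
    have := ler_wpM2l (mulr_ge0 C0 em0) h; lra.
  + apply: le_trans (ae k (pi / 2) x x1) _; have := kw k 0%N isT; rewrite expr0 mul1r => h.
    have := ler_wpM2l (mulr_ge0 C0 em0) h; lra.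
- apply: (claim (fun y => V1 (x, y))) => // [k b k0|k|k].
  + by apply: le_trans (tail1 k k0); have [] := CB k b x x1.
  + apply: le_trans (fe k 0 x x1) _; have := kw k 0%N isT; rewrite expr0 mul1r => h.
    have := ler_wpM2l (mulr_ge0 C0 em0) h.
    have : 0 <= C * em * (w k)^-1 by rewrite !mulr_ge0// invr_ge0 ltW.
    lra.
  + apply: le_trans (fe k (pi / 2) x x1) _; have := kw k 0%N isT; rewrite expr0 mul1r => h.
    have := ler_wpM2l (mulr_ge0 C0 em0) h.
    have : 0 <= C * em * (w k)^-1 by rewrite !mulr_ge0// invr_ge0 ltW.
    lra.
(* Equal values at the ends of the period allow integration by parts in [phi] without boundary
   terms. *)
have Vper : V (x, 0) = V (x, 2 * pi).
  apply: (@fourier_periodic _ (fun y => V (x, y)) C) => // k b k0.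
  have [+ _ _] := CB k b x x1; move/le_trans; apply; rewrite -/(w k) wk//.
  rewrite ler_wpM2l// lef_pV2 ?posrE ?exprn_gt0 ?ltr0n//.
  by rewrite ler_weXn2l// ler1n.
have V2E k b : fcoef (fun y => V2 (x, y)) k b = k%:R * a k (b - pi / 2) x.
  by apply: fcoef_derive => // t t02; have [] := dV x t (conj x1 t02).
apply: (claim (fun y => V2 (x, y))) => // [k b k0|k|k].
- rewrite V2E normrM normr_nat.
  have [+ _ _] := CB k (b - pi / 2) x x1; rewrite -/(w k) wk// => h.
  apply: le_trans (ler_wpM2l (ler0n _ _) h) _.
  by rewrite exprS invfM mulrCA mulVKf// pnatr_eq0 -lt0n.
- rewrite V2E add0r /a fcoef_phase// cosN sinN cos_pihalf sin_pihalf mul0r add0r mulN1r.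
  rewrite opprK mulrN addrC -mulrBr normrM normr_nat distrC.
  have := ae k (pi / 2) x x1; rewrite /a => h; apply: le_trans (ler_wpM2l (ler0n _ _) h) _.
  have := ler_wpM2l (mulr_ge0 C0 em0) (kw k 1%N isT); rewrite expr1; lra.
- rewrite V2E subrr -mulrBr normrM normr_nat.
  have h := ae k 0 x x1; apply: le_trans (ler_wpM2l (ler0n _ _) h) _.
  have := ler_wpM2l (mulr_ge0 C0 em0) (kw k 1%N isT); rewrite expr1; lra.
Qed.

(** * Integration of continuous functions over the rectangle *)

(** Measurability refers to the product sigma-algebra; an open set is the countable union of the
    rational rectangles that it contains. *)
Lemma open_measurable2 (R : realType) (U : set (R * R)) : open U ->
  measurable (U : set (MR R * MR R)).
Proof.
move=> oU.
pose W (q : rat * rat * (rat * rat)) : set (MR R * MR R) :=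
  `]ratr q.1.1, ratr q.1.2[%classic `*` `]ratr q.2.1, ratr q.2.2[%classic.
pose F q := if pselect (W q `<=` U) then W q else set0.
have -> : U = \bigcup_q F q.
  apply/seteqP; split=> [[x y] Uxy|z [q _]]; last by rewrite /F; case: pselect => // WU /WU.
  have [e /= e0 eU] : nbhs_ball (x, y) U by apply/nbhs_ballP; exact: open_nbhs_nbhs.
  have approx (t : R) : exists a b : rat,
      [/\ t - e < ratr a, ratr a < t, t < ratr b & ratr b < t + e].
    have [a] : exists q, ratr q \in `]t - e, t[ by apply: rat_in_itvoo; rewrite ltrBlDr ltrDl.
    have [b] : exists q, ratr q \in `]t, t + e[ by apply: rat_in_itvoo; rewrite ltrDl.
    by rewrite !in_itv/= => /andP[b1 b2] /andP[a1 a2]; exists a, b.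
  have [a [b [a1 a2 b1 b2]]] := approx x; have [c [d [c1 c2 d1 d2]]] := approx y.
  exists ((a, b), (c, d)) => //; rewrite /F; case: pselect => [WU|]; last first.
    case=> -[u w] [/=]; rewrite !in_itv/= => /andP[u1 u2] /andP[w1 w2]; apply: eU.
    by split; rewrite /ball/= ltr_distl; apply/andP; split; lra.
  by split; rewrite /= in_itv/= ?a2 ?b1 ?c2 ?d1.
apply: countable_bigcupT_measurable => [|q]; first exact: countableP.
rewrite /F; case: pselect => //= WU; apply: measurableX; exact: measurable_itv.
Qed.

Lemma continuous_measurable2 (R : realType) (F : R * R -> R) : continuous F ->
  measurable_fun [set: MR R * MR R] F.
Proof.
move=> /continuousP cF; apply: (measurability _ (RGenOpens.measurableE R)).
move=> _ [_ [a [b ->] <-]]; rewrite setTI; apply: open_measurable2.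
exact/cF/interval_open.
Qed.

Lemma Omega'_lty (R : realType) : (leb2 R (Omega' R) < +oo)%E.
Proof.
apply: le_lt_trans (@leb2_rect_lty R (- 1) 1 0 (2 * pi)); apply: le_measure; rewrite ?inE//.
- exact: measurable_Omega'.
- exact: measurable_rect.
by move=> z [/andP[a b] /andP[c d]]; split; rewrite /= in_itv/=; rewrite !ltW.
Qed.

Lemma continuous_integrable_Omega' (R : realType) (F : R * R -> R) : continuous F ->
  (leb2 R).-integrable (Omega' R : set (MR R * MR R)) (EFin \o F).
Proof.
move=> cF; apply: measurable_bounded_integrable.
- exact: measurable_Omega'.
- exact: Omega'_lty.
- by apply: measurable_funTS; exact: continuous_measurable2.
have [B B0 FB] := continuous_bounded2 (-1) 1 0 (2 * pi) cF.
exists B; split; first by rewrite num_real.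
move=> M BM [x y] [/= /andP[x1 x2] /andP[y1 y2]]; apply: le_trans (ltW BM).
by apply: FB; rewrite !ltW.
Qed.

(** Integrating the pointwise bound and using that the integral of [k] is at most that of [g]
    cancels one copy of the former. Continuity makes all three integrals finite, which the
    cancellation in the extended reals requires. *)
Lemma second_difference_energy (R : realType) (f g k : R * R -> R) (c : R) :
  continuous f -> continuous g -> continuous k -> 0 <= c ->
  (forall z, Omega' R z -> f z + g z <= 2 * k z + c) ->
  (\int[leb2 R]_(z in Omega' R) (k z)%:E <= \int[leb2 R]_(z in Omega' R) (g z)%:E)%E ->
  (\int[leb2 R]_(z in Omega' R) (f z)%:E <=
   \int[leb2 R]_(z in Omega' R) (k z)%:E + (c * fine (leb2 R (Omega' R)))%:E)%E.
Proof.
move=> cf cg ck c0 fgk kg.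
have mO := @measurable_Omega' R.
have iF := continuous_integrable_Omega' cf; have iG := continuous_integrable_Omega' cg.
have iK := continuous_integrable_Omega' ck.
have iC : (leb2 R).-integrable (Omega' R : set (MR R * MR R)) (EFin \o (fun=> c)).
  by apply: continuous_integrable_Omega'; cts.
have fF := integrable_fin_num mO iF; have fG := integrable_fin_num mO iG.
have fK := integrable_fin_num mO iK.
have fO : leb2 R (Omega' R) \is a fin_num.
  by rewrite ge0_fin_numE//; exact: Omega'_lty.
have H : (\int[leb2 R]_(z in Omega' R) (f z)%:E + \int[leb2 R]_(z in Omega' R) (g z)%:E <=
   \int[leb2 R]_(z in Omega' R) (k z)%:E + \int[leb2 R]_(z in Omega' R) (k z)%:E +
   (c * fine (leb2 R (Omega' R)))%:E)%E.
  rewrite EFinM fineK// -integral_cst// -!integralD//; last first.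
    exact: integrableD.
  apply: le_integral => //.
  - exact: integrableD.
  - by apply: integrableD => //; apply: integrableD.
  move=> z /set_mem zO; rewrite -!EFinD lee_fin; have := fgk z zO; lra.
move: fF fG fK kg H => /=.
move: (\int[_]_(_ in _) (f _)%:E)%E (\int[_]_(_ in _) (g _)%:E)%E (\int[_]_(_ in _) (k _)%:E)%E.
move=> [x| |] [y| |] [t| |]//= _ _ _; rewrite -!EFinD !lee_fin; lra.
Qed.

(** * Second differences *)

(* [a] and [b] are perturbations of [c] of order [e], symmetric up to [e ^+ 2]. *)
Definition sdiff (R : realType) (K e a b c : R) : Prop :=
  [/\ `|c| <= K, `|a - c| <= K * e, `|b - c| <= K * e & `|a + b - 2 * c| <= K * e ^+ 2].

Lemma sdiff_ge0 (R : realType) (K e a b c : R) : sdiff K e a b c -> 0 <= K.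
Proof. by case=> h _ _ _; apply: le_trans h. Qed.

Lemma sdiff_cst (R : realType) (K e c : R) : 0 <= e -> `|c| <= K -> sdiff K e c c c.
Proof.
move=> e0 cK; have K0 : 0 <= K by apply: le_trans cK.
split=> //; rewrite ?subrr ?normr0 ?mulr_ge0// ?exprn_ge0//.
have -> : c + c - 2 * c = 0 by ring.
by rewrite normr0 mulr_ge0// exprn_ge0.
Qed.

Lemma sdiff_reflect (R : realType) (K e a c : R) : 0 <= e -> 1 <= K ->
  `|c| <= K -> `|a - c| <= e -> sdiff K e a (2 * c - a) c.
Proof.
move=> e0 K1 cK ac; have aK : `|a - c| <= K * e by apply: le_trans ac _; rewrite ler_peMl.
split=> //.
  have -> : 2 * c - a - c = - (a - c) by ring.
  by rewrite normrN.
have -> : a + (2 * c - a) - 2 * c = 0 by ring.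
by rewrite normr0 mulr_ge0 ?exprn_ge0// (le_trans _ K1).
Qed.

Lemma sdiffD (R : realType) (K K' e a b c a' b' c' : R) :
  sdiff K e a b c -> sdiff K' e a' b' c' -> sdiff (K + K') e (a + a') (b + b') (c + c').
Proof.
move=> [h0 h1 h2 h3] [k0 k1 k2 k3]; split; rewrite ?[(K + _) * _]mulrDl.
- by apply: le_trans (ler_normD _ _) _; exact: lerD.
- have -> : a + a' - (c + c') = (a - c) + (a' - c') by ring.
  by apply: le_trans (ler_normD _ _) _; exact: lerD.
- have -> : b + b' - (c + c') = (b - c) + (b' - c') by ring.
  by apply: le_trans (ler_normD _ _) _; exact: lerD.
have -> : a + a' + (b + b') - 2 * (c + c') = (a + b - 2 * c) + (a' + b' - 2 * c') by ring.
by apply: le_trans (ler_normD _ _) _; exact: lerD.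
Qed.

(** The second difference of a product splits into two terms with a second difference of one factor
    and two products of first differences, each at most [K K' e^2]; hence the 4. In the first
    differences, [e <= 1] absorbs the quadratic term. *)
Lemma sdiffM (R : realType) (K K' e a b c a' b' c' : R) : 0 <= e <= 1 ->
  sdiff K e a b c -> sdiff K' e a' b' c' -> sdiff (4 * (K * K')) e (a * a') (b * b') (c * c').
Proof.
move=> /andP[e0 e1] S S'; have K0 := sdiff_ge0 S; have K0' := sdiff_ge0 S'.
case: S S' => h0 h1 h2 h3 [k0 k1 k2 k3].
have KK : 0 <= K * K' by exact: mulr_ge0.
have ee : e ^+ 2 <= e by rewrite expr2 ler_piMr.
have one u u' : `|u - c| <= K * e -> `|u' - c'| <= K' * e ->
    `|u * u' - c * c'| <= 4 * (K * K') * e.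
  move=> hu hu'; have -> : u * u' - c * c' = (u - c) * (u' - c') + (u - c) * c' + c * (u' - c') by ring.
  have n1 : `|(u - c) * (u' - c')| <= K * e * (K' * e) by rewrite normrM ler_pM.
  have n2 : `|(u - c) * c'| <= K * e * K' by rewrite normrM ler_pM.
  have n3 : `|c * (u' - c')| <= K * (K' * e) by rewrite normrM ler_pM.
  apply: le_trans (ler_normD _ _) _.
  apply: le_trans (lerD (le_trans (ler_normD _ _) (lerD n1 n2)) n3) _.
  have := ler_wpM2l KK ee; have := mulr_ge0 KK e0; rewrite expr2; lra.
split.
- rewrite normrM; apply: le_trans (ler_pM _ _ h0 k0) _ => //; lra.
- exact: one.
- exact: one.
have -> : a * a' + b * b' - 2 * (c * c') = c * (a' + b' - 2 * c') + (a + b - 2 * c) * c' +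
   ((a - c) * (a' - c') + (b - c) * (b' - c')) by ring.
have n1 : `|c * (a' + b' - 2 * c')| <= K * (K' * e ^+ 2) by rewrite normrM ler_pM.
have n2 : `|(a + b - 2 * c) * c'| <= K * e ^+ 2 * K' by rewrite normrM ler_pM.
have n3 : `|(a - c) * (a' - c')| <= K * e * (K' * e) by rewrite normrM ler_pM.
have n4 : `|(b - c) * (b' - c')| <= K * e * (K' * e) by rewrite normrM ler_pM.
apply: le_trans (ler_normD _ _) _.
apply: le_trans (lerD (le_trans (ler_normD _ _) (lerD n1 n2)) (le_trans (ler_normD _ _) (lerD n3 n4))) _.
rewrite expr2; lra.
Qed.

(** In the Taylor expansion at [c] the linear terms combine into [f' c] times the second difference
    of the arguments, and the remainders are quadratic. *)
Lemma sdiff_comp (R : realType) (f f' : R -> R) (L K e lo hi a b c : R) : 0 <= L ->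
  (forall t u, lo <= t <= hi -> lo <= u <= hi ->
     `|f' u| <= L /\ `|f t - f u - f' u * (t - u)| <= L * (t - u) ^+ 2) ->
  lo <= a <= hi -> lo <= b <= hi -> lo <= c <= hi -> sdiff K e a b c ->
  `|f a + f b - 2 * f c| <= (L * K + 2 * (L * K ^+ 2)) * e ^+ 2.
Proof.
move=> L0 fL ai bi ci S; have K0 := sdiff_ge0 S; case: S => _ h1 h2 h3.
have [f1 fa] := fL a c ai ci; have [_ fb] := fL b c bi ci.
have -> : f a + f b - 2 * f c = f' c * (a + b - 2 * c) +
  (f a - f c - f' c * (a - c)) + (f b - f c - f' c * (b - c)) by ring.
have n1 : `|f' c * (a + b - 2 * c)| <= L * (K * e ^+ 2) by rewrite normrM ler_pM.
have sq (u : R) : `|u| <= K * e -> L * u ^+ 2 <= L * (K ^+ 2 * e ^+ 2).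
  by move=> uK; rewrite ler_wpM2l// -exprMn -(real_normK (num_real u)) lerXn2r ?nnegrE// (le_trans _ uK).
apply: le_trans (ler_normD _ _) _.
apply: le_trans (lerD (le_trans (ler_normD _ _) (lerD n1 (le_trans fa (sq _ h1)))) (le_trans fb (sq _ h2))) _.
lra.
Qed.

(** Two applications of the mean value theorem, hence no factor one half in the remainder. The
    functions are controlled on the positive half-line only, so their bounds on the segment are
    obtained through [clamp]. *)
Lemma taylor2_bound (R : realType) (f f1 f2 : R -> R) (lo hi : R) : 0 < lo -> lo <= hi ->
  (forall t : R, 0 < t -> is_derive t 1 f (f1 t)) ->
  (forall t : R, 0 < t -> is_derive t 1 f1 (f2 t)) ->
  (forall t : R, 0 < t -> {for t, continuous f2}) ->
  exists2 L : R, 0 <= L & forall t u, lo <= t <= hi -> lo <= u <= hi ->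
     `|f1 u| <= L /\ `|f t - f u - f1 u * (t - u)| <= L * (t - u) ^+ 2.
Proof.
move=> lo0 lohi df df1 cf2.
have bd (g : R -> R) : (forall t : R, 0 < t -> {for t, continuous g}) ->
    exists2 B : R, 0 <= B & forall x, lo <= x <= hi -> `|g x| <= B.
  move=> cg; have cgc : continuous (fun x => g (clamp lo hi x)).
    move=> x; apply: (@continuous_comp _ _ _ (clamp lo hi) g); first exact: continuous_clamp.
    by apply: cg; apply: lt_le_trans lo0 _; have /andP[] := clamp_itv x lohi.
  have [B B0 gB] := continuous_bounded lohi cgc.
  by exists B => // x x1; have := gB x x1; rewrite clampK.
have [B1 B10 fB1] := bd f1 (fun t t0 => is_derive_continuous (df1 t t0)).
have [B2 B20 fB2] := bd f2 cf2.
exists (B1 + B2) => [|t u ti ui]; first exact: addr_ge0.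
split; first by apply: le_trans (fB1 u ui) _; rewrite lerDl.
have mvt_le (g g1 : R -> R) (x y : R) : (forall t : R, 0 < t -> is_derive t 1 g (g1 t)) ->
    0 < x -> x <= y -> exists2 z, x <= z <= y & g y - g x = g1 z * (y - x).
  move=> dg x0 xy; have cg : {within `[x, y], continuous g}.
    apply: continuous_in_subspaceT => v /set_mem/=; rewrite in_itv/= => /andP[xv _].
    exact: is_derive_continuous (dg v (lt_le_trans x0 xv)).
  have [|z] := @MVT_segment _ g g1 x y xy _ cg.
  - by move=> v; rewrite in_itv/= => /andP[xv _]; apply: dg; exact: lt_trans xv.
  - by rewrite in_itv/= => zi E; exists z.
have mvt (g g1 : R -> R) (x y : R) : (forall t : R, 0 < t -> is_derive t 1 g (g1 t)) ->
    lo <= x <= hi -> lo <= y <= hi -> exists z, [/\ g x - g y = g1 z * (x - y),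
    lo <= z <= hi & `|z - y| <= `|x - y|].
  move=> dg /andP[x1 x2] /andP[y1 y2]; have [xy|yx] := leP x y.
    have [z /andP[z1 z2] E] := mvt_le g g1 x y dg (lt_le_trans lo0 x1) xy.
    exists z; split.
    - by rewrite -opprB E; ring.
    - by rewrite (le_trans x1 z1) (le_trans z2 y2).
    - by rewrite !ler0_norm ?subr_le0//; lra.
  have [z /andP[z1 z2] E] := mvt_le g g1 y x dg (lt_le_trans lo0 y1) (ltW yx).
  exists z; split => //.
  - by rewrite (le_trans y1 z1) (le_trans z2 x2).
  - by rewrite !ger0_norm ?subr_ge0//; lra.
have [z [-> zi zu]] := mvt f f1 t u df ti ui.
have [y [E yi _]] := mvt f1 f2 z u df1 zi ui.
have -> : f1 z * (t - u) - f1 u * (t - u) = f2 y * (z - u) * (t - u) by rewrite -E; ring.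
rewrite !normrM -[(t - u) ^+ 2](real_normK (num_real (t - u))) expr2 mulrA.
apply: ler_wpM2r => //; apply: ler_pM => //.
by apply: le_trans (fB2 y yi) _; rewrite lerDr.
Qed.

(** * Taylor bounds and continuity for the energy density *)

Lemma gfunE (R : realType) (kappa p t : R) : 0 < t ->
  gfun kappa p t = kappa * expR (p / 2 * ln (2 * t)).
Proof.
move=> t0; have t20 : 0 < 2 * t by rewrite mulr_gt0.
rewrite /gfun /powR gt_eqF ?sqrtr_gt0//; congr (_ * expR _).
by rewrite -powR12_sqrt ?ltW// ln_powR mulrA.
Qed.

Lemma gfun_taylor2_bound (R : realType) (kappa p lo hi : R) : 0 < lo -> lo <= hi ->
  exists2 L : R, 0 <= L & exists f1 : R -> R,
  forall t u, lo <= t <= hi -> lo <= u <= hi ->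
     `|f1 u| <= L /\ `|gfun kappa p t - gfun kappa p u - f1 u * (t - u)| <= L * (t - u) ^+ 2.
Proof.
move=> lo0 lohi.
pose f t := kappa * expR (p / 2 * ln (2 * t)).
pose f1 t := f t * (p / 2) * t^-1.
pose f2 t := f t * (p / 2) * (p / 2 - 1) * t^-1 * t^-1.
have df (t : R) : 0 < t -> is_derive t 1 f (f1 t).
  move=> t0; have t20 : 0 < 2 * t by rewrite mulr_gt0.
  have D : is_derive t 1 (fun x => ln (2 * x)) (t^-1).
    have := is_derive_affine (f := @ln R) (a := 2) (b := 0) (x := t) (d := (2 * t)^-1).
    rewrite addr0 => /(_ (is_derive1_ln t20)) D; apply: is_derive_ext (is_derive_eq D _).
      by move=> x; rewrite addr0.
    by rewrite invfM mulrA mulfV ?mul1r// pnatr_eq0.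
  rewrite /f /f1; apply: is_derive_eq; rewrite /f /GRing.scale/=; ring.
have fE (t : R) : 0 < t -> gfun kappa p t = f t by move=> t0; rewrite gfunE.
clearbody f.
have dV (t c : R) : 0 < t -> is_derive t 1 (fun x => c * x^-1) (- (c * t^-1 * t^-1)).
  move=> t0; have t0' : t != 0 by rewrite gt_eqF.
  have D : is_derive t 1 (fun x : R => x^-1) (- t ^- 2) .
    by have := is_deriveV (f := id) t0' (is_derive_id t 1); rewrite scaler1.
  by apply: (is_derive_eq (is_deriveZ c D)); rewrite /GRing.scale/= expr2 invfM; ring.
have df1 (t : R) : 0 < t -> is_derive t 1 f1 (f2 t).
  move=> t0; have D := df t t0; have t0' : t != 0 by rewrite gt_eqF.
  have D' := dV t (p / 2) t0.
  apply: (@is_derive_ext _ (fun x => f x * (p / 2 * x^-1))); first by move=> x; rewrite /f1 mulrA.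
  apply: is_derive_eq; rewrite /f2 /f1 /GRing.scale/=; ring.
have cf2 (t : R) : 0 < t -> {for t, continuous f2}.
  move=> t0; have D := df t t0; have t0' : t != 0 by rewrite gt_eqF.
  have -> : f2 = (fun x => f x * (p / 2 * (p / 2 - 1) * x^-1 * x^-1)).
    by apply/funext => x; rewrite /f2 !mulrA.
  have c1 : {for t, continuous (fun x : R => x^-1)} by apply: cvgV => //; exact: cvg_id.
  apply: cvgM; first exact: is_derive_continuous D.
  by apply: cvgM => //; apply: cvgM => //; exact: cvg_cst.
have [L L0 fL] := taylor2_bound lo0 lohi df df1 cf2.
exists L => //; exists f1 => t u ti ui.
by rewrite !fE; [exact: fL| |]; apply: lt_le_trans lo0 _; case/andP: ti ui => ? _ /andP[].
Qed.

Lemma rad_of_bounds (R : realType) (eps gam rho : R) : eps <= gam -> -1 <= rho <= 1 ->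
  eps <= rad_of eps gam rho <= gam.
Proof. by move=> eg /andP[r1 r2]; rewrite /rad_of; apply/andP; split; nra. Qed.

(** [Dfun] and [Ffun] at one point are polynomials in the values of the pair and its derivatives,
    with coefficients from the geometry; in this form the rules for [sdiff] and for continuity apply
    by structure. *)
Definition Dval (R : realType) (c P P1 P2 Q1 Q2 : R) : R := c * P * (P1 * (Q2 + 1) - P2 * Q1).

Definition Fval (R : realType) (a b P P1 P2 Q1 Q2 : R) : R :=
  a * (P1 ^+ 2 + P ^+ 2 * Q1 ^+ 2) + b * (P2 ^+ 2 + P ^+ 2 * (Q2 + 1) ^+ 2).

Lemma ct_Dval (R : realType) (T : topologicalType) (c P P1 P2 Q1 Q2 : T -> R) :
  continuous c -> continuous P -> continuous P1 -> continuous P2 -> continuous Q1 ->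
  continuous Q2 -> continuous (fun z => Dval (c z) (P z) (P1 z) (P2 z) (Q1 z) (Q2 z)).
Proof. by move=> c0 c1 c2 c3 c4 c5; rewrite /Dval; cts. Qed.

Lemma ct_Fval (R : realType) (T : topologicalType) (a b P P1 P2 Q1 Q2 : T -> R) :
  continuous a -> continuous b -> continuous P -> continuous P1 -> continuous P2 ->
  continuous Q1 -> continuous Q2 ->
  continuous (fun z => Fval (a z) (b z) (P z) (P1 z) (P2 z) (Q1 z) (Q2 z)).
Proof. by move=> c0 c1 c2 c3 c4 c5 c6; rewrite /Fval; cts. Qed.

Definition energy_density (R : realType) (eps gam kappa p : R) (h : R -> R) (PQ : pair_of R) (z : R * R) : R :=
  (gfun kappa p (Ffun eps gam PQ z) + h (Dfun eps gam PQ z)) *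
    (rad_of eps gam z.1 / rho_r eps gam).

Lemma energy_density_continuous (R : realType) (eps gam kappa p : R) (h : R -> R) (PQ : pair_of R) :
  0 < eps -> eps < gam -> (forall t : R, 0 < t -> {for t, continuous h}) ->
  C1_bar PQ.1 -> C1_bar PQ.2 ->
  (forall z, clOmega' R z -> 0 < Dfun eps gam PQ z /\ 0 < Ffun eps gam PQ z) ->
  continuous (fun z => energy_density eps gam kappa p h PQ (clamp2 z)).
Proof.
case: PQ => P Q e0 eg ch C1P C1Q DF.
have cP := continuous_comp_clamp2 (let: And3 c _ _ := C1P in c).
have cQ := continuous_comp_clamp2 (let: And3 c _ _ := C1Q in c).
have cP1 i := continuous_comp_clamp2 (@bpd_continuous _ i _ C1P).
have cQ1 i := continuous_comp_clamp2 (@bpd_continuous _ i _ C1Q).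
have cc1 : continuous (fun z : R * R => (clamp2 z).1).
  by apply: (@ct_comp _ _ (clamp (-1) 1) fst); [exact: continuous_clamp|exact: ct_fst].
have cr : continuous (fun z : R * R => rad_of eps gam (clamp2 z).1).
  by rewrite /rad_of; cts.
have r0 z : 0 < rad_of eps gam (clamp2 z).1.
  have [c1 _] := clamp2_clOmega' z.
  by have /andP[h1 _] := rad_of_bounds (ltW eg) c1; exact: lt_le_trans h1.
have crV : continuous (fun z : R * R => (rad_of eps gam (clamp2 z).1)^-1).
  by move=> z; apply: cvgV; [rewrite gt_eqF|exact: cr].
have crV2 : continuous (fun z : R * R => (2 * rad_of eps gam (clamp2 z).1 ^+ 2)^-1).
  move=> z; apply: cvgV; first by rewrite gt_eqF// mulr_gt0// exprn_gt0.
  have c2 : continuous (fun z : R * R => 2 * rad_of eps gam (clamp2 z).1 ^+ 2) by cts.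
  exact: c2.
have c10 := cP1 d_rho; have c11 := cP1 d_phi; have d10 := cQ1 d_rho; have d11 := cQ1 d_phi.
have cD : continuous (fun z => Dfun eps gam (P, Q) (clamp2 z)).
  have c0 : continuous (fun z : R * R => rho_r eps gam / rad_of eps gam (clamp2 z).1).
    by apply: ct_mul; [exact: ct_cst|exact: crV].
  exact: (ct_Dval c0 cP c10 c11 d10 d11).
have cF : continuous (fun z => Ffun eps gam (P, Q) (clamp2 z)).
  have c0 : continuous (fun z : R * R => rho_r eps gam ^+ 2 / 2) by exact: ct_cst.
  exact: (ct_Fval c0 crV2 cP c10 c11 d10 d11).
have chD : continuous (fun z => h (Dfun eps gam (P, Q) (clamp2 z))).
  move=> z; apply: (@continuous_comp _ _ _ (fun z => Dfun eps gam (P, Q) (clamp2 z)) h).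
    exact: cD.
  by apply: ch; have [] := DF _ (clamp2_clOmega' z).
have cgF : continuous (fun z => gfun kappa p (Ffun eps gam (P, Q) (clamp2 z))).
  have -> : (fun z => gfun kappa p (Ffun eps gam (P, Q) (clamp2 z))) =
      (fun z => kappa * expR (p / 2 * ln (2 * Ffun eps gam (P, Q) (clamp2 z)))).
    by apply/funext => z; rewrite gfunE//; have [] := DF _ (clamp2_clOmega' z).
  have cl : continuous (fun z => ln (2 * Ffun eps gam (P, Q) (clamp2 z))).
    have c2 : continuous (fun z => 2 * Ffun eps gam (P, Q) (clamp2 z)) by cts.
    move=> z; apply: (@continuous_comp _ _ _ (fun z => 2 * Ffun eps gam (P, Q) (clamp2 z)) (@ln R)).
      exact: c2.
    apply: continuous_ln; rewrite mulr_gt0//.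
    by have [] := DF _ (clamp2_clOmega' z).
  have ce := @continuous_expR R; apply: ct_mul; first by cts.
  by apply: (ct_comp ce); cts.
by apply: ct_mul; [exact: ct_add|apply: ct_mul => //; exact: ct_cst].
Qed.

(** * Perturbation of the energy *)

Lemma Dval_sdiff (R : realType) (B : R) : 1 <= B -> exists K : R,
  forall (e c P P1 P2 Q1 Q2 p p1 p2 q1 q2 p' p1' p2' q1' q2' : R), 0 <= e <= 1 -> `|c| <= B ->
    sdiff B e p p' P -> sdiff B e p1 p1' P1 -> sdiff B e p2 p2' P2 ->
    sdiff B e q1 q1' Q1 -> sdiff B e q2 q2' Q2 ->
    sdiff K e (Dval c p p1 p2 q1 q2) (Dval c p' p1' p2' q1' q2') (Dval c P P1 P2 Q1 Q2).
Proof.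
(* The constant is left open and built by the sum and product rules; it depends on [B] only. *)
move=> B1; eexists => e c P P1 P2 Q1 Q2 p p1 p2 q1 q2 p' p1' p2' q1' q2' e1 cB SP SP1 SP2 SQ1 SQ2.
have e0 : 0 <= e by case/andP: e1.
have S1 : sdiff B e 1 1 1 by apply: sdiff_cst => //; rewrite normr1.
have Sc := sdiff_cst e0 cB.
have SN x x' X : sdiff B e x x' X -> sdiff (4 * (B * B)) e (- x) (- x') (- X).
  move=> S; have := sdiffM e1 (sdiff_cst e0 (_ : `|-1| <= B)) S.
  by rewrite !mulN1r; apply; rewrite normrN1.
apply: (sdiffM e1 (sdiffM e1 Sc SP)); apply: sdiffD.
  exact: (sdiffM e1 SP1 (sdiffD SQ2 S1)).
rewrite -!mulNr; exact: (sdiffM e1 (SN _ _ _ SP2) SQ1).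
Qed.

Lemma Fval_sdiff (R : realType) (B : R) : 1 <= B -> exists K : R,
  forall (e a b P P1 P2 Q1 Q2 p p1 p2 q1 q2 p' p1' p2' q1' q2' : R), 0 <= e <= 1 ->
    `|a| <= B -> `|b| <= B ->
    sdiff B e p p' P -> sdiff B e p1 p1' P1 -> sdiff B e p2 p2' P2 ->
    sdiff B e q1 q1' Q1 -> sdiff B e q2 q2' Q2 ->
    sdiff K e (Fval a b p p1 p2 q1 q2) (Fval a b p' p1' p2' q1' q2') (Fval a b P P1 P2 Q1 Q2).
Proof.
move=> B1; eexists => e a b P P1 P2 Q1 Q2 p p1 p2 q1 q2 p' p1' p2' q1' q2'.
move=> e1 aB bB SP SP1 SP2 SQ1 SQ2; have e0 : 0 <= e by case/andP: e1.
have S1 : sdiff B e 1 1 1 by apply: sdiff_cst => //; rewrite normr1.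
have Sa := sdiff_cst e0 aB; have Sb := sdiff_cst e0 bB.
have S2 := sdiffD SQ2 S1.
rewrite /Fval !expr2; apply: sdiffD.
  apply: (sdiffM e1 Sa); apply: sdiffD; first exact: (sdiffM e1 SP1 SP1).
  exact: (sdiffM e1 (sdiffM e1 SP SP) (sdiffM e1 SQ1 SQ1)).
apply: (sdiffM e1 Sb); apply: sdiffD; first exact: (sdiffM e1 SP2 SP2).
exact: (sdiffM e1 (sdiffM e1 SP SP) (sdiffM e1 S2 S2)).
Qed.

Lemma C3_pos_taylor2_bound (R : realType) (h : R -> R) (lo hi : R) :
  C3_pos h -> 0 < lo -> lo <= hi ->
  exists2 L : R, 0 <= L & exists h1 : R -> R,
  forall t u, lo <= t <= hi -> lo <= u <= hi ->
     `|h1 u| <= L /\ `|h t - h u - h1 u * (t - u)| <= L * (t - u) ^+ 2.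
Proof.
move=> [dh _] lo0 lohi.
have D n (t : R) : (n < 3)%N -> 0 < t -> is_derive t 1 (derive1n n h) (derive1n n.+1 h t).
  by move=> n3 t0; rewrite derive1nS derive1E; apply/derivableP; exact: dh.
have [L L0 hL] := taylor2_bound lo0 lohi (fun t => D 0%N t isT) (fun t => D 1%N t isT)
   (fun t t0 => is_derive_continuous (D 2 t isT t0)).
by exists L => //; exists (derive1n 1 h).
Qed.

Lemma C3_pos_continuous (R : realType) (h : R -> R) (t : R) : C3_pos h -> 0 < t ->
  {for t, continuous h}.
Proof.
move=> [dh _] t0; have := dh 0%N t isT t0 => /= /derivableP; exact: is_derive_continuous.
Qed.

Definition C1_close (R : realType) (e : R) (f g : R * R -> R) : Prop :=
  forall z, clOmega' R z -> `|f z - g z| <= e /\ forall i, `|bpd i f z - bpd i g z| <= e.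

(** Perturbed values of [Dfun] and [Ffun] stay in a compact part of the positive half-line, where
    [g] and [h] have Taylor bounds; half of [lo] is sacrificed. *)
Lemma sdiff_itv (R : realType) (K K' e a b c lo hi : R) : 0 <= e -> K' <= K -> K * e <= lo / 2 ->
  sdiff K' e a b c -> lo <= c <= hi ->
  [/\ lo / 2 <= a <= hi + lo / 2, lo / 2 <= b <= hi + lo / 2 & lo / 2 <= c <= hi + lo / 2].
Proof.
move=> e0 K'K Ke [_ ha hb _] /andP[c1 c2]; have K'e : K' * e <= lo / 2.
  by apply: le_trans Ke; rewrite ler_wpM2r.
move: (normr_ge0 (a - c)) ha hb; rewrite !ler_distl => n0 /andP[u1 u2] /andP[v1 v2].
have : 0 <= K' * e by lra.
by split; apply/andP; split; lra.
Qed.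

Lemma weighted_second_difference (R : realType) (a b e b1 b2 b0 a1 a2 a0 w W : R) :
  0 <= w -> w <= W ->
  `|b1 + b2 - 2 * b0| <= b * e ^+ 2 -> `|a1 + a2 - 2 * a0| <= a * e ^+ 2 ->
  (b1 + a1) * w + (b2 + a2) * w <= 2 * ((b0 + a0) * w) + `|b + a| * W * e ^+ 2.
Proof.
move=> w0 wW hb ha; have e2 : 0 <= e ^+ 2 by rewrite sqr_ge0.
have n0 : 0 <= `|b + a| * e ^+ 2 by rewrite mulr_ge0.
have h : (b1 + a1) + (b2 + a2) - 2 * (b0 + a0) <= `|b + a| * e ^+ 2.
  have -> : (b1 + a1) + (b2 + a2) - 2 * (b0 + a0) = (b1 + b2 - 2 * b0) + (a1 + a2 - 2 * a0).
    by ring.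
  apply: le_trans (ler_norm _) _; apply: le_trans (ler_normD _ _) _.
  apply: le_trans (lerD hb ha) _; rewrite -mulrDl.
  by rewrite ler_wpM2r// ler_norm.
have := ler_wpM2r w0 h; have := ler_wpM2l n0 wW; lra.
Qed.

Lemma energy_perturbation (R : realType) (eps gam kappa p : R) (h : R -> R) (P Q : R * R -> R)
    (lo hi : R) :
  0 < eps -> eps < gam -> 0 < lo -> C3_pos h -> C1_bar P -> C1_bar Q ->
  (forall z, clOmega' R z -> lo <= Dfun eps gam (P, Q) z <= hi /\ lo <= Ffun eps gam (P, Q) z <= hi) ->
  exists2 C : R, 0 <= C & exists2 e0 : R, 0 < e0 & forall (e : R) P1 Q1, 0 <= e <= e0 ->
    C1_bar P1 -> C1_bar Q1 -> C1_close e P1 P -> C1_close e Q1 Q ->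
    let P2 := fun z => 2 * P z + (- 1) * P1 z in
    let Q2 := fun z => 2 * Q z + (- 1) * Q1 z in
    [/\ C1_bar P2, C1_bar Q2,
        forall z, clOmega' R z ->
          0 < Dfun eps gam (P1, Q1) z /\ 0 < Dfun eps gam (P2, Q2) z
      & (energy eps gam kappa p h (P, Q) <= energy eps gam kappa p h (P2, Q2) ->
         energy eps gam kappa p h (P1, Q1) <=
           energy eps gam kappa p h (P, Q) + (C * e ^+ 2)%:E)%E].
Proof.
move=> eps0 eg lo0 hC3 C1P C1Q DF.
have bnd (f : R * R -> R) : {within clOmega' R, continuous f} ->
    exists2 B : R, 0 <= B & forall z, clOmega' R z -> `|f z| <= B.
  move=> /continuous_comp_clamp2 cf.
  have [B B0 fB] := continuous_bounded2 (-1) 1 0 (2 * pi) cf.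
  exists B => // -[x y] zO; have [z1 z2] := zO.
  by have := fB x y z1 z2; rewrite clamp2K.
have [BP BP0 hBP] := bnd P (let: And3 c _ _ := C1P in c).
have bnd1 f i (cf : C1_bar f) := bnd _ (@bpd_continuous R i f cf).
have [BP1 BP10 hBP1] := bnd1 P d_rho C1P; have [BP2 BP20 hBP2] := bnd1 P d_phi C1P.
have [BQ1 BQ10 hBQ1] := bnd1 Q d_rho C1Q; have [BQ2 BQ20 hBQ2] := bnd1 Q d_phi C1Q.
have rr0 : 0 < rho_r eps gam by rewrite divr_gt0// subr_gt0.
set r0 := rho_r eps gam in rr0.
have gr0 : 0 <= gam / r0 by apply: divr_ge0; apply: ltW; rewrite // (lt_trans eps0).
have rad z : clOmega' R z -> eps <= rad_of eps gam z.1 <= gam.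
  by case=> z1 _; apply: rad_of_bounds => //; exact: ltW.
have rad0 z : clOmega' R z -> 0 < rad_of eps gam z.1.
  by move=> /rad /andP[h1 _]; exact: lt_le_trans h1.
pose B := 1 + BP + BP1 + BP2 + BQ1 + BQ2 + r0 / eps + r0 ^+ 2 / 2 + (2 * eps ^+ 2)^-1.
have t1 : 0 <= r0 / eps by rewrite divr_ge0// ltW.
have t2 : 0 <= r0 ^+ 2 / 2 by rewrite divr_ge0// exprn_ge0// ltW.
have t3 : 0 <= (2 * eps ^+ 2)^-1 by rewrite invr_ge0 mulr_ge0// exprn_ge0// ltW.
have [B1 bP b1 b2 b3] : [/\ 1 <= B, BP <= B, BP1 <= B, BP2 <= B & BQ1 <= B].
  by rewrite /B; split; lra.
have [b4 b5 b6 b7] : [/\ BQ2 <= B, r0 / eps <= B, r0 ^+ 2 / 2 <= B & (2 * eps ^+ 2)^-1 <= B].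
  by rewrite /B; split; lra.
clearbody B.
have [KD hKD] := Dval_sdiff B1; have [KF hKF] := Fval_sdiff B1.
have lohi : lo <= hi.
  have O0 : clOmega' R (0, 0) by split; rewrite /= ?lexx ?twopi_ge0 ?lerN10 ?ler01.
  by have [/andP[+ +] _] := DF _ O0; exact: le_trans.
have lo2 : 0 < lo / 2 by rewrite divr_gt0.
have lohi2 : lo / 2 <= hi + lo / 2 by lra.
have [Lh Lh0 [h1 hLh]] := C3_pos_taylor2_bound hC3 lo2 lohi2.
have [Lg Lg0 [g1 hLg]] := gfun_taylor2_bound kappa p lo2 lohi2.
pose K := Num.max 1 (Num.max KD KF).
have K1 : 1 <= K by rewrite le_max lexx.
have KDK : KD <= K by rewrite !le_max lexx orbT.
have KFK : KF <= K by rewrite !le_max lexx !orbT.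
(* The bound 1 serves the product rule [sdiffM]; the other one keeps the perturbations of [Dfun] and
   [Ffun] below [lo / 2]. *)
pose e0 := Num.min 1 (lo / 2 / K).
have e00 : 0 < e0 by rewrite lt_min ltr01 divr_gt0// (lt_le_trans _ K1).
have e01 : e0 <= 1 by rewrite ge_min lexx.
have e0K : e0 <= lo / 2 / K by rewrite ge_min lexx orbT.
clearbody e0 K.
pose m := fine (leb2 R (Omega' R)).
pose c0 := (Lg * KF + 2 * (Lg * KF ^+ 2)) + (Lh * KD + 2 * (Lh * KD ^+ 2)).
exists (`|c0| * (gam / r0) * m).
  by rewrite mulr_ge0 ?fine_ge0// mulr_ge0.
exists e0; first exact: e00.
move=> e P1 Q1 /andP[e_ge0 ee0] C1P1 C1Q1 clP clQ P2 Q2.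
have e1 : 0 <= e <= 1 by rewrite e_ge0 (le_trans ee0).
have Ke : K * e <= lo / 2.
  by rewrite mulrC -ler_pdivlMr ?(lt_le_trans _ K1)// (le_trans ee0).
have [C1P2 bP2] := C1_bar_lin 2 (-1) C1P C1P1; have [C1Q2 bQ2] := C1_bar_lin 2 (-1) C1Q C1Q1.
have S (x y M : R) : `|x| <= M -> M <= B -> `|y - x| <= e -> sdiff B e y (2 * x + (- 1) * y) x.
  by move=> xM MB xy; rewrite mulN1r; apply: sdiff_reflect => //; exact: le_trans MB.
have SDF z : clOmega' R z ->
    sdiff KD e (Dfun eps gam (P1, Q1) z) (Dfun eps gam (P2, Q2) z) (Dfun eps gam (P, Q) z) /\
    sdiff KF e (Ffun eps gam (P1, Q1) z) (Ffun eps gam (P2, Q2) z) (Ffun eps gam (P, Q) z).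
  move=> zO; have [cP cPi] := clP z zO; have [cQ cQi] := clQ z zO.
  have [e_r _] := andP (rad z zO); have rz := rad0 z zO.
  have SP : sdiff B e (P1 z) (P2 z) (P z) by exact: S (hBP z zO) bP cP.
  have SP1 : sdiff B e (bpd d_rho P1 z) (bpd d_rho P2 z) (bpd d_rho P z).
    by rewrite (bP2 d_rho z zO); exact: S (hBP1 z zO) b1 (cPi d_rho).
  have SP2 : sdiff B e (bpd d_phi P1 z) (bpd d_phi P2 z) (bpd d_phi P z).
    by rewrite (bP2 d_phi z zO); exact: S (hBP2 z zO) b2 (cPi d_phi).
  have SQ1 : sdiff B e (bpd d_rho Q1 z) (bpd d_rho Q2 z) (bpd d_rho Q z).
    by rewrite (bQ2 d_rho z zO); exact: S (hBQ1 z zO) b3 (cQi d_rho).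
  have SQ2 : sdiff B e (bpd d_phi Q1 z) (bpd d_phi Q2 z) (bpd d_phi Q z).
    by rewrite (bQ2 d_phi z zO); exact: S (hBQ2 z zO) b4 (cQi d_phi).
  split.
    apply: hKD => //; rewrite ger0_norm; last by apply: divr_ge0; exact: ltW.
    apply: le_trans b5.
    by rewrite ler_pM2l// lef_pV2.
  apply: hKF => //.
    by rewrite ger0_norm.
  rewrite ger0_norm; last by rewrite invr_ge0 mulr_ge0// exprn_ge0// ltW.
  apply: le_trans b7.
  by rewrite lef_pV2 ?posrE ?mulr_gt0 ?exprn_gt0// ler_pM2l// lerXn2r ?nnegrE// ltW.
have itv K' a b c (K'K : K' <= K) := @sdiff_itv _ K K' e a b c lo hi e_ge0 K'K Ke.
have DF1 z : clOmega' R z -> 0 < Dfun eps gam (P1, Q1) z /\ 0 < Ffun eps gam (P1, Q1) z.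
  move=> zO; have [SD SF] := SDF z zO; have [Db Fb] := DF z zO.
  have [/andP[a _] _ _] := itv _ _ _ _ KDK SD Db; have [/andP[b _] _ _] := itv _ _ _ _ KFK SF Fb.
  by split; apply: lt_le_trans lo2 _.
have DF2 z : clOmega' R z -> 0 < Dfun eps gam (P2, Q2) z /\ 0 < Ffun eps gam (P2, Q2) z.
  move=> zO; have [SD SF] := SDF z zO; have [Db Fb] := DF z zO.
  have [_ /andP[a _] _] := itv _ _ _ _ KDK SD Db; have [_ /andP[b _] _] := itv _ _ _ _ KFK SF Fb.
  by split; apply: lt_le_trans lo2 _.
have DF0 z : clOmega' R z -> 0 < Dfun eps gam (P, Q) z /\ 0 < Ffun eps gam (P, Q) z.
  by move=> /DF[/andP[a _] /andP[b _]]; split; exact: lt_le_trans lo0 _.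
split; [exact: C1P2|exact: C1Q2| |].
  by move=> z zO; split; [exact: (DF1 z zO).1|exact: (DF2 z zO).1].
have ch (t : R) : 0 < t -> {for t, continuous h} by exact: C3_pos_continuous.
have cd0 := @energy_density_continuous R eps gam kappa p h (P, Q) eps0 eg ch C1P C1Q DF0.
have cd1 := @energy_density_continuous R eps gam kappa p h (P1, Q1) eps0 eg ch C1P1 C1Q1 DF1.
have cd2 := @energy_density_continuous R eps gam kappa p h (P2, Q2) eps0 eg ch C1P2 C1Q2 DF2.
have enE (PQ : pair_of R) : energy eps gam kappa p h PQ =
    (\int[leb2 R]_(z in Omega' R) (energy_density eps gam kappa p h PQ (clamp2 z))%:E)%E.
  by apply: eq_integral => z /set_mem zO; rewrite clamp2K//; exact: Omega'_clOmega'.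
rewrite !enE => le02.
have := second_difference_energy cd1 cd2 cd0 (c := `|c0| * (gam / r0) * e ^+ 2) _ _ le02.
have -> : `|c0| * (gam / r0) * m * e ^+ 2 = `|c0| * (gam / r0) * e ^+ 2 * m by ring.
apply.
  by rewrite mulr_ge0 ?exprn_ge0// mulr_ge0.
move=> z /Omega'_clOmega' zO; rewrite clamp2K//.
have [SD SF] := SDF z zO; have [Db Fb] := DF z zO.
have [D1 D2 Db'] := itv _ _ _ _ KDK SD Db; have [F1 F2 Fb'] := itv _ _ _ _ KFK SF Fb.
have hh := sdiff_comp Lh0 hLh D1 D2 Db' SD; have gg := sdiff_comp Lg0 hLg F1 F2 Fb' SF.
have rz := rad0 z zO; have /andP[_ rg] := rad z zO.
rewrite /energy_density; set w := _ / rho_r eps gam.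
have w0 : 0 <= w by rewrite divr_ge0 ?ltW.
have wg : w <= gam / r0 by rewrite ler_pM2r ?invr_gt0.
exact: weighted_second_difference w0 wg gg hh.
Qed.

(** * The error estimate *)

Lemma fourier_cheb_trace (R : realType) (N M : nat) (f : R * R -> R) :
  fourier_cheb N M f -> exists al be : nat -> R, forall y, 0 <= y <= 2 * pi ->
    f (1, y) = \sum_(0 <= k < N./2.+1) (al k * cos (k%:R * y) + be k * sin (k%:R * y)).
Proof.
move=> [a [b E]].
exists (fun k => \sum_(0 <= j < M.+1) a k j * cheb j 1).
exists (fun k => if (1 <= k < N./2)%N then \sum_(0 <= j < M.+1) b k j * cheb j 1 else 0).
have wid m (F : nat -> R) : \sum_(1 <= k < m) F k =
    \sum_(0 <= k < m.+1) (if (1 <= k < m)%N then F k else 0).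
  case: m => [|m]; first by rewrite big_geq// big_nat1.
  rewrite [RHS]big_ltn// [X in _ = _ + X]big_nat_recr//= ltnn addr0 add0r.
  by apply: eq_big_nat => k ->.
move=> y y02; rewrite E; last by split; rewrite //= lexx andbT; lra.
under eq_bigr => j _ do rewrite wid -big_split/= big_distrl/=.
rewrite exchange_big/=; apply: eq_bigr => k _.
rewrite big_distrl/=; case: ifP => _; last first.
  by rewrite mul0r addr0; apply: eq_bigr => j _; rewrite addr0 mulrAC.
by rewrite big_distrl/= -big_split/=; apply: eq_bigr => j _; ring.
Qed.

(** The square of a sum is at most twice the sum of the squares, and [2 (s + 1) >= s + 2],
    [2 (s + 2) >= s + 3]. Passing from [n] to [N = 2 n] costs [2 ^+ s.+3], whence [2 ^+ s.+4] in
    all. *)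
Lemma sqr_rate_le (R : realType) (s M n : nat) : (0 < M)%N -> (0 < n)%N ->
  (M%:R ^- s.+1 + n%:R ^- s.+2) ^+ 2 <=
  2 ^+ s.+4 * (M%:R ^ (2 - s.+4%:Z) + n.*2%:R ^ (1 - s.+4%:Z)) :> R.
Proof.
move=> M0 n0.
have -> : 2 - s.+4%:Z = - s.+2%:Z by lia.
have -> : 1 - s.+4%:Z = - s.+3%:Z by lia.
rewrite -!exprnN.
have -> : n.*2%:R ^- s.+3 = n%:R ^- s.+3 * 2 ^- s.+3 :> R by rewrite -muln2 natrM exprMn invfM.
have inv (m i j : nat) : (0 < m)%N -> (i <= j)%N -> m%:R ^- j <= m%:R ^- i :> R.
  move=> m0 ij; rewrite lef_pV2 ?posrE ?exprn_gt0 ?ltr0n//.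
  by rewrite ler_weXn2l// ler1n.
have hM : (M%:R ^- s.+1) ^+ 2 <= M%:R ^- s.+2 :> R.
  by rewrite -exprVn -exprM exprVn; apply: inv => //; lia.
have hn : (n%:R ^- s.+2) ^+ 2 <= n%:R ^- s.+3 :> R.
  by rewrite -exprVn -exprM exprVn; apply: inv => //; lia.
have e1 : 1 <= 2 ^+ s.+3 :> R by rewrite exprn_ege1// ler1n.
have p1 : 0 <= M%:R ^- s.+2 :> R by rewrite invr_ge0 exprn_ge0.
have p2 : M%:R ^- s.+2 <= 2 ^+ s.+3 * M%:R ^- s.+2 :> R by rewrite ler_peMl.
have n2 : 2 ^+ s.+3 != 0 :> R by rewrite expf_neq0// pnatr_eq0.
rewrite [2 ^+ s.+4]exprS; move: hM hn p2 n2.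
move: (M%:R ^- s.+1) (n%:R ^- s.+2) (M%:R ^- s.+2) (n%:R ^- s.+3) (2 ^+ s.+3) => a b c d e.
move=> h1 h2 h3 e0; have -> : 2 * e * (c + d * e^-1) = 2 * (e * c) + 2 * d by field.
have := sqr_ge0 (a - b); rewrite !expr2 in h1 h2 *; lra.
Qed.

Lemma rate_eventually_le (R : realType) (C e0 : R) : 0 <= C -> 0 < e0 -> exists K : nat,
  forall M n s, (K <= M)%N -> (K <= n)%N -> (0 < M)%N -> (0 < n)%N ->
    C * (M%:R ^- s.+1 + n%:R ^- s.+2) <= e0.
Proof.
move=> C0 e00; exists (Num.truncn (2 * C / e0)).+1 => M n s KM Kn M0 n0.
have small (m i : nat) : ((Num.truncn (2 * C / e0)).+1 <= m)%N -> (0 < m)%N -> C * m%:R ^- i.+1 <= e0 / 2.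
  move=> Km m0; have m0' : 0 < m%:R :> R by rewrite ltr0n.
  apply: (@le_trans _ _ (C / m%:R)).
    rewrite ler_wpM2l// lef_pV2 ?posrE ?exprn_gt0// -[leLHS]expr1.
    by rewrite ler_weXn2l// ler1n.
  rewrite ler_pdivrMr//.
  have : 2 * C / e0 < (Num.truncn (2 * C / e0)).+1%:R by apply: truncnS_gt.
  have : (Num.truncn (2 * C / e0)).+1%:R <= m%:R :> R by rewrite ler_nat.
  move=> h1 h2; have := lt_le_trans h2 h1; rewrite ltr_pdivrMr//; lra.
rewrite mulrDr; have := small M s KM M0; have := small n s.+1 Kn n0; lra.
Qed.

Lemma node_itv (R : realType) (N n : nat) : (n < N)%N -> 0 <= node R N n <= 2 * pi.
Proof.
move=> nN; have N0 : 0 < N%:R :> R by rewrite ltr0n (leq_trans _ nN).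
rewrite /node !mulr_ge0 ?invr_ge0 ?pi_ge0//= ler_pdivrMr// ler_wpM2l ?twopi_ge0//.
by rewrite ler_nat ltnW.
Qed.

(** The factor [2 r^2] lies between [2 eps^2] and 2, the latter because [gam <= 1]. *)
Lemma bounds_of_scaled (R : realType) (eps gam c r F : R) : 0 < eps -> gam <= 1 -> 1 < c ->
  eps <= r <= gam -> c^-1 <= 2 * r ^+ 2 * F <= c ->
  c^-1 / 2 <= F <= c / (2 * eps ^+ 2).
Proof.
move=> e0 g1 c1 /andP[r1 r2] /andP[G1 G2].
have c0 : 0 < c^-1 by rewrite invr_gt0; lra.
have e2 : 0 < 2 * eps ^+ 2 by rewrite mulr_gt0// exprn_gt0.
have r20 : 0 < 2 * r ^+ 2 by rewrite mulr_gt0// exprn_gt0//; lra.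
have rr : 2 * r ^+ 2 <= 2 by rewrite -[leRHS]mulr1 ler_pM2l// exprn_ile1//; lra.
have er : 2 * eps ^+ 2 <= 2 * r ^+ 2 by rewrite ler_pM2l// lerXn2r ?nnegrE//; lra.
have F0 : 0 < F by rewrite -(@pmulr_rgt0 _ (2 * r ^+ 2))// (lt_le_trans c0).
apply/andP; split.
  by rewrite ler_pdivrMr// mulrC (le_trans G1)// ler_pM2r.
by rewrite ler_pdivlMr// mulrC (le_trans _ G2)// ler_pM2r.
Qed.

(** The threshold is doubled because the conditions bear on [N./2], the number of frequencies in the
    competitor. *)
Lemma even_threshold (a b c M N : nat) : ((a + b + c).*2.+2 <= M)%N -> ((a + b + c).*2.+2 <= N)%N ->
  ~~ odd N ->
  [/\ N = N./2.*2, (0 < N./2)%N & [/\ a <= M, b <= M, b <= N./2 & c <= N./2]%N].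
Proof.
move=> KM KN evN; have NE : N = N./2.*2 by rewrite -[LHS]odd_double_half (negbTE evN).
by split => //; [lia|split; lia].
Qed.

Theorem theorem3 (R : realType) (eps gam kappa p : R) (h : R -> R)
  (u0 : R * R -> R * R) (P0 Q0 : R -> R) (PQ : pair_of R) (l : nat)
  (heps : 0 < eps) (hepsgam : eps < gam) (hgam : gam <= 1)
  (hkappa : 0 < kappa) (hp1 : 1 < p) (hp2 : p < 2)
  (hC3 : C3_pos h) (hconvex : strictly_convex_pos h)
  (hzero : h t @[t --> (0 : R)^'+] --> +oo)
  (hinfty : h t / t @[t --> +oo] --> +oo)
  (hW : forall A : 'M[R]_2, 0 < \det A -> 0 < stored_energy kappa p h A)
  (hu0 : smooth_on_circle gam u0)
  (hP0Q0 : boundary_polar gam u0 P0 Q0)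
  (hcav : cavitation_solution eps gam kappa p h u0 PQ)
  (hl : (6 < l)%N)
  (hreg : in_Hl l PQ.1 /\ in_Hl l PQ.2)
  (hmin : minimizer (energy eps gam kappa p h) (Bplus eps gam P0 Q0) PQ)
  (cF cD : R) (hcF : 1 < cF) (hcD : 1 < cD)
  (hF : forall z, clOmega' R z ->
     cF^-1 <= 2 * rad_of eps gam z.1 ^+ 2 * Ffun eps gam PQ z <= cF)
  (hD : forall z, clOmega' R z -> cD^-1 <= Dfun eps gam PQ z <= cD) :
  exists2 C : R, 0 < C &
    exists K : nat, forall (M N : nat), (K <= M)%N -> (K <= N)%N ->
      (1 <= M)%N -> (2 <= N)%N -> ~~ odd N ->
      forall PQ_NM : pair_of R,
        minimizer (energy eps gam kappa p h) (Bplus_NM eps gam P0 Q0 N M)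
          PQ_NM ->
        (energy eps gam kappa p h PQ <= energy eps gam kappa p h PQ_NM)%E /\
        (energy eps gam kappa p h PQ_NM <=
           energy eps gam kappa p h PQ +
           (C * (M%:R ^ (2 - l%:Z) + N%:R ^ (1 - l%:Z)))%:E)%E.
Proof.
(* The claim is vacuous if no [B^NM_+] is inhabited; otherwise a single member
   shows that the boundary data are trigonometric polynomials. *)
have [[N0 [M0 [X XB]]]|none] := pselect (exists N M X, Bplus_NM eps gam P0 Q0 N M X); last first.
  exists 1 => //; exists 0%N => M N _ _ _ _ _ Y [YB _].
  by case: none; exists N, M, Y.
case: XB => -[fX1 fX2 _] [[_ _ Xtr] _].
have [al [be alE]] := fourier_cheb_trace fX1.
have [al' [be' alE']] := fourier_cheb_trace fX2.
set n0 := N0./2.+1 in alE alE'.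
(* In terms of [s] the exponents [l - 3] and [l - 2] of the approximation are [s + 1] and [s + 2],
   without subtraction of natural numbers. *)
have [s lE] : exists s, l = s.+4 by exists (l - 4)%N; lia.
move: hreg hmin hF hD; case: PQ {hcav} => P Q [/= Pl Ql] [[[/= C1P C1Q tr] Dpos] Emin] hF hD.
rewrite lE in Pl Ql *.
have trP (y : R) : 0 <= y <= 2 * pi ->
    P (1, y) = \sum_(0 <= k < n0) (al k * cos (k%:R * y) + be k * sin (k%:R * y)).
  by move=> y02; have [/= -> _] := tr y y02; rewrite -alE//; have [] := Xtr y y02.
have trQ (y : R) : 0 <= y <= 2 * pi ->
    Q (1, y) = \sum_(0 <= k < n0) (al' k * cos (k%:R * y) + be' k * sin (k%:R * y)).
  by move=> y02; have [/= _ ->] := tr y y02; rewrite -alE'//; have [] := Xtr y y02.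
have [CP CP0 appP] := fourier_cheb_approximation C1P Pl trP.
have [CQ CQ0 appQ] := fourier_cheb_approximation C1Q Ql trQ.
pose lo := Num.min cD^-1 (cF^-1 / 2).
pose hi := Num.max cD (cF / (2 * eps ^+ 2)).
have cD0 : 0 < cD^-1 by rewrite invr_gt0; lra.
have cF0 : 0 < cF^-1 by rewrite invr_gt0; lra.
have lo0 : 0 < lo by rewrite lt_min cD0 divr_gt0.
have DF z : clOmega' R z -> lo <= Dfun eps gam (P, Q) z <= hi /\ lo <= Ffun eps gam (P, Q) z <= hi.
  move=> zO; have /andP[D1 D2] := hD z zO.
  have /andP[F3 F4] := bounds_of_scaled heps hgam hcF (rad_of_bounds (ltW hepsgam) (proj1 zO)) (hF z zO).
  by rewrite !ge_min !le_max D1 D2 F3 F4 !orbT.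
have [C1 C10 [e0 e00 pert]] := @energy_perturbation R eps gam kappa p h P Q lo hi heps hepsgam lo0 hC3 C1P C1Q DF.
pose Ca := CP + CQ.
have Ca0 : 0 <= Ca by rewrite addr_ge0.
have [K0 small] := rate_eventually_le Ca0 e00.
(* The summand 1 keeps the constant positive even if the product vanishes. *)
exists (C1 * Ca ^+ 2 * 2 ^+ s.+4 + 1).
  apply: ltr_wpDl ltr01; apply: mulr_ge0; last exact: exprn_ge0.
  by apply: mulr_ge0; last exact: exprn_ge0.
exists ((s.+3.*2 + K0 + n0).*2.+2) => M N KM KN M1 N2 evN PQ_NM [[BNM [BN DN]] NMmin].
split; first exact: Emin.
have [NE n1 [sM KM' Kn n0n]] := even_threshold KM KN evN.
set n := N./2 in NE n1 Kn n0n.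
have [p1 [C1p fp trp clp]] := appP M n sM n1 n0n.
have [q1 [C1q fq trq clq]] := appQ M n sM n1 n0n.
set d := _ + _ in clp clq.
have d0 : 0 <= d by rewrite addr_ge0// invr_ge0 exprn_ge0.
have dP : CP * d <= Ca * d by rewrite ler_wpM2r// lerDl.
have dQ : CQ * d <= Ca * d by rewrite ler_wpM2r// lerDr.
have close1 : C1_close (Ca * d) p1 P.
  move=> z zO; have [h0 h1 h2] := clp z zO; rewrite distrC; split; first exact: le_trans dP.
  by move=> i; rewrite distrC; case: (ord2P i) => ->; [exact: le_trans h1 dP|exact: le_trans h2 dP].
have close2 : C1_close (Ca * d) q1 Q.
  move=> z zO; have [h0 h1 h2] := clq z zO; rewrite distrC; split; first exact: le_trans dQ.
  by move=> i; rewrite distrC; case: (ord2P i) => ->; [exact: le_trans h1 dQ|exact: le_trans h2 dQ].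
have de : 0 <= Ca * d <= e0.
  by rewrite mulr_ge0//=; exact: small.
have [C1p2 C1q2 DD Een] := pert (Ca * d) p1 q1 de C1p C1q close1 close2.
have tr0 (y : R) : 0 <= y <= 2 * pi -> P (1, y) = P0 y /\ Q (1, y) = Q0 y by exact: tr.
have B1 : Bplus_NM eps gam P0 Q0 N M (p1, q1).
  split.
    split; [by rewrite NE|by rewrite NE|move=> j jN].
    have j02 := node_itv R jN; have [<- <-] := tr0 _ j02.
    by split; [exact: trp|exact: trq].
  split; last by move=> z zO; exact: (DD z zO).1.
  split; [exact: C1p|exact: C1q|move=> y y02]; have [<- <-] := tr0 _ y02.
  by split; [exact: trp|exact: trq].
(* The reflected pair is in general no Fourier-Chebyshev sum, but it competes in [Bplus]: the traces
   of [p1] and [q1] are exact on the whole edge, and the perturbation bound keeps its determinant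
   positive. *)
have B2 : Bplus eps gam P0 Q0 (fun z => 2 * P z + (- 1) * p1 z, fun z => 2 * Q z + (- 1) * q1 z).
  split; last by move=> z zO; exact: (DD z zO).2.
  split; [exact: C1p2|exact: C1q2|move=> y y02 /=]; rewrite trp// trq//; have [<- <-] := tr0 y y02.
  by split; ring.
(* Minimality is used twice: that of the discrete minimizer against [(p1, q1)], and that of [(P, Q)]
   against the reflected pair. *)
apply: le_trans (NMmin _ B1) _; apply: le_trans (Een (Emin _ B2)) _.
rewrite leeD2l// lee_fin.
have := sqr_rate_le R s M1 n1; rewrite -/d -NE.
set r := _ + _ => rd.
have r0 : 0 <= r by rewrite addr_ge0// exprz_ge0.
have c0 : 0 <= C1 * Ca ^+ 2 by rewrite mulr_ge0 ?exprn_ge0.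
rewrite exprMn mulrA; apply: le_trans (ler_wpM2l c0 rd) _.
by rewrite [leRHS]mulrDl mul1r mulrA lerDl.
Qed.
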